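(* Let $f$, $X$, $\rho_0$, $\mathcal L_0$ be as in the context, and assume that $c$ is preperiodic: $c_{n_0}$ is periodic of minimal period $n_1\ge1$, where $n_0\ge2$ is minimal with $c_{n_0}$ periodic. Let $\varphi\in C^1([a_0,b])$ and let $$\Psi(z)=\sum_{n=0}^\infty\int_{a_0}^b z^n\mathcal L_0^n(\rho_0X)(x)\varphi'(x)\,dx .$$ Then $\Psi(z)$ admits a meromorphic extension to a disc of radius $>1$. The poles of $\Psi(z)$ in the closed unit disc are at most simple poles at the $n_1$th roots of unity. Assume in addition either (a) $\varphi(c_k)=0$ for all $k\ge n_0$ and $\int\varphi\rho_0\,dx=0$, or (b) $X(c_k)=0$ for all $k\ge1$. Then the residues of all poles of modulus one of $\Psi(z)$ vanish, and $$\Psi(1)=\lim_{k\to\infty}\sum_{n=0}^k\int_{a_0}^b\mathcal L_0^n(\rho_0X)(x)\varphi'(x)\,dx .$$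
   Context: Setting. Let $a<c<b$, $I=[a,b]$, and let $f:I\to I$ be continuous such that: (i) $f$ is strictly increasing on $I_+=[a,c]$ and strictly decreasing on $I_-=[c,b]$; (ii) for $\sigma=\pm$, $f|_{I_\sigma}$ extends to a $C^3$ map on a neighbourhood of $I_\sigma$ and $\inf|f'|_{I_\sigma}|>1$; (iii) $c$ is not periodic under $f$; (iv) $f$ is topologically mixing on $[f^2(c),f(c)]$. Write $c_k=f^k(c)$. $f$ has a unique absolutely continuous invariant probability measure; its density $\rho_0$ is of bounded variation, is extended by $0$ to $\mathbb R$ (it is supported in $[c_2,c_1]$), and is taken with only regular discontinuities (at each $x$, $2\rho_0(x)$ is the sum of the left and right limits). Inverse branches. $J=(-\infty,f(c)]$; $\chi=1$ on the interior of $J$, $\chi(f(c))=1/2$, $\chi=0$ outside $J$. The two inverse branches of $f$ are extended to $C^3$ maps $\psi_+:J\to(-\infty,c]$ (strictly increasing, onto) and $\psi_-:J\to[c,\infty)$ (strictly decreasing, onto) with $\sup|\psi_\pm'|<1$. $a_0\le a$ denotes the unique fixed point of $\psi_+$. Operator. $\mathcal L_0\varphi(x)=\chi(x)\varphi(\psi_+(x))-\chi(x)\varphi(\psi_-(x))$. Perturbation field. $X:\mathbb R\to\mathbb R$ satisfies $\sup|X|\le1$, $X|_{f(I)}$ extends to a $C^2$ function in a neighbourhood of $f(I)$, and $X'$ (derivative in the sense of distributions) is a function of bounded variation supported in $[a,b]$. It is assumed that for small $|t|$ (possibly one-sided: only $t\ge0$ or only $t\le0$) the map $f_t=f+tX\circ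 f$ sends $I$ into itself. $C^1([a_0,b])$ is the set of functions on $[a_0,b]$ which extend to $C^1$ functions in an open neighbourhood of $[a_0,b]$. The power series $\Psi$ converges in the open unit disc. *)

(* Defs.v *)
From HB Require Import structures.
From mathcomp Require Import all_boot all_order all_algebra.
From mathcomp Require Import complex.
From mathcomp Require Import all_classical all_reals all_analysis.
Set Implicit Arguments.
Unset Strict Implicit.
Unset Printing Implicit Defensive.
Import Order.TTheory GRing.Theory Num.Theory.
Import numFieldNormedType.Exports.

Local Open Scope classical_set_scope.
Local Open Scope ring_scope.

(* R[i] with its numClosedFieldType structure made explicit, so that the topology,
   norm and derivative of normed modules over a field apply to C -> C. *)
Definition Cplx (R : realType) : numClosedFieldType := R[i].

Definition toC (R : realType) (x : R) : Cplx R := x%:C%C.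

Section ComplexFunctions.
Variable R : realType.
Local Notation C := (Cplx R).

Definition holomorphic_at (F : C -> C) (z0 : C) : Prop :=
  \forall z \near z0, derivable F z 1.

Definition is_pole (F : C -> C) (z0 : C) (m : nat) : Prop :=
  (0 < m)%N /\
  exists h : C -> C, [/\ holomorphic_at h z0, h z0 != 0 &
    \forall z \near z0^', F z = h z / (z - z0) ^+ m].

(* Removable singularities are required to be removed; only the value of F at
   a genuine pole is left unconstrained. *)
Definition meromorphic_on (U : set C) (F : C -> C) : Prop :=
  forall z, U z -> holomorphic_at F z \/ exists m, is_pole F z m.

(* If F z = h z / (z - z0)^(n+1) near z0 with h holomorphic, then the
   coefficient of (z - z0)^(-1) in the Laurent expansion of F at z0 is the
   n-th Taylor coefficient of h at z0. *)
Definition is_residue (F : C -> C) (z0 r : C) : Prop :=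
  exists (n : nat) (h : C -> C), [/\ holomorphic_at h z0,
    \forall z \near z0^', F z = h z / (z - z0) ^+ n.+1 &
    r = derive1n n h z0 / (n`!)%:R].

Definition Cdisc (r : R) : set C := [set z | `|z| < toC r].

End ComplexFunctions.

Section RealFunctions.
Variable R : realType.
Local Notation leb := (@lebesgue_measure R).

Definition Ck_on (k : nat) (U : set R) (g : R -> R) : Prop :=
  forall j : nat, (j <= k)%N -> forall x, U x ->
    {for x, continuous (derive1n j g)} /\ ((j < k)%N -> derivable (derive1n j g) x 1).

Definition Ck_extension (k : nat) (A : set R) (f g : R -> R) : Prop :=
  (forall x, A x -> g x = f x) /\
  exists U : set R, [/\ open U, A `<=` U & Ck_on k U g].

Definition extends_Ck (k : nat) (A : set R) (f : R -> R) : Prop :=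
  exists g, Ck_extension k A f g.

Definition BVR (g : R -> R) : Prop :=
  exists M : R, forall x y, x <= y -> (total_variation x y g <= M%:E)%E.

Definition regular_discontinuities (g : R -> R) : Prop :=
  forall x, exists l r : R,
    [/\ g y @[y --> x^'-] --> l, g y @[y --> x^'+] --> r & 2 * g x = l + r].

Definition test_function (eta : R -> R) : Prop :=
  (forall (k : nat) x, derivable (derive1n k eta) x 1) /\
  exists M : R, forall x, M < `|x| -> eta x = 0.

Definition distributional_derivative (X g : R -> R) : Prop :=
  [/\ locally_integrable setT X, locally_integrable setT g &
    forall eta, test_function eta ->
      (\int[leb]_(x in setT) (X x * derive1 eta x) =
       - \int[leb]_(x in setT) (g x * eta x))%R].

End RealFunctions.

Section Dynamics.
Variable R : realType.
Local Notation leb := (@lebesgue_measure R).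

Definition periodic_point (f : R -> R) (x : R) : Prop :=
  exists n : nat, (0 < n)%N /\ iter n f x = x.

Definition minimal_period (f : R -> R) (x : R) (n : nat) : Prop :=
  [/\ (0 < n)%N, iter n f x = x &
    forall m : nat, (0 < m < n)%N -> iter m f x <> x].

(* relatively open subsets of K are written K `&` U with U open in R *)
Definition topologically_mixing_on (f : R -> R) (K : set R) : Prop :=
  forall U V : set R, open U -> open V ->
    K `&` U !=set0 -> K `&` V !=set0 ->
    exists N : nat, forall n : nat, (N <= n)%N ->
      (iter n f @` (K `&` U)) `&` (K `&` V) !=set0.

Definition piecewise_expanding_on (f : R -> R) (A : set R) : Prop :=
  exists g, Ck_extension 3 A f g /\
    (1%:E < ereal_inf [set `|derive1 g x|%:E | x in A])%E.

(* f is a total function R -> R of which only the values on [a, b] matter. *)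
Record expanding_unimodal (a c b : R) (f : R -> R) : Prop := {
  eu_order : a < c < b;
  eu_maps : f @` `[a, b] `<=` `[a, b];
  eu_continuous : {within `[a, b], continuous f};
  eu_increasing : {in `[a, c] &, {homo f : x y / x < y}};
  eu_decreasing : {in `[c, b] &, {homo f : x y / x < y >-> y < x}};
  eu_expanding_l : piecewise_expanding_on f `[a, c];
  eu_expanding_r : piecewise_expanding_on f `[c, b];
  eu_aperiodic : ~ periodic_point f c;
  eu_mixing : topologically_mixing_on f `[f (f c), f c]
}.

Definition ac_invariant_probability (a b : R) (f : R -> R)
    (mu : probability (measurableTypeR R) R) : Prop :=
  [/\ mu `<< leb, mu `[a, b]%classic = 1%E &
    forall A : set R, measurable A -> mu (`[a, b]%classic `&` f @^-1` A) = mu A].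

Record invariant_density (a c b : R) (f rho : R -> R) : Prop := {
  id_ge0 : forall x, 0 <= rho x;
  id_density : exists mu : probability (measurableTypeR R) R,
    ac_invariant_probability a b f mu /\
    forall A : set R, measurable A -> mu A = (\int[leb]_(x in A) (rho x)%:E)%E;
  id_BV : BVR rho;
  id_support : forall x, x \notin `[f (f c), f c] -> rho x = 0;
  id_regular : regular_discontinuities rho
}.

Definition contracting_on (psi : R -> R) (J : set R) : Prop :=
  exists g, Ck_extension 3 J psi g /\
    (ereal_sup [set `|derive1 g x|%:E | x in J] < 1%:E)%E.

(* Values of psip and psim outside `]-oo, f c] are irrelevant: chi vanishes there. *)
Record inverse_branches (a c b : R) (f psip psim : R -> R) : Prop := {
  ib_inverse_l : forall x, x \in `[a, c] -> psip (f x) = x;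
  ib_inverse_r : forall x, x \in `[c, b] -> psim (f x) = x;
  ib_increasing : {in `]-oo, f c] &, {homo psip : x y / x < y}};
  ib_decreasing : {in `]-oo, f c] &, {homo psim : x y / x < y >-> y < x}};
  ib_onto_l : psip @` `]-oo, f c] = `]-oo, c]%classic;
  ib_onto_r : psim @` `]-oo, f c] = `[c, +oo[%classic;
  ib_contracting_l : contracting_on psip `]-oo, f c];
  ib_contracting_r : contracting_on psim `]-oo, f c]
}.

Definition chi (c : R) (f : R -> R) (x : R) : R :=
  if x < f c then 1 else if x == f c then 2^-1 else 0.

Definition L0 (c : R) (f psip psim phi : R -> R) : R -> R :=
  fun x => chi c f x * phi (psip x) - chi c f x * phi (psim x).

Definition preserves_interval (a b : R) (h : R -> R) : Prop :=
  h @` `[a, b] `<=` `[a, b].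

Record perturbation_field (a b : R) (f X : R -> R) : Prop := {
  pf_bound : forall x, `|X x| <= 1;
  pf_C2 : extends_Ck 2 (f @` `[a, b]) X;
  pf_BV : exists g, [/\ distributional_derivative X g, BVR g &
    forall x, x \notin `[a, b] -> g x = 0];
  pf_family : exists2 e : R, 0 < e &
    (forall t, 0 <= t < e -> preserves_interval a b (fun x => f x + t * X (f x)))
    \/
    (forall t, - e < t <= 0 -> preserves_interval a b (fun x => f x + t * X (f x)))
}.

Definition susceptibility_term (a0 b c : R) (f psip psim rho X phi : R -> R)
    (n : nat) : R :=
  (\int[leb]_(x in `[a0, b])
     (iter n (L0 c f psip psim) (fun y => rho y * X y) x * derive1 phi x))%R.

(* partial sums sum_(n < k) of the power series Psi at z *)
Definition susceptibility_partial (a0 b c : R)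
    (f psip psim rho X phi : R -> R) (z : Cplx R) : nat -> Cplx R :=
  fun k => \sum_(n < k)
    z ^+ n * toC (susceptibility_term a0 b c f psip psim rho X phi n).

End Dynamics.

(* Main.v *)
Require Import Defs.
From HB Require Import structures.
From mathcomp Require Import all_boot all_order all_algebra.
From mathcomp Require Import complex ring lra zify.
From mathcomp Require Import all_classical all_reals all_analysis.
From mathcomp Require Import measurable_realfun.
Import Order.TTheory GRing.Theory Num.Theory.
Import numFieldNormedType.Exports.
Local Open Scope classical_set_scope.
Local Open Scope ring_scope.
Set Implicit Arguments.
Unset Strict Implicit.
Unset Printing Implicit Defensive.

(* The postcritical set F is finite, so f is Markov on [c_2, c_1] and the transfer
   operator preserves functions that are log-Lipschitz off F. Topological mixing
   gives a uniform lower bound after finitely many steps, hence exponential mixing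
   in the sup norm off F by coupling, and identifies rho0 with the limit of the
   iterates h_m of a smooth density. Each h_m X is a sum of jumps at the points of
   F and of a primitive of a bounded function. L0 transports a jump at p to one at
   f p with the same coefficient, while on primitives it is conjugate to the
   transfer operator. Integrating against phi', the n-th term is, up to
   exponentially small errors, a combination of the numbers phi(f^n p), p in F,
   and of the mean of phi. It is therefore n1-periodic in n for n >= n0 up to
   O(tau^n), and under (a) or (b) the periodic part vanishes. A periodic sequence
   has a generating function with simple poles at roots of unity only, and an
   O(tau^n) sequence one that is holomorphic on |z| < 1/tau. *)

(** * Calculus off a finite set *)

Section FiniteExceptions.
Variable R : realType.
Local Notation leb := (@lebesgue_measure R).
Implicit Types (F : seq R) (p q : R).

(** The obstacle is the regularity of [rho0]: the coupling shows that it is log-Lipschitz off [F],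
    which says nothing on the regularity of the derivative of [rho0 X]. The iterates h_m have two
    derivatives off [F], bounded by multiples of h_m uniformly in m, so the decomposition into jumps
    and a primitive is applied to h_m X. The price is an error of order 2^n tau^m in the n-th term,
    since [L0] carries no weight |psi'| and may double the sup norm at each step; m is therefore
    taken proportional to the index. The jumps and the mass of the derivative depend on m, but no
    limit of them is needed: the terms of index n and n + n1 are compared through the same h_m, and
    these data cancel before any bound on them is required. The derivative of h_m X has no sign;
    adding a large multiple of the indicator of [c_2, c_1] puts it in the cone on which the coupling
    acts. Pointwise statements are made off [F] throughout. *)

Lemma derive1_is_derive (g : R -> R) x d :
  derivable g x 1 -> derive1 g x = d -> is_derive x (1 : R) g d.
Proof. by move=> dg <-; rewrite derive1E; exact/derivableP. Qed.

Lemma is_derive_derive1 (g : R -> R) x d :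
  is_derive x (1 : R) g d -> derive1 g x = d.
Proof. by move=> dg; rewrite derive1E derive_val. Qed.

Lemma is_derive_constant (k x : R) : is_derive x (1 : R) (fun=> k) 0.
Proof. exact: (@is_derive_cst R R R k x 1). Qed.

Lemma is_derive_scalel (g : R -> R) x d k : is_derive x (1 : R) g d ->
  is_derive x (1 : R) (fun z => k * g z) (k * d).
Proof. by move=> dg; exact: (@is_deriveZ R R R g k x 1 d). Qed.

Lemma is_derive_mul (g h : R -> R) x d e :
  is_derive x (1 : R) g d -> is_derive x (1 : R) h e ->
  is_derive x (1 : R) (fun z => g z * h z) (g x * e + d * h x).
Proof.
move=> dg dh; rewrite [d * _]mulrC; exact: (@is_deriveM R R g h x 1 d e).
Qed.

Lemma is_derive_add (g h : R -> R) x d e :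
  is_derive x (1 : R) g d -> is_derive x (1 : R) h e ->
  is_derive x (1 : R) (fun z => g z + h z) (d + e).
Proof. by move=> dg dh; exact: (@is_deriveD R R R g h x 1 d e). Qed.

Lemma is_derive_sub (g h : R -> R) x d e :
  is_derive x (1 : R) g d -> is_derive x (1 : R) h e ->
  is_derive x (1 : R) (fun z => g z - h z) (d - e).
Proof. by move=> dg dh; exact: (@is_deriveB R R R g h x 1 d e). Qed.

(** The mean value theorem holds between two exceptional points, and the continuity of [g] on the
    whole interval glues the pieces; the induction cuts [[p, q]] at one point of [F] at a time. *)
Lemma is_derive0_const F (g : R -> R) p q : p <= q ->
  {within `[p, q], continuous g} ->
  (forall x, p < x < q -> x \notin F -> is_derive x (1 : R) g 0) ->
  g p = g q.
Proof.
elim: F p q => [|r F IH] p q pq cg dg.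
  have [|c _] := @MVT_segment R g (fun=> 0) p q pq _ cg.
    by move=> x; rewrite in_itv/= => xpq; exact: dg.
  by rewrite mul0r => /eqP; rewrite subr_eq0 => /eqP.
have [/andP[pr rq]|rpq] := boolP (p < r < q); last first.
  apply: IH => // x xpq xF; apply: dg => //.
  rewrite inE negb_or xF andbT; apply: contraNneq rpq => <-; exact: xpq.
transitivity (g r).
  apply: IH; first exact: ltW.
  - apply: continuous_subspaceW cg.
    by apply: subset_itvl; rewrite bnd_simp ltW.
  - move=> x /andP[px xr] xF; apply: dg; first by rewrite px (lt_trans xr).
    by rewrite inE negb_or xF andbT lt_eqF.
apply: IH; first exact: ltW.
- apply: continuous_subspaceW cg.
  by apply: subset_itvr; rewrite bnd_simp ltW.
- move=> x /andP[rx xq] xF; apply: dg; first by rewrite (lt_trans pr).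
  by rewrite inE negb_or xF andbT gt_eqF.
Qed.

Lemma measurable_fun_seq (F : seq R) (k : R -> R) :
  measurable_fun [set x | x \in F] k.
Proof.
elim: F => [|r F IH].
  have -> : [set x : R | x \in [::]] = set0 by apply/seteqP; split.
  exact: measurable_fun_set0.
have -> : [set x | x \in r :: F] = [set r] `|` [set x | x \in F].
  apply/seteqP; split => x /=; rewrite inE.
    by case/orP => [/eqP->|]; [left|right].
  by case=> [->|->]; rewrite ?eqxx ?orbT.
apply/measurable_funU => //.
  elim: F {IH} => [|s F IH].
    have -> : [set x : R | x \in [::]] = set0 by apply/seteqP; split.
    exact: measurable0.
  have -> : [set x | x \in s :: F] = [set s] `|` [set x | x \in F].
    apply/seteqP; split => x /=; rewrite inE.
      by case/orP => [/eqP->|]; [left|right].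
    by case=> [->|->]; rewrite ?eqxx ?orbT.
  exact: measurableU.
by split => //; exact: measurable_fun_set1.
Qed.

Lemma measurable_seq (F : seq R) : measurable [set x | x \in F].
Proof.
elim: F => [|s F IH].
  have -> : [set x : R | x \in [::]] = set0 by apply/seteqP; split.
  exact: measurable0.
have -> : [set x | x \in s :: F] = [set s] `|` [set x | x \in F].
  apply/seteqP; split => x /=; rewrite inE.
    by case/orP => [/eqP->|]; [left|right].
  by case=> [->|->]; rewrite ?eqxx ?orbT.
exact: measurableU.
Qed.

Lemma open_not_mem (F : seq R) : open [set x | x \notin F].
Proof.
elim: F => [|s F IH].
  have -> : [set x : R | x \notin [::]] = setT by apply/seteqP; split.
  exact: openT.
have -> : [set x | x \notin s :: F] = ~` [set s] `&` [set x | x \notin F].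
  apply/seteqP; split => x /=; rewrite inE negb_or.
    by case/andP => /eqP.
  by case=> /eqP -> ->.
apply: openI => //; apply: closed_openC; apply: accessible_closed_set1; apply: hausdorff_accessible; exact: Rhausdorff.
Qed.

Lemma measurable_fun_pcont F (k : R -> R) p q :
  (forall x, p < x < q -> x \notin F -> {for x, continuous k}) ->
  measurable_fun `[p, q] k.
Proof.
move=> ck.
pose F' := p :: q :: F.
have : measurable_fun ((`]p, q[ `&` [set x | x \notin F']) `|` [set x | x \in F']) k.
  apply/measurable_funU.
  - by apply: measurableI => //; apply: open_measurable; exact: open_not_mem.
  - exact: measurable_seq.
  split; last exact: measurable_fun_seq.
  apply: open_continuous_measurable_fun.
    by apply: openI; [exact: interval_open|exact: open_not_mem].
  move=> x; rewrite inE/= in_itv/= => -[xpq]; rewrite !inE !negb_or => /and3P[_ _ xF].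
  exact: ck.
apply: measurable_funS.
  apply: measurableU; last exact: measurable_seq.
  by apply: measurableI => //; apply: open_measurable; exact: open_not_mem.
move=> x /=; rewrite in_itv/= => /andP[px xq].
have [xF|xF] := boolP (x \in F'); first by right.
left; split => //; rewrite in_itv/=; move: xF; rewrite !inE !negb_or => /and3P[xp xq' _].
by rewrite !lt_neqAle eq_sym xp px xq' xq.
Qed.

Lemma integrable_pcont F (k : R -> R) p q M :
  (forall x, p < x < q -> x \notin F -> {for x, continuous k}) ->
  (forall x, p <= x <= q -> `|k x| <= M) ->
  leb.-integrable `[p, q] (EFin \o k).
Proof.
move=> ck bk; apply: measurable_bounded_integrable => //.
- by rewrite /= lebesgue_measure_itv/=; case: ifP => _; rewrite ?ltry// -EFinB ltry.
- exact: measurable_fun_pcont ck.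
- exists M; split; first exact: num_real.
  move=> y My x /=; rewrite in_itv/= => xpq.
  by rewrite (le_trans (bk _ xpq))// ltW.
Qed.

(** The indefinite integral of [k] and the function [g] are both continuous with the same derivative
    off [F], so [is_derive0_const] applies to their difference. The bound on [k] gives
    integrability. *)
Lemma FTC_pcont F (g k : R -> R) p q M : p <= q ->
  {within `[p, q], continuous g} ->
  (forall x, p < x < q -> x \notin F -> is_derive x (1 : R) g (k x)) ->
  (forall x, p < x < q -> x \notin F -> {for x, continuous k}) ->
  (forall x, p <= x <= q -> `|k x| <= M) ->
  \int[leb]_(x in `[p, q]) k x = g q - g p.
Proof.
move=> pq cg dg ck bk.
have ik := integrable_pcont ck bk.
pose G x := \int[leb]_(t in `[p, x]) k t.
have cG : {within `[p, q], continuous G} := parameterized_integral_continuous pq ik.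
have : (G - g) p = (G - g) q.
  apply: (@is_derive0_const F) => //.
    by move=> x; apply: cvgB; [exact: cG|exact: cg].
  move=> x xpq xF; have /andP[px xq] := xpq.
  have [dG GE] := continuous_FTC1_closed xq ik px (ck _ xpq xF).
  rewrite -(subrr (k x)); apply: is_deriveB; last exact: dg.
  exact: derive1_is_derive dG GE.
rewrite /GRing.add/= /GRing.opp/=.
rewrite {1}/G set_itv1 Rintegral_set1 => /eqP.
by rewrite sub0r eq_sym subr_eq addrC => /eqP.
Qed.

End FiniteExceptions.

(** * Components of the complement of a finite set *)

Section Components.
Variable R : realType.
Implicit Types (F : seq R) (x y z : R).

(** Both points lie strictly on the same side of every point of [F]. This is membership in the same
    component of the complement of [F], stated without intervals, and it implies that neither point
    is in [F]. *)
Definition same_comp F x y : Prop := forall p, p \in F -> 0 < (p - x) * (p - y).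

Lemma same_compC F x y : same_comp F x y -> same_comp F y x.
Proof. by move=> H p pF; rewrite mulrC; exact: H. Qed.

Lemma same_comp_refl F x : x \notin F -> same_comp F x x.
Proof.
move=> xF p pF; rewrite -expr2 exprn_even_gt0//= subr_eq0.
by apply: contraNneq xF => <-.
Qed.

Lemma same_comp_notin F x y : same_comp F x y -> x \notin F.
Proof. by move=> H; apply/negP => /H; rewrite subrr mul0r ltxx. Qed.

Lemma same_comp_between F x y z : same_comp F x y ->
  Num.min x y <= z <= Num.max x y -> same_comp F x z.
Proof.
move=> H zxy p pF; have := H p pF; move: zxy.
case: (leP x y) => xy /andP[xz zy] Hp.
- have [px|px|px] := ltgtP p x; last by rewrite px subrr mul0r ltxx in Hp.
    by rewrite nmulr_rgt0 ?subr_lt0 ?(lt_le_trans px)//.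
  have {}Hp : 0 < p - y by rewrite -(pmulr_rgt0 _ (_ : 0 < p - x)) ?subr_gt0.
  by rewrite pmulr_rgt0 ?subr_gt0// (le_lt_trans zy)// -subr_gt0.
- have [px|px|px] := ltgtP p x; last by rewrite px subrr mul0r ltxx in Hp.
    have {}Hp : p - y < 0 by rewrite -(nmulr_rgt0 _ (_ : p - x < 0)) ?subr_lt0.
    by rewrite nmulr_rgt0 ?subr_lt0// (lt_le_trans _ xz)// -subr_lt0.
  by rewrite pmulr_rgt0 ?subr_gt0// (le_lt_trans zy).
Qed.

Lemma same_comp_intro F x y :
  (forall z, Num.min x y <= z <= Num.max x y -> z \notin F) -> same_comp F x y.
Proof.
move=> H p pF.
have := contraL (H p) pF; case: (leP x y) => xy;
  rewrite negb_and -!ltNge => /orP[px|px]; nra.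
Qed.

Lemma near_same_comp F x : x \notin F -> \forall y \near x, same_comp F x y.
Proof.
move=> xF; elim: F xF => [|p F IH]; first by move=> _; near=> y => p; rewrite in_nil.
rewrite inE negb_or => /andP[xp /IH H].
have Hp : \forall y \near x, 0 < (p - x) * (p - y).
  have [px|px] := ltP p x.
    near=> y; rewrite nmulr_rgt0 ?subr_lt0//; near: y; exact: lt_nbhsr.
  have {}px : x < p by rewrite lt_neqAle xp.
  near=> y; rewrite pmulr_rgt0 ?subr_gt0//; near: y; exact: lt_nbhsl.
near=> y => q; rewrite inE => /orP[/eqP ->|qF]; first by near: y.
by have : same_comp F x y by [near: y]; exact.
Unshelve. all: by end_near. Qed.

Lemma MVT_lipschitz (g dg : R -> R) (x y L : R) :
  (forall z, Num.min x y <= z <= Num.max x y -> is_derive z (1 : R) g (dg z)) ->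
  (forall z, Num.min x y <= z <= Num.max x y -> `|dg z| <= L) ->
  `|g x - g y| <= L * `|x - y|.
Proof.
wlog xy : x y / x <= y.
  move=> H dgz bg; have [xy|xy] := leP x y; first exact: H.
  by rewrite distrC (distrC x); apply: H (ltW xy) _ _; rewrite minC maxC.
rewrite min_l// max_r// => dgz bg.
have [||z zxy E] := @MVT_segment R g dg x y xy.
- by move=> z zxy; apply: dgz; rewrite !(itvP zxy).
- by apply: derivable_within_continuous => z zxy; have [] := dgz z zxy.
- by rewrite distrC E normrM (distrC x); apply: ler_wpM2r => //; exact: bg.
Qed.

Lemma same_comp_lipschitz F (g dg : R -> R) (x y L : R) : same_comp F x y ->
  (forall z, same_comp F x z -> is_derive z (1 : R) g (dg z)) ->
  (forall z, same_comp F x z -> `|dg z| <= L) ->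
  `|g x - g y| <= L * `|x - y|.
Proof.
by move=> xy dgz bg; apply: (MVT_lipschitz (dg := dg)) => z /(same_comp_between xy);
  [exact: dgz|exact: bg].
Qed.

(** The hypothesis bounds the derivative of [ln v] by [L] on the component, so [ln v] is
    [L]-Lipschitz there. *)
Lemma same_comp_loglip F (v dv : R -> R) (x y L : R) : same_comp F x y ->
  (forall z, same_comp F x z -> 0 < v z) ->
  (forall z, same_comp F x z -> is_derive z (1 : R) v (dv z)) ->
  (forall z, same_comp F x z -> `|dv z| <= L * v z) ->
  v x <= expR (L * `|x - y|) * v y.
Proof.
move=> xy v0 dvz bv.
have H : `|(@ln R \o v) x - (@ln R \o v) y| <= L * `|x - y|.
  apply: (@same_comp_lipschitz F _ (fun z => (v z)^-1 * dv z) _ _ _ xy).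
    by move=> z xz; apply: is_derive1_comp; [apply: is_derive1_ln; exact: v0|exact: dvz].
  move=> z xz; rewrite normrM normfV (gtr0_norm (v0 _ xz)) mulrC.
  by rewrite ler_pdivrMr ?v0// bv.
have vx0 : 0 < v x by apply: v0; apply: same_comp_refl; exact: same_comp_notin xy.
have vy0 := v0 _ xy.
rewrite -ler_ln ?posrE ?mulr_gt0 ?expR_gt0// lnM ?posrE ?expR_gt0//.
by rewrite expRK -lerBlDr (le_trans (ler_norm _) H).
Qed.

End Components.

(** * Inverse branches and log-Lipschitz densities *)

Section Branches.
Variable R : realType.
Implicit Types (F : seq R) (x y z A : R).

(* [s] is the sign of [psi'], so that [s * psi'] is the weight [|psi'|]. *)
Record branch (c2 c1 : R) F (th La D s : R) (psi : R -> R) : Prop := {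
  br_sign : `|s| = 1;
  br_der1 : forall x, x < c1 -> derivable psi x 1;
  br_der2 : forall x, x < c1 -> derivable (derive1 psi) x 1;
  br_der3 : forall x, x < c1 -> derivable (derive1 (derive1 psi)) x 1;
  br_weight : forall x, x < c1 -> 0 <= s * derive1 psi x <= th;
  br_notin : forall x, x < c1 -> x \notin F -> psi x \notin F;
  br_out : forall x, x < c2 -> ~~ (c2 <= psi x <= c1);
  br_low : forall x, x < c1 -> x \notin F -> c2 <= psi x <= c1 ->
    1 <= La * (s * derive1 psi x);
  br_bound2 : forall x, x < c1 -> x \notin F -> c2 <= psi x <= c1 ->
    `|derive1 (derive1 psi) x| <= D * (s * derive1 psi x);
  br_bound3 : forall x, x < c1 -> x \notin F -> c2 <= psi x <= c1 ->
    `|derive1 (derive1 (derive1 psi)) x| <= D * (s * derive1 psi x)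
}.

Definition half_transfer (c1 s : R) (psi h : R -> R) : R -> R :=
  fun x => if x < c1 then s * derive1 psi x * h (psi x) else 0.

(** The cone of densities on which mixing is proved: [A] is a Lipschitz constant of [ln h] on each
    component. The multiplicative form admits an [h] that vanishes on a whole component, and values
    on [F] are unconstrained. *)
Record loglip (c2 c1 : R) F A (h : R -> R) : Prop := {
  ll_ge0 : forall x, x \notin F -> 0 <= h x;
  ll_out : forall x, x \notin F -> ~~ (c2 <= x <= c1) -> h x = 0;
  ll_lip : forall x y, same_comp F x y -> h x <= expR (A * `|x - y|) * h y
}.

Section OneBranch.
Variables (c2 c1 : R) (F : seq R) (th La D s : R) (psi : R -> R).
Hypothesis c12 : c2 < c1.
Hypothesis c2F : c2 \in F.
Hypothesis c1F : c1 \in F.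
Hypothesis th0 : 0 <= th.
Hypothesis La0 : 0 < La.
Hypothesis bpsi : branch c2 c1 F th La D s psi.

Lemma same_comp_lt x y p : p \in F -> same_comp F x y -> (x < p) = (y < p).
Proof.
move=> pF /(_ _ pF) H; apply/idP/idP => Hp; rewrite ltNge; apply/negP => Hq; nra.
Qed.

Lemma same_comp_le x y p : p \in F -> same_comp F x y -> (p <= x) = (p <= y).
Proof. by move=> pF xy; rewrite !leNgt (same_comp_lt pF xy). Qed.

Lemma same_comp_le' x y p : p \in F -> same_comp F x y -> (x <= p) = (y <= p).
Proof.
move=> pF xy; rewrite !le_eqVlt (same_comp_lt pF xy).
have xF := same_comp_notin xy; have yF := same_comp_notin (same_compC xy).
have -> : (x == p) = false by apply/negbTE; apply: contraNneq xF => ->.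
by have -> : (y == p) = false by apply/negbTE; apply: contraNneq yF => ->.
Qed.

Lemma same_comp_itv x y : same_comp F x y ->
  (c2 <= x <= c1) = (c2 <= y <= c1).
Proof. by move=> xy; rewrite (same_comp_le c2F xy) (same_comp_le' c1F xy). Qed.

Lemma branch_norm x : x < c1 -> `|derive1 psi x| = s * derive1 psi x.
Proof.
move=> xc; have /andP[w0 _] := br_weight bpsi xc.
by rewrite -(ger0_norm w0) normrM (br_sign bpsi) mul1r.
Qed.

Lemma branch_contract x y : x < c1 -> y < c1 ->
  `|psi x - psi y| <= th * `|x - y|.
Proof.
move=> xc yc.
have le z : Num.min x y <= z <= Num.max x y -> z < c1.
  by move=> /andP[_ zxy]; rewrite (le_lt_trans zxy)// gt_max xc yc.
apply: (@MVT_lipschitz R psi (derive1 psi)) => z /le zc.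
  by apply: derive1_is_derive => //; exact: br_der1 bpsi _ zc.
by rewrite branch_norm//; have /andP[] := br_weight bpsi zc.
Qed.

(** By the intermediate value theorem a point between [psi x] and [psi y] is [psi t] with [t]
    between [x] and [y]. Such a [t] is off [F], and [br_notin] says that [psi] maps the complement
    of [F] into itself. *)
Lemma branch_same x y : x < c1 -> y < c1 -> same_comp F x y ->
  same_comp F (psi x) (psi y).
Proof.
move=> xc yc xy; apply: same_comp_intro => z zxy.
have le t : Num.min x y <= t <= Num.max x y -> t < c1.
  by move=> /andP[_ txy]; rewrite (le_lt_trans txy)// gt_max xc yc.
wlog xley : x y xc yc xy zxy le / x <= y.
  move=> H; have [xley|/ltW yx] := leP x y; first exact: (H x y).
  by apply: (H y x); rewrite // 1?minC 1?maxC//; exact: same_compC.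
have [|t txy <-] := @IVT R psi x y z xley _ zxy.
  apply: derivable_within_continuous => t; rewrite in_itv/= => txy.
  by apply: br_der1 bpsi _ _; apply: le; rewrite min_l// max_r.
have txy' : Num.min x y <= t <= Num.max x y.
  by move: txy; rewrite in_itv/= min_l// max_r.
apply: br_notin bpsi _ (le _ txy') _.
exact: same_comp_notin (same_compC (same_comp_between xy txy')).
Qed.

(** Bounded distortion: [br_low] makes the weight positive and [br_bound2] bounds its logarithmic
    derivative by [D]. The condition on [psi x] passes to the whole component of [x], because [c2]
    and [c1] belong to [F]. *)
Lemma branch_loglip x y : x < c1 -> same_comp F x y -> c2 <= psi x <= c1 ->
  s * derive1 psi x <= expR (D * `|x - y|) * (s * derive1 psi y).
Proof.
move=> xc xy xK.
have zP z : same_comp F x z -> [/\ z < c1, z \notin F & c2 <= psi z <= c1].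
  move=> xz; have zc : z < c1 by rewrite -(same_comp_lt c1F xz).
  split=> //; first exact: same_comp_notin (same_compC xz).
  by rewrite -(same_comp_itv (branch_same xc zc xz)).
pose v z := s * derive1 psi z.
apply: (@same_comp_loglip R F v (fun z => s * derive1 (derive1 psi) z) _ _ _ xy).
- move=> z /zP[zc zF zK]; rewrite -(pmulr_rgt0 _ La0).
  by apply: lt_le_trans (br_low bpsi zc zF zK).
- move=> z /zP[zc zF zK]; apply: is_derive_scalel.
  by apply: derive1_is_derive => //; exact: br_der2 bpsi _ zc.
- move=> z /zP[zc zF zK]; rewrite normrM (br_sign bpsi) mul1r.
  exact: br_bound2 bpsi _ zc zF zK.
Qed.

Local Notation half := (half_transfer c1 s psi).

Lemma half_ge0 h x : (forall y, y \notin F -> 0 <= h y) -> x \notin F ->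
  0 <= half h x.
Proof.
move=> h0 xF; rewrite /half_transfer; case: ifPn => // xc.
have /andP[w0 _] := br_weight bpsi xc.
by apply: mulr_ge0 => //; apply: h0; exact: br_notin bpsi _ xc xF.
Qed.

Lemma half_out h x : (forall y, y \notin F -> ~~ (c2 <= y <= c1) -> h y = 0) ->
  x \notin F -> ~~ (c2 <= x <= c1) -> half h x = 0.
Proof.
move=> h0 xF xK; rewrite /half_transfer; case: ifPn => // xc.
rewrite h0 ?mulr0//; first exact: br_notin bpsi _ xc xF.
apply: br_out bpsi _ _; rewrite ltNge; apply: contra xK => ->.
exact: ltW.
Qed.

(** The density is read at two points closer by the factor [th], which contracts its constant [A] by
    [th]; the distortion of the weight adds [D]. If [psi x] falls outside [[c2, c1]], both sides
    vanish. *)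
Lemma half_loglip A h x y : 0 <= A -> loglip c2 c1 F A h -> same_comp F x y ->
  half h x <= expR ((th * A + D) * `|x - y|) * half h y.
Proof.
move=> A0 hh xy; rewrite /half_transfer -(same_comp_lt c1F xy).
case: ifPn => [xc|]; last by rewrite mulr0.
have yc : y < c1 by rewrite -(same_comp_lt c1F xy).
have xy' := branch_same xc yc xy.
have [xK|xK] := boolP (c2 <= psi x <= c1); last first.
  have yK := xK; rewrite (same_comp_itv xy') in yK.
  rewrite !(ll_out hh) ?mulr0//.
    exact: same_comp_notin (same_compC xy').
  exact: same_comp_notin xy'.
have W := branch_loglip xc xy xK.
have H := ll_lip hh xy'.
have /andP[w0 _] := br_weight bpsi xc.
have /andP[w0' _] := br_weight bpsi yc.
have hx0 : 0 <= h (psi x) := ll_ge0 hh (same_comp_notin xy').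
have hy0 : 0 <= h (psi y) := ll_ge0 hh (same_comp_notin (same_compC xy')).
apply: le_trans (ler_pM w0 hx0 W H) _.
rewrite mulrACA -expRD; apply: ler_wpM2r; first exact: mulr_ge0.
rewrite ler_expR mulrDl addrC lerD2r -mulrA mulrCA.
by apply: ler_wpM2l => //; exact: branch_contract.
Qed.

End OneBranch.
End Branches.

(** * Piecewise continuous functions and their primitives *)

Section PiecewiseContinuous.
Variable R : realType.
Local Notation leb := (@lebesgue_measure R).
Implicit Types (F : seq R) (h k : R -> R) (p q x : R).

Definition pcont F h : Prop :=
  (forall x, x \notin F -> {for x, continuous h}) /\
  exists M : R, forall x, `|h x| <= M.

Lemma continuous_near_eq h k x : {for x, continuous k} ->
  (\forall y \near x, h y = k y) -> {for x, continuous h}.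
Proof.
move=> ck hk; have hkx : h x = k x := nbhs_singleton hk.
rewrite /prop_for /continuous_at hkx; apply: cvg_trans ck.
by apply: near_eq_cvg; apply: filterS hk => y ->.
Qed.

Lemma pcontD F h k : pcont F h -> pcont F k -> pcont F (fun x => h x + k x).
Proof.
move=> [ch [M hM]] [ck [M' kM]]; split=> [x xF|].
  by apply: cvgD; [exact: ch|exact: ck].
by exists (M + M') => x; rewrite (le_trans (ler_normD _ _))// lerD.
Qed.

Lemma pcontM F h k : pcont F h -> pcont F k -> pcont F (fun x => h x * k x).
Proof.
move=> [ch [M hM]] [ck [M' kM]]; split=> [x xF|].
  by apply: cvgM; [exact: ch|exact: ck].
by exists (M * M') => x; rewrite normrM ler_pM.
Qed.

Lemma pcont_cst F (r : R) : pcont F (fun=> r).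
Proof. by split=> [x xF|]; [exact: cvg_cst|exists `|r|]. Qed.

Lemma pcontZ F (r : R) h : pcont F h -> pcont F (fun x => r * h x).
Proof. by move=> ph; apply: pcontM => //; exact: pcont_cst. Qed.

Lemma pcontB F h k : pcont F h -> pcont F k -> pcont F (fun x => h x - k x).
Proof.
move=> ph pk; have := pcontD ph (pcontZ (-1) pk).
by congr pcont; apply/funext => x; rewrite mulN1r.
Qed.

Lemma pcont_piece F p q (u v : R) : p \in F -> q \in F ->
  pcont F (fun x => if p <= x <= q then u else v).
Proof.
move=> pF qF; split; last first.
  exists (Num.max `|u| `|v|) => x; rewrite le_max.
  by case: ifP => _; rewrite lexx ?orbT.
move=> x xF; apply: (@continuous_near_eq _ (fun=> if p <= x <= q then u else v)).
  exact: cvg_cst.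
apply: filterS (near_same_comp xF) => y xy.
by rewrite (same_comp_le pF xy) (same_comp_le' qF xy).
Qed.

Lemma pcont_off F h k : pcont F h -> (forall x, x \notin F -> k x = h x) ->
  pcont F (fun x => if x \in F then 0 else k x).
Proof.
move=> [ch [M hM]] kh; split; last first.
  exists M => x; case: ifPn => [xF|xF]; last by rewrite kh.
  by rewrite normr0 (le_trans _ (hM x)).
move=> x xF; apply: (continuous_near_eq (ch _ xF)).
apply: filterS (near_same_comp xF) => y /same_compC/same_comp_notin yF.
by rewrite (negbTE yF) kh.
Qed.

Lemma pcont_integrable F h p q : pcont F h ->
  leb.-integrable `[p, q] (EFin \o h).
Proof.
move=> [ch [M hM]]; apply: (@integrable_pcont R F h p q M) => x.
  by move=> _; exact: ch.
by move=> _; exact: hM.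
Qed.

Lemma Rintegral_itv_split F h p q x : pcont F h -> p <= x -> x <= q ->
  \int[leb]_(t in `[p, q]) h t =
  \int[leb]_(t in `[p, x]) h t + \int[leb]_(t in `[x, q]) h t.
Proof.
move=> ph px xq.
have := @Rintegral_itvB R h (BLeft p) (BRight q) x (pcont_integrable _ _ ph).
rewrite !bnd_simp => /(_ px xq) /eqP; rewrite subr_eq => /eqP ->.
rewrite Rintegral_itv_obnd_cbnd 1?addrC//.
by apply: integrableS (pcont_integrable x q ph) => //; apply: subset_itvr;
  rewrite bnd_simp.
Qed.

Lemma Rintegral_itv_bound h p q M F : p <= q -> pcont F h ->
  (forall x, `|h x| <= M) -> `|\int[leb]_(t in `[p, q]) h t| <= M * (q - p).
Proof.
move=> pq ph hM.
apply: le_trans (le_normr_Rintegral _ _) _ => //.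
  exact: pcont_integrable ph.
apply: (@le_trans _ _ (\int[leb]_(t in `[p, q]) (cst M t))).
  apply: le_Rintegral => //.
    apply: (@pcont_integrable F (fun x => `|h x|)).
    by case: ph => ch _; split=> [x /ch cx|];
      [apply: cvg_norm; exact: cx|exists M => x; rewrite normr_id].
  exact: (@pcont_integrable F (fun=> M) p q (pcont_cst F M)).
rewrite Rintegral_cst// /= lebesgue_measure_itv/= lte_fin.
case: ifPn => [_|]; first by rewrite -EFinD.
by rewrite mulr0 -leNgt => qp; rewrite mulr_ge0 ?subr_ge0// (le_trans _ (hM 0)).
Qed.

(* A primitive of [- k] off [F]. *)
Definition tail (c : R) k x : R := \int[leb]_(t in `[x, c]) k t.

Lemma tail_ge c k x : c <= x -> tail c k x = 0.
Proof.
move=> cx; rewrite /tail.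
have [->|cx'] := eqVneq x c; first by rewrite set_itv1 Rintegral_set1.
rewrite set_itv_ge ?Rintegral_set0//.
by rewrite bnd_simp -ltNge lt_neqAle eq_sym cx' cx.
Qed.

Lemma tail_split F c k x y : pcont F k -> x <= y -> y <= c ->
  tail c k x = \int[leb]_(t in `[x, y]) k t + tail c k y.
Proof. by move=> pk xy yc; exact: Rintegral_itv_split pk xy yc. Qed.

Lemma tail_lipschitz F c k M x y : pcont F k -> (forall x, `|k x| <= M) ->
  `|tail c k x - tail c k y| <= M * `|x - y|.
Proof.
move=> pk kM; wlog xy : x y / x <= y.
  move=> H; have [xy|/ltW xy] := leP x y; first exact: H.
  by rewrite distrC (distrC x); exact: H.
have M0 : 0 <= M by apply: le_trans (kM 0).
rewrite (distrC x) (ger0_norm (_ : 0 <= y - x)) ?subr_ge0//.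
have [yc|/ltW cy] := leP y c.
  by rewrite (tail_split pk xy yc) addrK; exact: Rintegral_itv_bound pk kM.
rewrite (tail_ge k cy) subr0.
have [cx|xc] := leP c x; first by rewrite tail_ge// normr0 mulr_ge0// subr_ge0.
apply: le_trans (Rintegral_itv_bound (ltW xc) pk kM) _.
by rewrite ler_wpM2l// lerD2r.
Qed.

Lemma lipschitz_continuous (g : R -> R) M :
  (forall x y, `|g x - g y| <= M * `|x - y|) -> continuous g.
Proof.
move=> gM x; apply/cvgrPdist_le => /= e e0.
have M1 : 0 < `|M| + 1 by rewrite ltr_wpDl.
near=> y.
apply: le_trans (gM x y) _.
apply: (@le_trans _ _ ((`|M| + 1) * `|x - y|)).
  by rewrite ler_wpM2r// (le_trans (ler_norm _))// lerDl.
rewrite mulrC -ler_pdivlMr//; near: y.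
apply: cvgr_dist_le; [exact: cvg_id|exact: divr_gt0].
Unshelve. all: by end_near. Qed.

Lemma tail_continuous F c k : pcont F k -> continuous (tail c k).
Proof.
move=> pk; have [_ [M kM]] := pk; apply: (@lipschitz_continuous _ M) => x y.
exact: tail_lipschitz pk kM.
Qed.

Lemma is_derive_near_eq (g h : R -> R) x d : (\forall y \near x, g y = h y) ->
  is_derive x (1 : R) h d -> is_derive x (1 : R) g d.
Proof.
by move=> gh dh; apply: near_eq_is_derive dh; apply: filterS gh => y ->.
Qed.

Lemma tail_derive F c k x : pcont F k -> x \notin F -> x != c ->
  (forall y, y \notin F -> c < y -> k y = 0) ->
  is_derive x (1 : R) (tail c k) (- k x).
Proof.
move=> pk xF xc kc; have [ck _] := pk.
have [cx|xc'] := ltP c x.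
  rewrite kc// oppr0; apply: (@is_derive_near_eq _ (fun=> 0)).
  near=> y; apply: tail_ge; apply: ltW; near: y; exact: lt_nbhsr.
have {xc xc'} xc : x < c by rewrite lt_neqAle xc.
(* Any base point to the left of [x] would do. *)
pose G y := \int[leb]_(t in `[x - 1, y]) k t.
apply: (@is_derive_near_eq _ (fun y => tail c k (x - 1) - G y)).
  near=> y; have yx : x - 1 <= y.
    by apply: ltW; near: y; apply: lt_nbhsr; rewrite ltrBlDr ltrDl.
  rewrite (@tail_split F c k (x - 1) y)//; last by apply: ltW; near: y; exact: lt_nbhsl.
  by rewrite /G addrAC subrr add0r.
rewrite -[- k x]sub0r; apply: is_derive_sub.
have x1 : x - 1 < x by rewrite ltrBlDr ltrDl.
have [dG GE] := @continuous_FTC1_closed R k (x - 1) x c xc (pcont_integrable _ _ pk)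
  x1 (ck _ xF).
exact: derive1_is_derive dG GE.
Unshelve. all: by end_near. Qed.

Lemma Rintegral_pcont_eq F h k p q : p <= q -> pcont F h -> pcont F k ->
  (forall x, p < x < q -> x \notin F -> h x = k x) ->
  \int[leb]_(t in `[p, q]) h t = \int[leb]_(t in `[p, q]) k t.
Proof.
move=> pq ph pk hk; pose d x := h x - k x.
have pd : pcont F d := pcontB ph pk.
have [cd [M dM]] := pd.
suff d0 : \int[leb]_(t in `[p, q]) d t = 0.
  apply/eqP; rewrite -subr_eq0 -RintegralB//; first exact/eqP.
    exact: pcont_integrable ph.
  exact: pcont_integrable pk.
rewrite -(subrr (0 : R)); apply: (@FTC_pcont R F (fun=> 0) d p q M) => //.
- by move=> x; exact: cvg_cst.
- by move=> x xpq xF; rewrite /d hk// subrr; exact: is_derive_constant.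
- by move=> x _ /cd.
Qed.

(** The comparison is known only off [F] and in the interior; both integrands are first set to zero
    on [F] and at the endpoints, so that it holds at every point of the interval. *)
Lemma Rintegral_pcont_le F h k p q : p <= q -> pcont F h -> pcont F k ->
  (forall x, p < x < q -> x \notin F -> h x <= k x) ->
  \int[leb]_(t in `[p, q]) h t <= \int[leb]_(t in `[p, q]) k t.
Proof.
move=> pq ph pk hk; pose F' := p :: q :: F.
have sub k' : pcont F k' -> pcont F' k'.
  move=> [ck' bk']; split => // x; rewrite !inE !negb_or => /and3P[_ _]; exact: ck'.
pose z k' x := if x \in F' then 0 else k' x.
have pz k' : pcont F k' -> pcont F' (z k').
  by move=> /sub pk'; apply: pcont_off pk' _.
rewrite (@Rintegral_pcont_eq F' h (z h))//; [|exact: sub|exact: pz|]; last first.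
  by move=> x _ xF; rewrite /z (negbTE xF).
rewrite (@Rintegral_pcont_eq F' k (z k))//; [|exact: sub|exact: pz|]; last first.
  by move=> x _ xF; rewrite /z (negbTE xF).
apply: le_Rintegral => //.
- exact: pcont_integrable (pz _ ph).
- exact: pcont_integrable (pz _ pk).
- move=> x /=; rewrite in_itv/= => /andP[px xq]; rewrite /z; case: ifPn => //.
  rewrite !inE !negb_or => /and3P[xp xq' xF]; apply: hk => //.
  by rewrite !lt_neqAle eq_sym xp px xq' xq.
Qed.

End PiecewiseContinuous.

(** * Markov maps and their transfer operator *)

Section Transfer.
Variable R : realType.
Local Notation leb := (@lebesgue_measure R).
Implicit Types (x y z A : R) (h k : R -> R).

(* Data of a mixing Markov map on [[c2, c1]] with turning point [c]; the finite
   set [F] consists of the endpoints of the Markov partition. *)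
Record markov_map (c2 c c1 : R) (F : seq R) (f pp pm : R -> R) (th La D : R) : Prop := {
  mk_th : 0 <= th < 1;
  mk_La : 1 <= La;
  mk_D : 0 < D;
  mk_c2c : c2 < c;
  mk_cc1 : c < c1;
  mk_c2F : c2 \in F;
  mk_c1F : c1 \in F;
  mk_Fsub : forall p, p \in F -> c2 <= p <= c1;
  mk_fF : forall p, p \in F -> f p \in F;
  mk_fc : f c = c1;
  mk_fK : forall y, c2 <= y <= c1 -> c2 <= f y <= c1;
  mk_pp : branch c2 c1 F th La D 1 pp;
  mk_pm : branch c2 c1 F th La D (-1) pm;
  mk_ppc1 : pp c1 = c;
  mk_pmc1 : pm c1 = c;
  mk_ppc2 : pp c2 <= c2;
  mk_pmc2 : pm c2 = c1;
  mk_ppcont : {within `]-oo, c1], continuous pp};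
  mk_pmcont : {within `]-oo, c1], continuous pm};
  mk_left : forall y, c2 <= y <= c -> pp (f y) = y;
  mk_right : forall y, c <= y <= c1 -> pm (f y) = y;
  mk_ppmono : forall x y, x < y -> y <= c1 -> pp x < pp y;
  mk_pmmono : forall x y, x < y -> y <= c1 -> pm y < pm x;
  mk_cover : forall u v, c2 <= u -> u < v -> v <= c1 -> exists N : nat,
    forall n, (N <= n)%N -> forall x, c2 < x < c1 ->
    exists y, u < y < v /\ iter n f y = x
}.

Definition transfer (c1 : R) (pp pm : R -> R) h : R -> R :=
  fun x => half_transfer c1 1 pp h x + half_transfer c1 (-1) pm h x.

Section Iteration.
Variables (c2 c c1 : R) (F : seq R) (f pp pm : R -> R) (th La D : R).
Hypothesis mk : markov_map c2 c c1 F f pp pm th La D.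

Local Notation L := (transfer c1 pp pm).
Local Notation Cl := (loglip c2 c1 F).

Lemma c2c1 : c2 < c1.
Proof. exact: lt_trans (mk_c2c mk) (mk_cc1 mk). Qed.

Lemma th_ge0 : 0 <= th. Proof. by case/andP: (mk_th mk). Qed.

Lemma La_gt0 : 0 < La. Proof. exact: lt_le_trans ltr01 (mk_La mk). Qed.

Lemma mk_inK x : x \notin F -> c2 <= x <= c1 -> c2 < x < c1.
Proof.
move=> xF /andP[x2 x1]; rewrite !lt_neqAle x2 x1 !andbT.
apply/andP; split; first by apply: contraNneq xF => <-; exact: mk_c2F mk.
by apply: contraNneq xF => ->; exact: mk_c1F mk.
Qed.

Lemma transferD h k x : L (fun y => h y + k y) x = L h x + L k x.
Proof.
by rewrite /transfer /half_transfer; case: ifP => _; rewrite ?addr0// !mulrDr; ring.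
Qed.

Lemma transferZ (r : R) h x : L (fun y => r * h y) x = r * L h x.
Proof.
by rewrite /transfer /half_transfer; case: ifP => _; rewrite ?addr0 ?mulr0//; ring.
Qed.

Lemma transferB h k x : L (fun y => h y - k y) x = L h x - L k x.
Proof.
by rewrite /transfer /half_transfer; case: ifP => _; rewrite ?addr0 ?subr0//; ring.
Qed.

(** The branches map the complement of [F] into itself, so the operator acts on functions known only
    off [F]. *)
Lemma transfer_off h k : (forall x, x \notin F -> h x = k x) ->
  forall x, x \notin F -> L h x = L k x.
Proof.
move=> hk x xF; rewrite /transfer /half_transfer; case: ifPn => // xc.
rewrite !hk//; first exact: br_notin (mk_pm mk) _ xc xF.
exact: br_notin (mk_pp mk) _ xc xF.
Qed.

Lemma iter_transferB n h k x :
  iter n L (fun y => h y - k y) x = iter n L h x - iter n L k x.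
Proof.
elim: n x => [//|n IH] x /=.
rewrite -transferB; congr (transfer _ _ _ _ x).
by apply/funext => y; exact: IH.
Qed.

Lemma iter_transferD n h k x :
  iter n L (fun y => h y + k y) x = iter n L h x + iter n L k x.
Proof.
elim: n x => [//|n IH] x /=.
rewrite -transferD; congr (transfer _ _ _ _ x).
by apply/funext => y; exact: IH.
Qed.

Lemma iter_transferZ n (r : R) h x :
  iter n L (fun y => r * h y) x = r * iter n L h x.
Proof.
elim: n x => [//|n IH] x /=.
rewrite -transferZ; congr (transfer _ _ _ _ x).
by apply/funext => y; exact: IH.
Qed.

Lemma transfer_ge0 h x : (forall y, y \notin F -> 0 <= h y) -> x \notin F ->
  0 <= L h x.
Proof.
move=> h0 xF; apply: addr_ge0.
  exact: half_ge0 (mk_pp mk) _ _ h0 xF.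
exact: half_ge0 (mk_pm mk) _ _ h0 xF.
Qed.

Lemma iter_transfer_ge0 n h x : (forall y, y \notin F -> 0 <= h y) ->
  x \notin F -> 0 <= iter n L h x.
Proof. by move=> h0; elim: n x => [|n IH] x xF; [exact: h0|exact: transfer_ge0]. Qed.

Lemma transfer_out h x :
  (forall y, y \notin F -> ~~ (c2 <= y <= c1) -> h y = 0) ->
  x \notin F -> ~~ (c2 <= x <= c1) -> L h x = 0.
Proof.
move=> h0 xF xK; rewrite /transfer.
rewrite (half_out (mk_pp mk) h0 xF xK).
by rewrite (half_out (mk_pm mk) h0 xF xK) addr0.
Qed.

Lemma iter_transfer_out n h x :
  (forall y, y \notin F -> ~~ (c2 <= y <= c1) -> h y = 0) ->
  x \notin F -> ~~ (c2 <= x <= c1) -> iter n L h x = 0.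
Proof.
by move=> h0; elim: n x => [|n IH] x xF xK; [exact: h0|exact: transfer_out].
Qed.

Lemma transfer_loglip A h : 0 <= A -> Cl A h -> Cl (th * A + D) (L h).
Proof.
move=> A0 hh; split.
- by move=> x; apply: transfer_ge0; exact: ll_ge0 hh.
- by move=> x; apply: transfer_out; exact: ll_out hh.
- move=> x y xy; rewrite /transfer mulrDr; apply: lerD.
    exact (half_loglip (mk_c2F mk) (mk_c1F mk) La_gt0 (mk_pp mk) A0 hh xy).
  exact (half_loglip (mk_c2F mk) (mk_c1F mk) La_gt0 (mk_pm mk) A0 hh xy).
Qed.

Lemma loglip_le A B h : A <= B -> Cl A h -> Cl B h.
Proof.
move=> AB hh; split; [exact: ll_ge0 hh|exact: ll_out hh|move=> x y xy].
apply: le_trans (ll_lip hh xy) _; apply: ler_wpM2r.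
  exact (ll_ge0 hh (same_comp_notin (same_compC xy))).
by rewrite ler_expR ler_wpM2r.
Qed.

(** The map sending [A] to [th * A + D] is a contraction with fixed point [D / (1 - th)]. *)
Lemma iter_transfer_loglip n A h : 0 <= A -> Cl A h ->
  Cl (th ^+ n * A + D / (1 - th)) (iter n L h).
Proof.
move=> A0 hh; have /andP[th0 th1] := mk_th mk.
have D0 : 0 <= D / (1 - th) by rewrite divr_ge0 ?subr_ge0 ?ltW// (mk_D mk).
elim: n => [|n IH]; first by apply: loglip_le hh; rewrite expr0 mul1r lerDl.
have H : 0 <= th ^+ n * A + D / (1 - th) by rewrite addr_ge0// mulr_ge0// exprn_ge0.
apply: loglip_le (transfer_loglip H IH).
rewrite mulrDr mulrA -exprS -addrA lerD2l le_eqVlt; apply/orP; left; apply/eqP.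
by field; rewrite subr_eq0 gt_eqF.
Qed.

(** [y] is one of the two preimages of [f y]. The corresponding summand of [L h (f y)] is at least
    [h y / La], and the other one is nonnegative. *)
Lemma transfer_lower h y : (forall z, z \notin F -> 0 <= h z) ->
  c2 <= y <= c1 -> f y \notin F -> h y <= La * L h (f y).
Proof.
move=> h0 /andP[y2 y1] fyF.
have yF : y \notin F by apply: contra fyF; exact: mk_fF mk _.
have fy1 : f y < c1.
  have yK : c2 <= y <= c1 by rewrite y2 y1.
  have /andP[_] := mk_fK mk yK.
  rewrite le_eqVlt => /predU1P[E|//].
  by rewrite E (mk_c1F mk) in fyF.
have La0 := ltW La_gt0.
have [yc|/ltW cy] := leP y c.
  have E : pp (f y) = y by apply: (mk_left mk); rewrite y2 yc.
  have W : 1 <= La * (1 * derive1 pp (f y)).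
    by apply: br_low (mk_pp mk) _ fy1 fyF _; rewrite E y2 y1.
  rewrite /transfer mulrDr -[h y]addr0; apply: lerD.
    by rewrite /half_transfer fy1 E mulrA; apply: ler_peMl => //; exact: h0.
  by apply: mulr_ge0 => //; exact: half_ge0 (mk_pm mk) _ _ h0 fyF.
have E : pm (f y) = y by apply: (mk_right mk); rewrite cy y1.
have W : 1 <= La * (-1 * derive1 pm (f y)).
  by apply: br_low (mk_pm mk) _ fy1 fyF _; rewrite E y2 y1.
rewrite /transfer mulrDr -[h y]add0r; apply: lerD.
  by apply: mulr_ge0 => //; exact: half_ge0 (mk_pp mk) _ _ h0 fyF.
by rewrite /half_transfer fy1 E mulrA; apply: ler_peMl => //; exact: h0.
Qed.

Lemma iter_fK n y : c2 <= y <= c1 -> c2 <= iter n f y <= c1.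
Proof. by move=> yK; elim: n => [//|n IH]; exact: mk_fK mk _ IH. Qed.

Lemma iter_transfer_lower n h y : (forall z, z \notin F -> 0 <= h z) ->
  c2 <= y <= c1 -> iter n f y \notin F ->
  h y <= La ^+ n * iter n L h (iter n f y).
Proof.
move=> h0 yK; elim: n => [|n IH] yF; first by rewrite expr0 mul1r.
have yF' : iter n f y \notin F by apply: contra yF; exact: mk_fF mk _.
apply: le_trans (IH yF') _; rewrite exprSr -mulrA.
apply: ler_wpM2l; first by rewrite exprn_ge0// ltW// La_gt0.
apply: (transfer_lower _ (iter_fK n yK) yF) => z zF.
exact: iter_transfer_ge0.
Qed.

(** Induction on a sublist [G] of [F]: the bracket around [z] starts as [c2], [c1] and shrinks with
    each new point of [G], until no point of [F] lies strictly inside it. *)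
Lemma component_endpoints z : z \notin F -> c2 < z < c1 ->
  exists p q, [/\ p \in F, q \in F, p < z < q &
    forall r, r \in F -> r <= p \/ q <= r].
Proof.
move=> zF /andP[z2 z1].
suff H (G : seq R) : {subset G <= F} -> exists p q,
    [/\ p \in F, q \in F, p < z < q & forall r, r \in G -> r <= p \/ q <= r].
  exact: (H F).
elim: G => [_|r G IH GF].
  by exists c2, c1; rewrite (mk_c2F mk) (mk_c1F mk) z2 z1; split.
have [|p [q [pF qF /andP[pz zq] H]]] := IH; first by move=> s sG; apply: GF; rewrite inE sG orbT.
have rF : r \in F by apply: GF; rewrite mem_head.
have [rz|zr|rz] := ltgtP r z; last by rewrite -rz rF in zF.
- exists (Num.max p r), q; split => //; first by rewrite /Num.max; case: ifP.
    by rewrite gt_max pz rz zq.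
  move=> s; rewrite inE => /predU1P[->|/H[sp|qs]]; rewrite ?le_max ?lexx ?orbT ?sp; auto.
- exists p, (Num.min q r); split => //; first by rewrite /Num.min; case: ifP.
    by rewrite lt_min pz zr zq.
  move=> s; rewrite inE => /predU1P[->|/H[sp|qs]]; rewrite ?ge_min ?lexx ?orbT ?qs; auto.
Qed.

Lemma uniform_nat (T : eqType) (s : seq T) (P : T -> nat -> Prop) :
  (forall t, t \in s -> exists N, forall n, (N <= n)%N -> P t n) ->
  exists N, forall t, t \in s -> forall n, (N <= n)%N -> P t n.
Proof.
elim: s => [_|t s IH H]; first by exists 0%N.
have [|N HN] := IH; first by move=> u us; apply: H; rewrite inE us orbT.
have [N' HN'] := H t (mem_head _ _).
exists (maxn N N') => u; rewrite inE => /predU1P[->|us] n; rewrite geq_max => /andP[n1 n2].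
  exact: HN'.
exact: HN.
Qed.

(** The time in [mk_cover] depends on the interval. Only the finitely many intervals with endpoints
    in [F] are needed, since the component of [z] is one of them. *)
Lemma uniform_cover : exists N, forall n, (N <= n)%N -> forall x z,
  x \notin F -> c2 <= x <= c1 -> z \notin F -> c2 <= z <= c1 ->
  exists y, [/\ same_comp F z y, c2 <= y <= c1 & iter n f y = x].
Proof.
pose P (t : R * R) n := t.1 < t.2 -> forall x, c2 < x < c1 ->
    exists y, t.1 < y < t.2 /\ iter n f y = x.
have [|N HN] := @uniform_nat _ [seq (p, q) | p <- F, q <- F] P.
  move=> t /allpairsP[[p q] /= [pF qF ->]].
  have [pq|qp] := ltP p q; last by exists 0%N => n _; rewrite /P/= ltNge qp.
  have /andP[p2 _] := mk_Fsub mk pF; have /andP[_ q1] := mk_Fsub mk qF.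
  by have [N HN] := mk_cover mk p2 pq q1; exists N => n Nn _; exact: HN.
exists N => n Nn x z xF xK zF zK.
have [p [q [pF qF /andP[pz zq] H]]] := component_endpoints zF (mk_inK zF zK).
have [|y [/andP[py yq] yx]] := HN (p, q) _ n Nn (lt_trans pz zq) x (mk_inK xF xK).
  by apply/allpairsP; exists (p, q).
rewrite /= in py yq; exists y; split => //.
  by move=> r /H[rp|qr]; nra.
have /andP[p2 _] := mk_Fsub mk pF; have /andP[_ q1] := mk_Fsub mk qF.
by rewrite (ltW (le_lt_trans p2 py)) (ltW (lt_le_trans yq q1)).
Qed.

End Iteration.
End Transfer.

(** * Change of variables and conservation of mass *)

Section Doeblin.
Variable R : realType.
Local Notation leb := (@lebesgue_measure R).
Implicit Types (x y z A : R) (h k : R -> R).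
Variables (c2 c c1 : R) (F : seq R) (f pp pm : R -> R) (th La D : R).
Hypothesis mk : markov_map c2 c c1 F f pp pm th La D.

Local Notation L := (transfer c1 pp pm).
Local Notation Cl := (loglip c2 c1 F).
Let c21 : c2 < c1 := c2c1 mk.

Lemma half_pcont s psi h : branch c2 c1 F th La D s psi -> pcont F h ->
  pcont F (half_transfer c1 s psi h).
Proof.
move=> bp [ch [M hM]]; split; last first.
  exists (th * M) => x; rewrite /half_transfer; case: ifPn => [xc|_].
    have w := br_weight bp xc; have /andP[w0 w1] := w.
    by rewrite normrM (ger0_norm w0) ler_pM.
  by rewrite normr0 mulr_ge0 ?(th_ge0 mk)// (le_trans _ (hM 0)).
move=> x xF.
have [xc|cx] := ltP x c1.
  apply: (@continuous_near_eq _ _ (fun y => s * derive1 psi y * h (psi y))).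
    have cpsi : {for x, continuous psi}.
      apply: differentiable_continuous; apply/derivable1_diffP; exact: br_der1 bp _ xc.
    apply: cvgM.
      apply: cvgM; first exact: cvg_cst.
      apply: differentiable_continuous; apply/derivable1_diffP; exact: br_der2 bp _ xc.
    apply: (@continuous_comp _ _ _ psi h x cpsi).
    by apply: ch; exact: br_notin bp _ xc xF.
  near=> y; rewrite /half_transfer ifT//; near: y; exact: lt_nbhsl.
have {cx} cx : c1 < x.
  by rewrite lt_neqAle cx andbT; apply: contraNneq xF => <-; exact: mk_c1F mk.
apply: (@continuous_near_eq _ _ (fun=> 0)); first exact: cvg_cst.
near=> y; rewrite /half_transfer ifF//; apply/negbTE; rewrite -leNgt ltW//.
by near: y; exact: lt_nbhsr.
Unshelve. all: by end_near. Qed.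

Lemma transfer_pcont h : pcont F h -> pcont F (L h).
Proof.
by move=> ph; apply: pcontD; apply: half_pcont ph; [exact: mk_pp mk|exact: mk_pm mk].
Qed.

Lemma iter_transfer_pcont n h : pcont F h -> pcont F (iter n L h).
Proof. by move=> ph; elim: n => [//|n IH] /=; exact: transfer_pcont. Qed.

Definition vanishing h := forall x, x \notin F -> ~~ (c2 <= x <= c1) -> h x = 0.

Lemma vanishing_gt h x : vanishing h -> x \notin F -> c1 < x -> h x = 0.
Proof. by move=> h0 xF cx; apply: h0 => //; rewrite [x <= _]leNgt cx andbF. Qed.

Lemma tail_out k x : pcont F k -> vanishing k -> x <= c2 ->
  tail c1 k x = tail c1 k c2.
Proof.
move=> pk k0 xc; apply: (@is_derive0_const R F) => //.
  by apply: continuous_subspaceT; exact: tail_continuous pk.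
move=> y /andP[_ yc] yF.
have ky : k y = 0 by apply: k0 => //; rewrite [c2 <= y]leNgt yc.
rewrite -oppr0 -ky; apply: (tail_derive pk yF).
  by rewrite lt_eqF// (lt_trans yc).
by move=> z; exact: vanishing_gt.
Qed.

(** Both sides vanish at [c1], where the two branches meet at [c], and they have the same derivative
    off [F] by the chain rule: the minus sign before the decreasing branch turns its negative
    derivative into its weight. *)
Lemma tail_transfer k x : pcont F k -> vanishing k -> x <= c1 ->
  tail c1 k (pp x) - tail c1 k (pm x) = tail c1 (L k) x.
Proof.
move=> pk k0 xc.
pose Phi y := (tail c1 k (pp y) - tail c1 k (pm y)) - tail c1 (L k) y.
suff E : Phi x = Phi c1.
  move: E; rewrite /Phi (mk_ppc1 mk) (mk_pmc1 mk) subrr (tail_ge _ (lexx c1)) subr0.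
  by move=> /eqP; rewrite subr_eq0 => /eqP.
have pLk := transfer_pcont pk.
have ct : continuous (tail c1 k) := tail_continuous pk.
apply: (@is_derive0_const R F) => //.
  move=> y; apply: cvgB; first apply: cvgB.
  - apply: (@continuous_comp _ _ _ (pp : subspace `[x, c1] -> R) (tail c1 k)); last exact: ct.
    apply: continuous_subspaceW (mk_ppcont mk) _.
    by apply: subset_itvr; rewrite bnd_simp.
  - apply: (@continuous_comp _ _ _ (pm : subspace `[x, c1] -> R) (tail c1 k)); last exact: ct.
    apply: continuous_subspaceW (mk_pmcont mk) _.
    by apply: subset_itvr; rewrite bnd_simp.
  - by apply: continuous_subspaceT; exact: tail_continuous pLk.
move=> y /andP[xy yc] yF.
have nc psi s : branch c2 c1 F th La D s psi ->
    is_derive y (1 : R) (fun z => tail c1 k (psi z)) (- k (psi y) * derive1 psi y).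
  move=> bp; have pyF := br_notin bp yc yF.
  apply: (@is_derive1_comp R (tail c1 k) psi).
    apply: (tail_derive pk pyF); last by move=> z; exact: vanishing_gt.
    by apply: contraNneq pyF => ->; exact: mk_c1F mk.
  by apply: derive1_is_derive => //; exact: br_der1 bp _ yc.
have dL : is_derive y (1 : R) (tail c1 (L k)) (- L k y).
  apply: (tail_derive pLk yF); first by rewrite lt_eqF.
  move=> z zF; apply: vanishing_gt => // u uF; exact: transfer_out mk _ _ k0 uF.
have := is_derive_sub (is_derive_sub (nc _ _ (mk_pp mk)) (nc _ _ (mk_pm mk))) dL.
set d := (X in is_derive y 1 _ X); suff -> : d = 0 by [].
by rewrite /d /transfer /half_transfer yc; ring.
Qed.

Definition mass h : R := \int[leb]_(t in `[c2, c1]) h t.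

Lemma mass_transfer k : pcont F k -> vanishing k -> mass (L k) = mass k.
Proof.
move=> pk k0; rewrite /mass -/(tail c1 (L k) c2) -(tail_transfer pk k0 (ltW c21)).
by rewrite (mk_pmc2 mk) (tail_ge _ (lexx c1)) subr0 (tail_out pk k0 (mk_ppc2 mk)).
Qed.

Lemma mass_iter_transfer n k : pcont F k -> vanishing k ->
  mass (iter n L k) = mass k.
Proof.
move=> pk k0; elim: n => [//|n IH] /=.
rewrite mass_transfer ?IH//; first exact: iter_transfer_pcont.
by move=> x xF xK; exact: iter_transfer_out mk _ _ _ k0 xF xK.
Qed.

Lemma mass_le h k : pcont F h -> pcont F k ->
  (forall x, x \notin F -> c2 <= x <= c1 -> h x <= k x) -> mass h <= mass k.
Proof.
move=> ph pk hk; apply: (Rintegral_pcont_le (ltW c21) ph pk) => x /andP[x2 x1] xF.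
by apply: hk => //; rewrite !ltW.
Qed.

Lemma mass_eq h k : pcont F h -> pcont F k ->
  (forall x, x \notin F -> c2 <= x <= c1 -> h x = k x) -> mass h = mass k.
Proof.
move=> ph pk hk; apply: (Rintegral_pcont_eq (ltW c21) ph pk) => x /andP[x2 x1] xF.
by apply: hk => //; rewrite !ltW.
Qed.

Lemma massB h k : pcont F h -> pcont F k ->
  mass (fun x => h x - k x) = mass h - mass k.
Proof.
by move=> ph pk; apply: RintegralB => //; [exact: pcont_integrable ph|exact: pcont_integrable pk].
Qed.

Lemma massD h k : pcont F h -> pcont F k ->
  mass (fun x => h x + k x) = mass h + mass k.
Proof.
by move=> ph pk; apply: RintegralD => //; [exact: pcont_integrable ph|exact: pcont_integrable pk].
Qed.

Lemma massZ r h : pcont F h -> mass (fun x => r * h x) = r * mass h.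
Proof. by move=> ph; apply: RintegralZl => //; exact: pcont_integrable ph. Qed.

Lemma mass_cst r : mass (fun=> r) = r * (c1 - c2).
Proof.
by rewrite /mass Rintegral_cst// /= lebesgue_measure_itv/= lte_fin c21 -EFinD.
Qed.

Lemma mass_norm_le h (M : R) : pcont F h ->
  (forall x, x \notin F -> c2 <= x <= c1 -> `|h x| <= M) ->
  `|mass h| <= M * (c1 - c2).
Proof.
move=> ph hM; rewrite ler_norml -mulNr -!mass_cst.
apply/andP; split; apply: mass_le => //; try exact: pcont_cst.
  by move=> x xF xK; have := hM x xF xK; rewrite ler_norml => /andP[].
by move=> x xF xK; have := hM x xF xK; rewrite ler_norml => /andP[].
Qed.

Definition unit_itv (x : R) : R := if c2 <= x <= c1 then 1 else 0.

Lemma unit_itv_pcont : pcont F unit_itv.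
Proof. exact: pcont_piece (mk_c2F mk) (mk_c1F mk). Qed.

Lemma unit_itv_loglip A : 0 <= A -> Cl A unit_itv.
Proof.
move=> A0; split.
- by move=> x _; rewrite /unit_itv; case: ifP.
- by move=> x _ /negbTE; rewrite /unit_itv => ->.
- move=> x y xy; rewrite /unit_itv -(same_comp_itv (mk_c2F mk) (mk_c1F mk) xy).
  case: ifP => _; rewrite ?mulr1 ?mulr0//.
  by rewrite -expR0 ler_expR mulr_ge0.
Qed.

Lemma mass_unit_itv : mass unit_itv = c1 - c2.
Proof.
rewrite -[RHS]mul1r -mass_cst; apply: mass_eq; first exact: unit_itv_pcont.
  exact: pcont_cst.
by move=> x _ xK; rewrite /unit_itv xK.
Qed.

End Doeblin.

(** * Exponential mixing by coupling *)

Section Contraction.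
Variable R : realType.
Implicit Types (x y z A : R) (h k : R -> R).

Lemma bernoulli (y : R) n : 0 <= y <= 1 -> 1 - n%:R * y <= (1 - y) ^+ n.
Proof.
move=> /andP[y0 y1]; elim: n => [|n IH]; first by rewrite mul0r subr0 expr0.
rewrite exprS; apply: le_trans (ler_wpM2l _ IH); last by rewrite subr_ge0.
rewrite -natr1; have : 0 <= n%:R :> R by rewrite ler0n.
by move: (n%:R : R) => t t0; nra.
Qed.

Lemma expr_small (t e : R) : 0 <= t < 1 -> 0 < e ->
  exists N, forall n, (N <= n)%N -> t ^+ n <= e.
Proof.
move=> /andP[t0 t1] e0.
have : (fun n => t ^+ n) @ \oo --> (0 : R).
  by apply: cvg_expr; rewrite ger0_norm.
move=> /cvgrPdist_le /(_ _ e0) [N _ HN]; exists N => n Nn.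
by have := HN n Nn; rewrite sub0r normrN ger0_norm// exprn_ge0.
Qed.

Variables (c2 c c1 : R) (F : seq R) (f pp pm : R -> R) (th La D : R).
Hypothesis mk : markov_map c2 c c1 F f pp pm th La D.

Local Notation L := (transfer c1 pp pm).
Local Notation Cl := (loglip c2 c1 F).
Local Notation mass := (mass c2 c1).
Local Notation unit_itv := (unit_itv c2 c1).
Let c21 : c2 < c1 := c2c1 mk.

(** One time [N] serves two purposes: it halves the log-Lipschitz constant, and by then the image of
    every component inside [[c2, c1]] reaches every point of [[c2, c1]] off [F]. *)
Lemma doeblin_constants : exists A N kap, [/\ 0 < A, (0 < N)%N, 0 < kap <= 1,
  (forall h, Cl A h -> Cl A (L h)) &
  (forall h, Cl A h -> Cl (A / 2) (iter N L h)) /\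
  (forall h x z, Cl A h -> x \notin F -> c2 <= x <= c1 ->
     z \notin F -> c2 <= z <= c1 -> kap * h z <= iter N L h x)].
Proof.
have D0 := mk_D mk; have /andP[th0 th1] := mk_th mk.
(* Four times the fixed constant of the iteration: the additive part is then [A / 4], and
   [th ^+ N <= 1 / 4] makes the total at most [A / 2]. *)
pose A := 4 * (D / (1 - th)).
have B0 : 0 < D / (1 - th) by rewrite divr_gt0// subr_gt0.
have A0 : 0 < A by rewrite mulr_gt0.
have [N1 HN1] := @expr_small th (1 / 4) (mk_th mk) ltac:(lra).
have [N2 HN2] := uniform_cover mk.
pose N := maxn 1 (maxn N1 N2).
(* The exponential pays for moving from [z] to a point [y] of its component whose N-th image is [x],
   the power of [La] for the [N] steps from [y] to [x]. *)
pose kap := expR (- (A * (c1 - c2))) / La ^+ N.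
have La0 := La_gt0 mk.
have LaN : 1 <= La ^+ N by rewrite exprn_ege1// (mk_La mk).
have kap0 : 0 < kap by rewrite divr_gt0 ?expR_gt0 ?exprn_gt0.
exists A, N, kap; split => //.
- by rewrite /N leq_max.
- rewrite kap0 ler_pdivrMr ?exprn_gt0// mul1r (le_trans _ LaN)//.
  by rewrite -expR0 ler_expR oppr_le0 mulr_ge0 ?subr_ge0// ltW.
- move=> h hh; apply: loglip_le (transfer_loglip mk (ltW A0) hh).
  rewrite /A (_ : D = (1 - th) * (D / (1 - th))) ; last by field; rewrite subr_eq0 gt_eqF.
  have -> : (1 - th) * (D / (1 - th)) / (1 - th) = D / (1 - th).
    by field; rewrite subr_eq0 gt_eqF.
  by move: (D / (1 - th)) B0 => B B0; nra.
split=> [h hh|h x z hh xF xK zF zK].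
  apply: loglip_le (iter_transfer_loglip mk N (ltW A0) hh).
  have : th ^+ N <= 1 / 4 by apply: HN1; rewrite /N !leq_max leqnn orbT.
  by rewrite /A; move: (th ^+ N) (D / (1 - th)) B0 => t B B0; nra.
have [|y [zy yK yx]] := HN2 N _ x z xF xK zF zK; first by rewrite /N !leq_max leqnn !orbT.
have h0 w : w \notin F -> 0 <= h w by exact: ll_ge0 hh w.
have H1 := ll_lip hh zy.
have H2 : h y <= La ^+ N * iter N L h x.
  by rewrite -yx; apply: (iter_transfer_lower mk h0 yK); rewrite yx.
have yF := same_comp_notin (same_compC zy).
have H3 : h z <= expR (A * (c1 - c2)) * h y.
  apply: le_trans H1 _; apply: ler_wpM2r; first exact: h0.
  rewrite ler_expR ler_wpM2l ?(ltW A0)// ler_norml.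
  by move: zK yK => /andP[? ?] /andP[? ?]; apply/andP; split; lra.
rewrite /kap expRN -invfM mulrC ler_pdivrMr ?mulr_gt0 ?expR_gt0 ?exprn_gt0//.
apply: le_trans H3 _; rewrite mulrCA ler_pM2l ?expR_gt0//.
by rewrite mulrC.
Qed.

Section Coupling.
Variables (A kap : R) (N : nat).
Hypothesis A0 : 0 < A.
Hypothesis N0 : (0 < N)%N.
Hypothesis kap01 : 0 < kap <= 1.
Hypothesis ClL : forall h, Cl A h -> Cl A (L h).
Hypothesis ClN : forall h, Cl A h -> Cl (A / 2) (iter N L h).
Hypothesis lowN : forall h x z, Cl A h -> x \notin F -> c2 <= x <= c1 ->
     z \notin F -> c2 <= z <= c1 -> kap * h z <= iter N L h x.

Lemma loglip_vanishing B h : Cl B h -> vanishing c2 c1 F h.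
Proof. by move=> hh x xF xK; exact: ll_out hh _ xF xK. Qed.

Lemma iter_ClL n h : Cl A h -> Cl A (iter n L h).
Proof. by move=> hh; elim: n => [//|n IH]; exact: ClL. Qed.

Lemma mass_ge0 B h : Cl B h -> pcont F h -> 0 <= mass h.
Proof.
move=> hh ph; rewrite -(mul0r (c1 - c2)) -(mass_cst mk)//.
by apply: (mass_le mk) => //; [exact: pcont_cst|move=> x xF _; exact: ll_ge0 hh x xF].
Qed.

(** Integrate [lowN] over [x]: the N-th iterate has the same mass as [h]. *)
Lemma loglip_sup h z : Cl A h -> pcont F h -> z \notin F ->
  h z <= (kap * (c1 - c2))^-1 * mass h.
Proof.
have /andP[k0 _] := kap01.
have kc0 : 0 < kap * (c1 - c2) by rewrite mulr_gt0// subr_gt0.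
move=> hh ph zF; rewrite mulrC ler_pdivlMr//.
have [zK|zK] := boolP (c2 <= z <= c1); last first.
  by rewrite (ll_out hh zF zK) mul0r; exact: mass_ge0 hh ph.
rewrite mulrCA mulrA -(mass_iter_transfer mk N ph (loglip_vanishing hh)).
rewrite -[leLHS](mass_cst mk).
apply: (mass_le mk); [exact: pcont_cst|exact: (iter_transfer_pcont mk)|].
by move=> x xF xK; exact: lowN hh xF xK zF zK.
Qed.

(** Integrate [lowN] over [z]. *)
Lemma loglip_inf h x : Cl A h -> pcont F h -> x \notin F -> c2 <= x <= c1 ->
  kap / (c1 - c2) * mass h <= iter N L h x.
Proof.
move=> hh ph xF xK; rewrite mulrAC ler_pdivrMr ?subr_gt0//.
rewrite -(massZ c2 c1 _ ph) -[leRHS](mass_cst mk).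
apply: (mass_le mk); [exact: pcontZ|exact: pcont_cst|].
by move=> z zF zK; exact: lowN hh xF xK zF zK.
Qed.

(** What is left of the N-th iterate once half of the constant guaranteed by [loglip_inf] is
    removed. Removing only half keeps the remainder in the cone. *)
Definition remainder h x := iter N L h x - kap / (2 * (c1 - c2)) * mass h * unit_itv x.

Lemma remainder_pcont h : pcont F h -> pcont F (remainder h).
Proof.
move=> ph; apply: pcontB; first exact: (iter_transfer_pcont mk).
by apply: pcontZ; exact: (unit_itv_pcont mk).
Qed.

(** The N-th iterate has constant [A / 2], and subtracting a constant at most half as large as the
    function at most doubles the log-Lipschitz constant. *)
Lemma remainder_loglip h : Cl A h -> pcont F h -> Cl A (remainder h).
Proof.
move=> hh ph; have /andP[k0 _] := kap01.
have c210 : 0 < c1 - c2 by rewrite subr_gt0.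
pose s := kap / (2 * (c1 - c2)) * mass h.
have s0 : 0 <= s.
  by apply: mulr_ge0; [rewrite divr_ge0 ?mulr_ge0 ?ltW|exact: mass_ge0 hh ph].
have hN := ClN hh.
have half x : x \notin F -> c2 <= x <= c1 -> s <= iter N L h x / 2.
  move=> xF xK; have := loglip_inf hh ph xF xK.
  have -> : kap / (c1 - c2) * mass h = 2 * s.
    by rewrite /s; field; rewrite gt_eqF.
  lra.
split.
- move=> x xF; rewrite /remainder /unit_itv -/s; case: ifPn => xK.
    by have := half x xF xK; lra.
  by rewrite mulr0 subr0; exact: ll_ge0 hN x xF.
- move=> x xF xK; rewrite /remainder /unit_itv (negbTE xK) mulr0 subr0.
  by apply: (ll_out hN).
- move=> x y xy; rewrite /remainder /unit_itv -/s.
  rewrite -(same_comp_itv (mk_c2F mk) (mk_c1F mk) xy).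
  have Hxy := ll_lip hN xy.
  have yF := same_comp_notin (same_compC xy).
  have E : expR (A * `|x - y|) = expR (A / 2 * `|x - y|) * expR (A / 2 * `|x - y|).
    by rewrite -expRD -mulrDl -splitr.
  have E1 : 1 <= expR (A / 2 * `|x - y|).
    by rewrite -expR0 ler_expR mulr_ge0// divr_ge0// ltW.
  case: ifPn => xK; last first.
    rewrite !mulr0 !subr0; apply: le_trans Hxy _.
    rewrite E; apply: ler_wpM2r; first exact: ll_ge0 hN y yF.
    by rewrite ler_peMl// (le_trans _ E1).
  have yK : c2 <= y <= c1.
    by rewrite -(same_comp_itv (mk_c2F mk) (mk_c1F mk) xy).
  have := half y yF yK; rewrite !mulr1 E.
  move: Hxy E1; move: (expR _) => e; move: (iter N L h x) (iter N L h y) => u v uv e1 sv.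
  apply: le_trans (lerD uv (lexx _)) _.
  (* The last factor is nonnegative, because [s <= v / 2] and [1 <= e] give
     [s * (e + 1) <= e * v]. *)
  have -> : e * e * (v - s) = e * v - s + (e - 1) * (e * v - s * (e + 1)) by ring.
  rewrite lerDl mulr_ge0 ?subr_ge0//.
  nra.
Qed.

Lemma remainder_mass h : Cl A h -> pcont F h ->
  mass (remainder h) = (1 - kap / 2) * mass h.
Proof.
move=> hh ph; have pu := unit_itv_pcont mk.
rewrite (massB c2 c1 (iter_transfer_pcont mk N ph) (pcontZ _ pu)).
rewrite (massZ c2 c1 _ pu) (mass_unit_itv mk).
rewrite (mass_iter_transfer mk)//; last exact: loglip_vanishing hh.
by field; rewrite subr_eq0 gt_eqF.
Qed.

(** Two densities of equal mass have the same multiple of [unit_itv] removed, so the difference of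
    their iterates is that of the remainders, whose mass is smaller by the factor [1 - kap / 2]. The
    induction starts from [loglip_sup]. *)
Lemma coupling (k : nat) h1 h2 x : Cl A h1 -> pcont F h1 -> Cl A h2 -> pcont F h2 ->
  mass h1 = mass h2 -> x \notin F ->
  `|iter (k * N) L h1 x - iter (k * N) L h2 x|
    <= (1 - kap / 2) ^+ k * ((kap * (c1 - c2))^-1 * mass h1).
Proof.
elim: k h1 h2 => [|k IH] h1 h2 hh1 ph1 hh2 ph2 E xF.
  rewrite mul0n/= expr0 mul1r.
  have H1 := loglip_sup hh1 ph1 xF; have H2 := loglip_sup hh2 ph2 xF.
  have := ll_ge0 hh1 xF; have := ll_ge0 hh2 xF.
  by rewrite -E in H2; rewrite ler_norml => ? ?; apply/andP; split; lra.
have := IH _ _ (remainder_loglip hh1 ph1) (remainder_pcont ph1)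
  (remainder_loglip hh2 ph2) (remainder_pcont ph2).
rewrite !remainder_mass// E => /(_ erefl xF).
rewrite -E mulSnr !iterD -!iter_transferB.
have -> : (fun y => remainder h1 y - remainder h2 y) =
          (fun y => iter N L h1 y - iter N L h2 y).
  by apply/funext => y; rewrite /remainder E; ring.
by move=> /le_trans; apply; rewrite exprSr le_eqVlt; apply/orP; left; apply/eqP; ring.
Qed.

Lemma exponential_coupling : exists C tau, [/\ 0 <= C, 0 < tau < 1 &
  forall n h1 h2 x, Cl A h1 -> pcont F h1 -> Cl A h2 -> pcont F h2 ->
  mass h1 = mass h2 -> x \notin F ->
  `|iter n L h1 x - iter n L h2 x| <= C * tau ^+ n * mass h1].
Proof.
have /andP[k0 k1] := kap01.
(* By Bernoulli's inequality [tau ^+ N] is at least [1 - kap / 2], which turns the contraction per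
   block of [N] steps into a rate per step. *)
pose tau := 1 - kap / 2 / N%:R.
have NR : 1 <= N%:R :> R by rewrite ler1n.
have yb : 0 < kap / 2 / N%:R <= 1 / 2.
  rewrite !divr_gt0 ?(lt_le_trans ltr01 NR)//= ler_pdivrMr ?(lt_le_trans ltr01 NR)//.
  by move: (N%:R) NR => t t1; nra.
have tau01 : 0 < tau < 1 by rewrite /tau; lra.
have /andP[t0 t1] := tau01.
have tN : 1 - kap / 2 <= tau ^+ N.
  apply: le_trans (@bernoulli _ N _); last by lra.
  by rewrite mulrCA mulfV ?mulr1// gt_eqF// (lt_le_trans ltr01 NR).
have kc0 : 0 < (kap * (c1 - c2))^-1 by rewrite invr_gt0 mulr_gt0// subr_gt0.
(* Dividing by [tau ^+ N] absorbs the incomplete block of [n %% N] steps. *)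
exists ((kap * (c1 - c2))^-1 / tau ^+ N), tau; split => //.
  by rewrite divr_ge0 ?exprn_ge0// ltW.
move=> n h1 h2 x hh1 ph1 hh2 ph2 E xF.
have T0 : 0 <= mass h1 := mass_ge0 hh1 ph1.
have Hr h : Cl A h -> pcont F h -> mass (iter (n %% N) L h) = mass h.
  by move=> hh ph; rewrite (mass_iter_transfer mk)//; exact: loglip_vanishing hh.
have := @coupling (n %/ N) (iter (n %% N) L h1) (iter (n %% N) L h2) x
  (iter_ClL _ hh1) (iter_transfer_pcont mk _ ph1) (iter_ClL _ hh2)
  (iter_transfer_pcont mk _ ph2).
rewrite !Hr// => /(_ E xF); rewrite -!iterD -divn_eq => /le_trans; apply.
rewrite mulrA; apply: ler_wpM2r => //.
rewrite mulrC -mulrA; apply: ler_wpM2l; first exact: ltW.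
rewrite [leRHS]mulrC ler_pdivlMr ?exprn_gt0//.
apply: (@le_trans _ _ (tau ^+ (n %/ N * N) * tau ^+ N)).
  apply: ler_wpM2r; first by rewrite exprn_ge0// ltW.
  rewrite mulnC exprM; apply: lerXn2r; rewrite ?nnegrE ?exprn_ge0 ?(ltW t0)//.
  lra.
rewrite [X in _ <= _ ^+ X](divn_eq n N) exprD ler_pM2l ?exprn_gt0//.
by rewrite ler_wiXn2l ?(ltW t0) ?(ltW t1)// ltnW// ltn_mod.
Qed.

End Coupling.

Record doeblin (A Cs ki C tau : R) (N : nat) : Prop := {
  do_A : 0 < A;
  do_Cs : 0 <= Cs;
  do_ki : 0 < ki;
  do_C : 0 <= C;
  do_tau : 0 < tau < 1;
  do_stable : forall h, Cl A h -> Cl A (L h);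
  do_sup : forall h z, Cl A h -> pcont F h -> z \notin F -> h z <= Cs * mass h;
  do_inf : forall h x, Cl A h -> pcont F h -> x \notin F -> c2 <= x <= c1 ->
    ki * mass h <= iter N L h x;
  do_mix : forall n h1 h2 x, Cl A h1 -> pcont F h1 -> Cl A h2 -> pcont F h2 ->
    mass h1 = mass h2 -> x \notin F ->
    `|iter n L h1 x - iter n L h2 x| <= C * tau ^+ n * mass h1
}.

Lemma doeblin_exists : exists A Cs ki C tau N, doeblin A Cs ki C tau N.
Proof.
have [A [N [kap [A0 N0 k01 ClL [ClN lowN]]]]] := doeblin_constants.
have [C [tau [C0 t01 mix]]] := exponential_coupling A0 N0 k01 ClL ClN lowN.
have /andP[k0 _] := k01.
exists A, ((kap * (c1 - c2))^-1), (kap / (c1 - c2)), C, tau, N; split => //.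
- by rewrite invr_ge0 mulr_ge0// ?subr_ge0 ltW.
- by rewrite divr_gt0// subr_gt0.
- by move=> h z hh ph zF; exact: (loglip_sup k01 lowN hh ph zF).
- by move=> h x hh ph xF xK; exact: (loglip_inf lowN hh ph xF xK).
Qed.

End Contraction.

(** * The invariant density *)

Section InvariantDensity.
Variable R : realType.
Implicit Types (x y z : R) (h : R -> R).

Lemma geometric_small (C t e : R) : 0 <= C -> 0 <= t < 1 -> 0 < e ->
  exists N, forall n, (N <= n)%N -> C * t ^+ n <= e.
Proof.
move=> C0 t01 e0.
have C1 : 0 < C + 1 by rewrite ltr_wpDl.
have [N HN] := @expr_small R t (e / (C + 1)) t01 (divr_gt0 e0 C1).
exists N => n /HN; rewrite ler_pdivlMr// => H; apply: le_trans H.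
rewrite mulrC; apply: ler_wpM2l; last by rewrite lerDl.
by case/andP: t01 => t0 _; rewrite exprn_ge0.
Qed.

Lemma geometric_cvg (a : nat -> R) l (C t : R) : 0 <= C -> 0 <= t < 1 ->
  (forall n, `|a n - l| <= C * t ^+ n) -> a @ \oo --> l.
Proof.
move=> C0 t01 H; apply/cvgrPdist_le => e e0.
have [N HN] := geometric_small C0 t01 e0.
by exists N => // n Nn; rewrite distrC (le_trans (H n))// HN.
Qed.

Lemma geometric_cauchy (a : nat -> R) (C t : R) : 0 <= C -> 0 <= t < 1 ->
  (forall n (k : nat), `|a n - a (n + k)%N| <= C * t ^+ n) ->
  exists l, forall n, `|a n - l| <= C * t ^+ n.
Proof.
move=> C0 t01 H.
have : cvg (a @ \oo).
  apply/cauchy_cvgP/cauchy_exP => e e0.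
  have e2 : 0 < e / 2 by rewrite divr_gt0.
  have [N HN] := geometric_small C0 t01 e2.
  exists (a N); exists N => // n /= Nn; rewrite /ball/=.
  rewrite -(subnKC Nn) (le_lt_trans (H N _))//.
  by rewrite (le_lt_trans (HN N (leqnn N)))// ltr_pdivrMr// ltr_pMr// ltr1n.
move=> /cvg_ex [l al]; exists l => n.
have : (fun k => `|a n - a (n + k)%N|) @ \oo --> `|a n - l|.
  apply: cvg_norm; apply: cvgB; first exact: cvg_cst.
  by rewrite -(cvg_shiftn n) in al; under eq_fun do rewrite addnC.
by move=> /cvgr_to_le; apply; near=> k; exact: H.
Unshelve. all: by end_near. Qed.

Lemma near_at_rightP x (P : R -> Prop) : (\forall y \near x^'+, P y) ->
  exists2 e, 0 < e & forall y, x < y < x + e -> P y.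
Proof.
move=> [e e0 He]; exists e => // y /andP[xy ye]; apply: He => //=.
by rewrite distrC gtr0_norm ?subr_gt0// ltrBlDl.
Qed.

Lemma near_at_leftP x (P : R -> Prop) : (\forall y \near x^'-, P y) ->
  exists2 e, 0 < e & forall y, x - e < y < x -> P y.
Proof.
move=> [e e0 He]; exists e => // y /andP[ye yx]; apply: He => //=.
by rewrite gtr0_norm ?subr_gt0// ltrBlDr addrC -ltrBlDr.
Qed.

Variables (c2 c c1 : R) (F : seq R) (f pp pm : R -> R) (th La D : R).
Hypothesis mk : markov_map c2 c c1 F f pp pm th La D.
Variables (A Cs ki C tau : R) (N : nat).
Hypothesis db : doeblin c2 c1 F pp pm A Cs ki C tau N.

Local Notation L := (transfer c1 pp pm).
Local Notation Cl := (loglip c2 c1 F).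
Local Notation mass := (mass c2 c1).
Local Notation unit_itv := (unit_itv c2 c1).
Let c21 : c2 < c1 := c2c1 mk.
Let t01 : 0 <= tau < 1.
Proof. by have /andP[/ltW -> ->] := do_tau db. Qed.

Lemma transfer_norm_le (g : R -> R) e x : 0 <= e ->
  (forall y, y \notin F -> `|g y| <= e) -> x \notin F -> `|L g x| <= 2 * e.
Proof.
move=> e0 ge xF; have /andP[th0 /ltW th1] := mk_th mk.
have half s psi : branch c2 c1 F th La D s psi -> `|half_transfer c1 s psi g x| <= e.
  move=> bp; rewrite /half_transfer; case: ifPn => [xc|]; last by rewrite normr0.
  have w := br_weight bp xc; have /andP[w0 w1] := w.
  rewrite normrM (ger0_norm w0) -[e]mul1r ler_pM//; first exact: le_trans th1.
  by apply: ge; exact: (br_notin bp xc xF).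
rewrite /transfer (le_trans (ler_normD _ _))//.
by have := half _ _ (mk_pp mk); have := half _ _ (mk_pm mk); lra.
Qed.

(** Near a point [x] off [F] the values of [h] are squeezed between two multiples of [h x], with
    factors the exponentials of plus and minus [B * |x - y|]. *)
Lemma loglip_pcont (B M : R) h : 0 <= B -> Cl B h -> (forall x, x \in F -> h x = 0) ->
  (forall x, x \notin F -> h x <= M) -> pcont F h.
Proof.
move=> B0 hh hF hM; split; last first.
  exists `|M| => x; have [xF|xF] := boolP (x \in F); first by rewrite hF// normr0.
  by rewrite ger0_norm ?(ll_ge0 hh xF)// (le_trans (hM _ xF))// ler_norm.
move=> x xF.
have cE (s : R) : expR (s * `|x - y|) * h x @[y --> x] --> h x.
  have cn : s * `|x - y| @[y --> x] --> s * `|x - x|.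
    by apply: cvgM; [exact: cvg_cst|apply: cvg_norm; apply: cvgB; [exact: cvg_cst|exact: cvg_id]].
  have ce : expR (s * `|x - y|) @[y --> x] --> expR (s * `|x - x|).
    by apply: continuous_cvg cn; exact: continuous_expR.
  have ch : h x @[_ --> x] --> h x by exact: cvg_cst.
  have E : expR (s * `|x - x|) * h x = h x by rewrite subrr normr0 mulr0 expR0 mul1r.
  by rewrite -[X in _ --> X]E; exact: (cvgM ce ch).
apply: (squeeze_cvgr _ (cE (- B)) (cE B)).
apply: filterS (near_same_comp xF) => y xy.
have := ll_lip hh xy; have := ll_lip hh (same_compC xy).
rewrite distrC => -> H; rewrite andbT mulNr expRN mulrC ler_pdivrMr ?expR_gt0//.
by rewrite mulrC.
Qed.

Definition start x : R := (c1 - c2)^-1 * unit_itv x.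

Lemma loglipZ (B r : R) h : 0 <= r -> Cl B h -> Cl B (fun x => r * h x).
Proof.
move=> r0 hh; split.
- by move=> x xF; rewrite mulr_ge0// (ll_ge0 hh).
- by move=> x xF xK; rewrite (ll_out hh)// mulr0.
- by move=> x y xy; rewrite mulrCA ler_wpM2l// (ll_lip hh).
Qed.

Lemma start_loglip (B : R) : 0 <= B -> Cl B start.
Proof.
move=> B0; apply: loglipZ; first by rewrite invr_ge0 subr_ge0 ltW.
exact: (unit_itv_loglip mk).
Qed.

Lemma start_pcont : pcont F start.
Proof. exact: pcontZ (unit_itv_pcont mk). Qed.

Lemma start_mass : mass start = 1.
Proof.
rewrite (massZ c2 c1 _ (unit_itv_pcont mk)) (mass_unit_itv mk) mulVf//.
by rewrite subr_eq0 gt_eqF.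
Qed.

Let ClS n : Cl A (iter n L start).
Proof.
elim: n => [|n IH]; last exact: (do_stable db IH).
exact: start_loglip (ltW (do_A db)).
Qed.

Let pS n : pcont F (iter n L start).
Proof. exact: (iter_transfer_pcont mk _ start_pcont). Qed.

Let mS n : mass (iter n L start) = 1.
Proof.
rewrite (mass_iter_transfer mk) ?start_mass//; first exact: start_pcont.
by move=> x xF xK; exact: (ll_out (ClS 0) xF xK).
Qed.

(** [start] and its k-th iterate both have mass one and lie in the cone, so [do_mix] compares the
    iterates of order [n] and [n + k]. The cone conditions pass to the pointwise limit. *)
Lemma limit_density : exists h, [/\ Cl A h, pcont F h, mass h = 1,
  (forall x, x \notin F -> L h x = h x) &
  (forall n x, x \notin F -> `|iter n L start x - h x| <= C * tau ^+ n)].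
Proof.
(* The limit is set to zero on [F], where the iterates are not controlled. *)
have /choice[h hP] : forall x, exists l : R, if x \in F then l = 0 else
    forall n, `|iter n L start x - l| <= C * tau ^+ n.
  move=> x; case: (boolP (x \in F)) => xF; first by exists 0.
  apply: (@geometric_cauchy (fun n => iter n L start x) C tau (do_C db) t01) => n k.
  rewrite iterD.
  have := do_mix db n (ClS 0) (pS 0) (ClS k) (pS k).
  by rewrite !mS => /(_ _ erefl xF); rewrite mulr1.
have hF x : x \in F -> h x = 0 by move=> xF; have := hP x; rewrite xF.
have hn n x : x \notin F -> `|iter n L start x - h x| <= C * tau ^+ n.
  by move=> xF; have := hP x; rewrite (negbTE xF).
have cv x : x \notin F -> (fun n => iter n L start x) @ \oo --> h x.
  by move=> xF; apply: (geometric_cvg (do_C db) t01) => n; exact: hn.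
have hCl : Cl A h.
  split.
  - move=> x xF; apply: (cvgr_to_ge (cv x xF)); near=> n; exact: (ll_ge0 (ClS n) xF).
  - move=> x xF xK; apply: (@cvg_unique _ (@Rhausdorff R) _ _ _ _ (cv x xF)).
    have -> : (fun n => iter n L start x) = (fun=> 0).
      by apply/funext => n; exact: (ll_out (ClS n) xF xK).
    exact: cvg_cst.
  - move=> x y xy; have xF := same_comp_notin xy; have yF := same_comp_notin (same_compC xy).
    apply: (ler_cvg_to (cv x xF)); first by apply: cvgM; [exact: cvg_cst|exact: cv y yF].
    by near=> n; exact: (ll_lip (ClS n) xy).
have ph : pcont F h.
  apply: (loglip_pcont (ltW (do_A db)) hCl hF (M := Cs)) => x xF.
  apply: (cvgr_to_le (cv x xF)); near=> n.
  by have := do_sup db (ClS n) (pS n) xF; rewrite mS mulr1.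
exists h; split => //.
- have : (fun n => mass (iter n L start)) @ \oo --> mass h.
    apply: (@geometric_cvg _ _ (C * (c1 - c2)) tau) => //.
      by rewrite mulr_ge0 ?(do_C db)// subr_ge0 ltW.
    move=> n; rewrite -(massB c2 c1 (pS n) ph) mulrAC.
    apply: (mass_norm_le mk); first exact: pcontB.
    by move=> x xF _; exact: hn.
  have -> : (fun n => mass (iter n L start)) = (fun=> 1) by apply/funext => n; exact: mS.
  move=> H; apply: (@cvg_unique _ (@Rhausdorff R) _ _ _ _ H); exact: cvg_cst.
- move=> x xF.
  apply: (@cvg_unique _ (@Rhausdorff R) (iter n.+1 L start x @[n --> \oo])).
    apply: (@geometric_cvg _ _ (2 * C) tau) => //.
      by rewrite mulr_ge0 ?(do_C db).
    move=> n /=; rewrite -transferB -mulrA; apply: transfer_norm_le => //.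
      by rewrite mulr_ge0 ?(do_C db)// exprn_ge0//; case/andP: t01.
    by move=> y yF; exact: hn.
  by have := cv x xF; rewrite -(cvg_shiftS (fun n => iter n L start x)).
Unshelve. all: by end_near. Qed.

Lemma limit_density_gt0 h x : Cl A h -> pcont F h -> mass h = 1 ->
  (forall y, y \notin F -> L h y = h y) -> x \notin F -> c2 <= x <= c1 ->
  ki <= h x.
Proof.
move=> hh ph h1 Lh xF xK.
have fix_iter n y : y \notin F -> iter n L h y = h y.
  elim: n y => [//|n IH] y yF /=; rewrite -(Lh y yF).
  exact: (transfer_off mk IH yF).
by have := do_inf db hh ph xF xK; rewrite h1 mulr1 fix_iter.
Qed.

(* If [M * h - rho >= 0] is positive at a point, it is bounded below on an
   interval, hence, by the covering property, on all of [[c2, c1]]. *)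
Lemma fixed_point_positive d : (forall x, x \notin F -> 0 <= d x) ->
  (forall x, x \notin F -> L d x = d x) ->
  (exists u v eta, [/\ c2 <= u, u < v, v <= c1, 0 < eta &
     forall y, u < y < v -> y \notin F -> eta <= d y]) ->
  exists2 eta, 0 < eta & forall x, x \notin F -> c2 <= x <= c1 -> eta <= d x.
Proof.
move=> d0 Ld [u [v [eta [c2u uv vc1 e0 de]]]].
have fix_iter n y : y \notin F -> iter n L d y = d y.
  elim: n y => [//|n IH] y yF /=; rewrite -(Ld y yF).
  exact: (transfer_off mk IH yF).
have [n Hn] := mk_cover mk c2u uv vc1.
have La0 := La_gt0 mk.
exists (eta / La ^+ n); first by rewrite divr_gt0 ?exprn_gt0.
move=> x xF xK; have [y [yuv yx]] := Hn n (leqnn n) x (mk_inK mk xF xK).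
have yK : c2 <= y <= c1.
  by case/andP: yuv => uy yv; rewrite (ltW (le_lt_trans c2u uy)) (ltW (lt_le_trans yv vc1)).
have yF : y \notin F.
  apply: contra xF => yF; rewrite -yx; elim: n {Hn yx} => [//|n IH] /=.
  exact: (mk_fF mk IH).
rewrite ler_pdivrMr ?exprn_gt0// mulrC.
apply: le_trans (de y yuv yF) _.
have := @iter_transfer_lower _ _ _ _ _ _ _ _ _ _ _ mk n d y d0 yK.
by rewrite yx fix_iter//; exact.
Qed.

(** [rho] is not known to lie in the cone, so [do_mix] does not apply to it. Instead let [M] be the
    best constant with [rho <= M * h] off [F], for the limit density [h]. The fixed point
    [M * h - rho] vanishes, as otherwise [fixed_point_positive] bounds it from below and [M] could
    be lowered. Comparing masses gives [M = 1]. *)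
Lemma invariant_density_unique (rho : R -> R) (M0 : R) :
  (forall x, 0 <= rho x <= M0) ->
  (forall x, ~~ (c2 <= x <= c1) -> rho x = 0) ->
  regular_discontinuities rho ->
  (forall x, x \notin F -> L rho x = rho x) ->
  mass rho = 1 ->
  [/\ Cl A rho, pcont F rho &
    forall n x, x \notin F -> `|iter n L start x - rho x| <= C * tau ^+ n].
Proof.
move=> rho0 rho_out rho_reg Lrho rho1.
have [h [hh ph h1 Lh hn]] := limit_density.
have ki0 := do_ki db.
have hki x : x \notin F -> c2 <= x <= c1 -> ki <= h x.
  exact: limit_density_gt0.
have hCs x : x \notin F -> h x <= Cs.
  by move=> xF; have := do_sup db hh ph xF; rewrite h1 mulr1.
have [x0 [x0F x0K]] : exists x, x \notin F /\ c2 <= x <= c1.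
  apply: contrapT => /forallNP noF.
  have : mass start = mass (fun=> 0).
    apply: (mass_eq mk start_pcont (pcont_cst F 0)) => x xF xK.
    by have := noF x; case.
  by rewrite start_mass (mass_cst mk) mul0r => /eqP; rewrite oner_eq0.
pose S := [set rho x / h x | x in [set x | x \notin F /\ c2 <= x <= c1]].
have supS : has_sup S.
  split; first by exists (rho x0 / h x0), x0.
  exists (M0 / ki) => _ [x [xF xK] <-].
  have /andP[r0 r1] := rho0 x; have hx := hki x xF xK.
  by rewrite ler_pM// ?invr_ge0 ?(le_trans _ hx) ?(ltW ki0)// lef_pV2 ?posrE// (lt_le_trans ki0).
pose M := sup S.
have rhoM x : x \notin F -> rho x <= M * h x.
  move=> xF; have [xK|xK] := boolP (c2 <= x <= c1); last first.
    by rewrite rho_out// (ll_out hh)// mulr0.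
  have hx := lt_le_trans ki0 (hki x xF xK).
  by rewrite -ler_pdivrMr//; apply: sup_upper_bound => //; exists x.
pose d x := M * h x - rho x.
have Ld x : x \notin F -> L d x = d x.
  by move=> xF; rewrite /d transferB transferZ Lh// Lrho.
have d0 x : x \notin F -> 0 <= d x by move=> xF; rewrite subr_ge0 rhoM.
(* Since [h <= Cs], a gap [eta] would allow the smaller constant [M - eta / Cs]. *)
have no_gap : ~ exists2 eta, 0 < eta &
    forall x, x \notin F -> c2 <= x <= c1 -> eta <= d x.
  move=> [eta e0 de].
  have Cs0 : 0 < Cs.
    exact: lt_le_trans ki0 (le_trans (hki x0 x0F x0K) (hCs x0 x0F)).
  have : M <= M - eta / Cs.
    apply: ge_sup; first by exists (rho x0 / h x0), x0.
    move=> _ [x [xF xK] <-]; have hx := lt_le_trans ki0 (hki x xF xK).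
    rewrite ler_pdivrMr// mulrBl.
    have := de x xF xK; rewrite /d.
    have : eta / Cs * h x <= eta.
      by rewrite mulrAC ler_pdivrMr// ler_wpM2l ?hCs// ltW.
    lra.
  by rewrite lerBrDr gerDl leNgt divr_gt0.
have dz x : x \notin F -> c2 <= x <= c1 -> d x = 0.
  move=> xF xK; apply/eqP; rewrite eq_le d0// andbT leNgt; apply/negP => dx.
  apply: no_gap; apply: fixed_point_positive => //.
  have [l [r [rl rr E]]] := rho_reg x.
  have ch : {for x, continuous h} by case: ph => + _; exact.
  have /andP[xc2 xc1] := mk_inK mk xF xK.
  have dl : (fun y => d y) @ x^'- --> M * h x - l.
    apply: cvgB => //; apply: cvgM; first exact: cvg_cst.
    exact: cvg_at_left_filter.
  have dr : (fun y => d y) @ x^'+ --> M * h x - r.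
    apply: cvgB => //; apply: cvgM; first exact: cvg_cst.
    exact: cvg_at_right_filter.
  (* Twice [d x] is the sum of the one-sided limits of [d] at [x], as [h] is continuous there and
     [rho] has regular discontinuities. One of them is positive, which yields an interval on that
     side. *)
  have : 0 < M * h x - l \/ 0 < M * h x - r.
    have : 0 < (M * h x - l) + (M * h x - r) by move: dx; rewrite /d; lra.
    have [|] := ltP 0 (M * h x - l); [by left|right; lra].
  case=> [pl|pr].
    have pl2 : (M * h x - l) / 2 < M * h x - l.
      by rewrite ltr_pdivrMr// ltr_pMr// ltr1n.
    have [e e0 He] := near_at_leftP (cvgr_gt _ dl _ pl2).
    exists (Num.max c2 (x - e)), x, ((M * h x - l) / 2).
    rewrite le_max lexx gt_max xc2 gtrBl e0 (ltW xc1) divr_gt0//; split => //.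
    move=> y /andP[]; rewrite gt_max => /andP[_ y1] y2 _.
    by apply: ltW; apply: He; rewrite y1.
  have pr2 : (M * h x - r) / 2 < M * h x - r.
    by rewrite ltr_pdivrMr// ltr_pMr// ltr1n.
  have [e e0 He] := near_at_rightP (cvgr_gt _ dr _ pr2).
  exists x, (Num.min c1 (x + e)), ((M * h x - r) / 2).
  rewrite ge_min lexx lt_min xc1 ltrDl e0 (ltW xc2) divr_gt0//; split => //.
  move=> y /andP[y2]; rewrite lt_min => /andP[_ y1] _.
  by apply: ltW; apply: He; rewrite y1 y2.
have rhoE x : x \notin F -> rho x = M * h x.
  move=> xF; have [xK|xK] := boolP (c2 <= x <= c1).
    by apply/esym/eqP; rewrite -subr_eq0; apply/eqP; exact: dz.
  by rewrite rho_out// (ll_out hh)// mulr0.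
have prho : pcont F rho.
  split; last first.
    by exists M0 => x; have /andP[r0 r1] := rho0 x; rewrite ger0_norm.
  move=> x xF; have [cMh _] := pcontZ M ph.
  apply: (continuous_near_eq (cMh x xF)).
  by apply: filterS (near_same_comp xF) => y /same_compC/same_comp_notin; exact: rhoE.
have M1 : M = 1.
  have : mass rho = M * mass h.
    rewrite -(massZ c2 c1 _ ph); apply: (mass_eq mk prho (pcontZ M ph)) => x xF _.
    exact: rhoE.
  by rewrite rho1 h1 mulr1.
have {}rhoE x : x \notin F -> rho x = h x by move=> /rhoE ->; rewrite M1 mul1r.
split => //; last by move=> n x xF; rewrite rhoE//; exact: hn.
split.
- by move=> x _; have /andP[] := rho0 x.
- by move=> x _; exact: rho_out.
- move=> x y xy; rewrite !rhoE ?(ll_lip hh xy)//; first exact: same_comp_notin (same_compC xy).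
  exact: same_comp_notin xy.
Qed.

End InvariantDensity.

(** * Derivatives of the iterates of a smooth density *)

Section SmoothCone.
Variable R : realType.
Implicit Types (x y z : R) (h dh ddh : R -> R).
Variables (c2 c c1 : R) (F : seq R) (f pp pm : R -> R) (th La D : R).
Hypothesis mk : markov_map c2 c c1 F f pp pm th La D.

Local Notation L := (transfer c1 pp pm).
Local Notation Cl := (loglip c2 c1 F).
Local Notation mass := (mass c2 c1).
Local Notation unit_itv := (unit_itv c2 c1).
Local Notation start := (start c2 c1).
Let c21 : c2 < c1 := c2c1 mk.

(** The derivatives are bounded relative to [h] itself: in this form the bounds survive the transfer
    operator, whose weights multiply [h] and its derivatives alike. *)
Record smooth_cone (a1 a2 : R) h dh ddh : Prop := {
  sc_d1 : forall x, x \notin F -> is_derive x (1 : R) h (dh x);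
  sc_d2 : forall x, x \notin F -> is_derive x (1 : R) dh (ddh x);
  sc_b1 : forall x, x \notin F -> `|dh x| <= a1 * h x;
  sc_b2 : forall x, x \notin F -> `|ddh x| <= a2 * h x
}.

Lemma is_derive_if (g dg : R -> R) x : x \notin F ->
  (x < c1 -> is_derive x (1 : R) g (dg x)) ->
  is_derive x (1 : R) (fun y => if y < c1 then g y else 0)
    (if x < c1 then dg x else 0).
Proof.
move=> xF dgx; case: ifPn => xc.
  apply: is_derive_near_eq (dgx xc).
  by apply: filterS (lt_nbhsl xc) => y ->.
have cx : c1 < x.
  rewrite lt_neqAle leNgt xc andbT.
  by apply: contraNneq xF => <-; exact: mk_c1F mk.
apply: is_derive_near_eq (is_derive_constant 0 x).
by apply: filterS (lt_nbhsr cx) => y cy; rewrite ltNge (ltW cy).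
Qed.

(** Product and chain rules for the weight times [h] composed with [psi]. Each extra factor [psi']
    costs at most [th], the higher derivatives of [psi] at most [D] times the weight, and the mixed
    term occurs three times in the second derivative. *)
Lemma half_cone (a1 a2 s : R) psi h dh ddh : 0 <= a1 -> 0 <= a2 ->
  branch c2 c1 F th La D s psi ->
  (forall x, x \notin F -> 0 <= h x) -> vanishing c2 c1 F h ->
  smooth_cone a1 a2 h dh ddh ->
  let p1 : R -> R := derive1 psi in let p2 : R -> R := derive1 p1 in
  let p3 : R -> R := derive1 p2 in
  smooth_cone (D + th * a1) (D + 3 * D * th * a1 + th ^+ 2 * a2)
    (half_transfer c1 s psi h)
    (fun x => if x < c1 then s * (p2 x * h (psi x) + p1 x ^+ 2 * dh (psi x)) else 0)
    (fun x => if x < c1 then s * (p3 x * h (psi x) + 3 * p1 x * p2 x * dh (psi x)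
                                  + p1 x ^+ 3 * ddh (psi x)) else 0).
Proof.
move=> a10 a20 bp h0 hv sc p1 p2 p3; have D0 := mk_D mk.
have dp x : x < c1 -> is_derive x (1 : R) psi (p1 x).
  by move=> xc; apply: derive1_is_derive => //; exact: (br_der1 bp xc).
have dp1 x : x < c1 -> is_derive x (1 : R) p1 (p2 x).
  by move=> xc; apply: derive1_is_derive => //; exact: (br_der2 bp xc).
have dp2 x : x < c1 -> is_derive x (1 : R) p2 (p3 x).
  by move=> xc; apply: derive1_is_derive => //; exact: (br_der3 bp xc).
have bw x : x < c1 -> 0 <= s * p1 x <= th by exact: (br_weight bp).
have bn x : x < c1 -> `|p1 x| = s * p1 x by exact: (branch_norm bp).
have bb2 x : x < c1 -> x \notin F -> c2 <= psi x <= c1 ->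
  `|p2 x| <= D * (s * p1 x) by exact: (br_bound2 bp).
have bb3 x : x < c1 -> x \notin F -> c2 <= psi x <= c1 ->
  `|p3 x| <= D * (s * p1 x) by exact: (br_bound3 bp).
rewrite /half_transfer -/p1; clearbody p1 p2 p3.
have dcomp (g dg : R -> R) x : (forall y, y \notin F -> is_derive y (1 : R) g (dg y)) ->
    x < c1 -> x \notin F -> is_derive x (1 : R) (fun y => g (psi y)) (dg (psi x) * p1 x).
  move=> dgy xc xF; apply: (@is_derive1_comp R g psi); last exact: dp.
  by apply: dgy; exact: (br_notin bp xc xF).
(* The bounds on the higher derivatives of [psi] are available only when [psi x] lies in [[c2, c1]];
   elsewhere [h] and [dh] vanish at [psi x], so the products obey the same bounds. *)
have key x : x < c1 -> x \notin F -> exists w : R, [/\ 0 <= w, w <= th, w = s * p1 x &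
    [/\ `|p1 x| = w, `|p2 x| * h (psi x) <= D * w * h (psi x) &
    `|p2 x| * `|dh (psi x)| <= D * w * `|dh (psi x)| /\
    `|p3 x| * h (psi x) <= D * w * h (psi x)]].
  move=> xc xF; have pF := br_notin bp xc xF.
  have /andP[w0 w1] := bw x xc.
  exists (s * p1 x); split => //; split; first exact: bn.
    have [xK|xK] := boolP (c2 <= psi x <= c1); last by rewrite hv// !mulr0.
    by rewrite ler_wpM2r ?h0//; exact: bb2.
  have [xK|xK] := boolP (c2 <= psi x <= c1).
    split; apply: ler_wpM2r; rewrite ?h0//.
      exact: bb2.
    exact: bb3.
  have hz : h (psi x) = 0 by exact: hv.
  have : `|dh (psi x)| <= 0 by have := sc_b1 sc pF; rewrite hz mulr0.
  rewrite normr_le0 => /eqP dhz; rewrite hz dhz normr0 !mulr0.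
  by split; exact: lexx.
split.
- move=> x xF.
  apply: (@is_derive_if (fun y => s * p1 y * h (psi y))
    (fun y => s * (p2 y * h (psi y) + p1 y ^+ 2 * dh (psi y)))) => // xc.
  have H : is_derive x (1 : R) (fun y => (s * p1 y) * h (psi y))
      ((s * p1 x) * (dh (psi x) * p1 x) + (s * p2 x) * h (psi x)).
    apply: (@is_derive_mul R (fun y => s * p1 y) (fun y => h (psi y))).
      exact: is_derive_scalel (dp1 x xc).
    exact: dcomp (sc_d1 sc) xc xF.
  by apply: is_derive_eq H _; ring.
- move=> x xF.
  apply: (@is_derive_if (fun y => s * (p2 y * h (psi y) + p1 y ^+ 2 * dh (psi y)))
    (fun y => s * (p3 y * h (psi y) + 3 * p1 y * p2 y * dh (psi y)
                                  + p1 y ^+ 3 * ddh (psi y)))) => // xc.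
  apply: is_derive_scalel.
  have H1 : is_derive x (1 : R) (fun y => p2 y * h (psi y))
      (p2 x * (dh (psi x) * p1 x) + p3 x * h (psi x)).
    apply: (@is_derive_mul R p2 (fun y => h (psi y))); first exact: dp2.
    exact: dcomp (sc_d1 sc) xc xF.
  have H2 : is_derive x (1 : R) (fun y => p1 y ^+ 2 * dh (psi y))
      (p1 x ^+ 2 * (ddh (psi x) * p1 x) + (p1 x * p2 x + p2 x * p1 x) * dh (psi x)).
    apply: (@is_derive_mul R (fun y => p1 y ^+ 2) (fun y => dh (psi y))).
      exact: (@is_derive_mul R p1 p1 x _ _ (dp1 x xc) (dp1 x xc)).
    exact: dcomp (sc_d2 sc) xc xF.
  by apply: is_derive_eq (is_derive_add H1 H2) _; ring.
- move=> x xF; case: ifPn => [xc|]; last by rewrite normr0 mulr0.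
  have [w [w0 w1 wE [w2 w3 _]]] := key x xc xF.
  have pF := br_notin bp xc xF.
  have b1 := sc_b1 sc pF.
  rewrite normrM (br_sign bp) mul1r -wE.
  apply: le_trans (ler_normD _ _) _; rewrite !normrM -expr2 w2 (ger0_norm (h0 _ pF)).
  move: b1 w3 (h0 _ pF) (normr_ge0 (dh (psi x))).
  move: `|dh _| (h _) => e k b1 w3 k0 e0.
  have H : w ^+ 2 * e <= (th * w) * (a1 * k).
    by rewrite expr2; apply: ler_pM => //; [exact: mulr_ge0|exact: ler_wpM2r].
  rewrite (_ : (D + th * a1) * (w * k) = D * w * k + (th * w) * (a1 * k)); last by ring.
  exact: lerD.
- move=> x xF; case: ifPn => [xc|]; last by rewrite normr0 mulr0.
  have [w [w0 w1 wE [w2 w3 [w4 w5]]]] := key x xc xF.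
  have pF := br_notin bp xc xF.
  have b1 := sc_b1 sc pF; have b2 := sc_b2 sc pF.
  rewrite normrM (br_sign bp) mul1r -wE.
  apply: le_trans (ler_normD _ _) _; apply: le_trans (lerD (ler_normD _ _) (lexx _)) _.
  rewrite !normrM w2 (ger0_norm (h0 _ pF)) (ger0_norm (_ : (0 : R) <= 3))// -expr2 -exprS.
  move: b1 b2 w3 w4 w5 (h0 _ pF) (normr_ge0 (dh (psi x))) (normr_ge0 (ddh (psi x))).
  move: `|dh _| `|ddh _| (h _) `|p2 x| `|p3 x| => e e' k q2 q3 b1 b2 w3 w4 w5 k0 e0 e'0.
  have H1 : 3 * w * q2 * e <= 3 * D * th * a1 * (w * k).
    have : w * (q2 * e) <= th * (D * w * (a1 * k)).
      apply: (@le_trans _ _ (w * (D * w * e))); first exact: ler_wpM2l.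
      apply: (@le_trans _ _ (th * (D * w * e))).
        by apply: ler_wpM2r => //; rewrite !mulr_ge0// ltW.
      apply: ler_wpM2l; first exact: le_trans w1.
      by apply: ler_wpM2l => //; rewrite mulr_ge0// ltW.
    by move=> H; lra.
  have H2 : w ^+ 3 * e' <= th ^+ 2 * a2 * (w * k).
    have -> : th ^+ 2 * a2 * (w * k) = (th ^+ 2 * w) * (a2 * k) by ring.
    apply: ler_pM => //; first exact: exprn_ge0.
    rewrite exprSr; apply: ler_wpM2r => //.
    by apply: lerXn2r; rewrite ?nnegrE ?(le_trans w0).
  rewrite (mulrDl (D + _)) (mulrDl D); apply: lerD => //; apply: lerD => //.
  by rewrite mulrA.
Qed.

Lemma smooth_coneD (a1 a2 : R) h dh ddh k dk ddk :
  smooth_cone a1 a2 h dh ddh -> smooth_cone a1 a2 k dk ddk ->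
  smooth_cone a1 a2 (fun x => h x + k x) (fun x => dh x + dk x) (fun x => ddh x + ddk x).
Proof.
move=> sh sk; split => x xF.
- by apply: is_derive_add; [exact: (sc_d1 sh)|exact: (sc_d1 sk)].
- by apply: is_derive_add; [exact: (sc_d2 sh)|exact: (sc_d2 sk)].
- rewrite mulrDr; apply: le_trans (ler_normD _ _) _; apply: lerD.
    exact: (sc_b1 sh).
  exact: (sc_b1 sk).
- rewrite mulrDr; apply: le_trans (ler_normD _ _) _; apply: lerD.
    exact: (sc_b2 sh).
  exact: (sc_b2 sk).
Qed.

(** [cone1] and [cone2] are the fixed points of the two recursions of [half_cone], so the same
    constants serve for every iterate. *)
Definition cone1 := D / (1 - th).
Definition cone2 := (D + 3 * D * th * cone1) / (1 - th ^+ 2).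

Lemma cone_ge0 : 0 <= cone1 /\ 0 <= cone2.
Proof.
have D0 := mk_D mk; have /andP[th0 th1] := mk_th mk.
have c10 : 0 <= cone1 by rewrite /cone1 divr_ge0// ?subr_ge0 ltW.
split=> //; rewrite /cone2 divr_ge0//.
  have D0' := ltW D0; apply: addr_ge0 => //.
  by apply: mulr_ge0 => //; apply: mulr_ge0 => //; apply: mulr_ge0.
by rewrite subr_ge0 exprn_ile1// ltW.
Qed.

Lemma iter_start_cone m : exists dh ddh,
  smooth_cone cone1 cone2 (iter m L start) dh ddh.
Proof.
have /andP[th0 th1] := mk_th mk; have [c10 c20] := cone_ge0.
elim: m => [|m [dh [ddh IH]]].
  (* [start] is locally constant off [F]. *)
  exists (fun=> 0), (fun=> 0).
  have s0 x : x \notin F -> 0 <= start x.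
    exact: (ll_ge0 (start_loglip mk (lexx 0))).
  split => x xF; rewrite /= ?normr0.
  - apply: is_derive_near_eq (is_derive_constant (start x) x).
    apply: filterS (near_same_comp xF) => y xy.
    by rewrite /start /unit_itv (same_comp_itv (mk_c2F mk) (mk_c1F mk) xy).
  - exact: is_derive_constant.
  - by rewrite mulr_ge0// s0.
  - by rewrite mulr_ge0// s0.
have hm := iter_transfer_loglip mk m (lexx 0) (start_loglip mk (lexx 0)).
have H1 : D + th * cone1 = cone1.
  by rewrite /cone1; field; rewrite subr_eq0 gt_eqF.
have H2 : D + 3 * D * th * cone1 + th ^+ 2 * cone2 = cone2.
  rewrite /cone2; move: cone1 => a1; field.
  by rewrite subr_eq0 gt_eqF// expr_lt1.
have half s psi : branch c2 c1 F th La D s psi ->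
    exists dk ddk, smooth_cone cone1 cone2 (half_transfer c1 s psi (iter m L start)) dk ddk.
  move=> bp.
  have := half_cone c10 c20 bp (@ll_ge0 _ _ _ _ _ _ hm) (@ll_out _ _ _ _ _ _ hm) IH.
  by rewrite H1 H2 => /= H; eexists; eexists; exact: H.
have [dk [ddk Hk]] := half _ _ (mk_pp mk); have [dk' [ddk' Hk']] := half _ _ (mk_pm mk).
by eexists; eexists; exact: (smooth_coneD Hk Hk').
Qed.

Variables (A Cs ki C tau : R) (N : nat).
Hypothesis db : doeblin c2 c1 F pp pm A Cs ki C tau N.

Lemma start_density m : [/\ Cl A (iter m L start), pcont F (iter m L start),
  mass (iter m L start) = 1 &
  forall x, x \notin F -> 0 <= iter m L start x <= Cs].
Proof.
have A0 := ltW (do_A db).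
have hm : Cl A (iter m L start).
  by elim: m => [|m IH]; [exact: (start_loglip mk A0)|exact: (do_stable db IH)].
have pm' : pcont F (iter m L start).
  exact: (iter_transfer_pcont mk _ (start_pcont mk)).
have m1 : mass (iter m L start) = 1.
  rewrite (mass_iter_transfer mk _ (start_pcont mk)) ?(start_mass mk)//.
  exact: (@ll_out _ _ _ _ _ _ (start_loglip mk A0)).
split=> // x xF; rewrite (ll_ge0 hm xF).
by have := do_sup db hm pm' xF; rewrite m1 mulr1.
Qed.

Variables (X dX ddX : R -> R) (B : R).
Hypothesis XB : forall x, c2 < x < c1 -> [/\ `|X x| <= B, `|dX x| <= B & `|ddX x| <= B].
Hypothesis X1 : forall x, c2 < x < c1 -> is_derive x (1 : R) X (dX x).
Hypothesis X2 : forall x, c2 < x < c1 -> is_derive x (1 : R) dX (ddX x).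

(** [E] does not depend on [m], because neither the sup bound on the iterates nor their cone
    constants do. The derivative [g] may change sign; the added multiple of [unit_itv] brings it
    into the cone, where mixing applies. *)
Lemma observable_derivative : exists2 E : R, 0 <= E & forall m, exists g : R -> R,
  [/\ pcont F g, vanishing c2 c1 F g,
     (forall x, x \notin F -> is_derive x (1 : R) (fun y => iter m L start y * X y) (g x)),
     (forall x, x \notin F -> `|g x| <= E) &
     Cl A (fun x => E * unit_itv x + g x)].
Proof.
have [c10 c20] := cone_ge0.
have Cs0 := do_Cs db; have A0 := do_A db.
have B0 : 0 <= B.
  have [//|+ _ _] := XB (x := (c2 + c1) / 2); first by move: c21; lra.
  exact: le_trans.
(* [G0] bounds the first derivative of the product and [G1] the second. With [E = G0 + G1 / A] the
   function [E + g] is at least [G1 / A] on the core, so its derivative is at most [A] times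
   itself. *)
pose G0 := cone1 * Cs * B + Cs * B.
pose G1 := cone2 * Cs * B + 2 * (cone1 * Cs * B) + Cs * B.
have CB : 0 <= Cs * B by rewrite mulr_ge0.
have CB1 : 0 <= cone1 * Cs * B by rewrite -mulrA mulr_ge0.
have CB2 : 0 <= cone2 * Cs * B by rewrite -mulrA mulr_ge0.
have G00 : 0 <= G0 by rewrite /G0; lra.
have G10 : 0 <= G1 by rewrite /G1; lra.
have E0 : 0 <= G0 + G1 / A by rewrite addr_ge0// divr_ge0// ltW.
exists (G0 + G1 / A) => // m.
have [hm phm hm1 hmC] := start_density m.
have [dh [ddh sc]] := iter_start_cone m.
move: hm phm hm1 hmC sc; move: (iter m L start) => h hm ph h1 hC sc.
have hb x : x \notin F -> [/\ `|h x| <= Cs, `|dh x| <= cone1 * Cs & `|ddh x| <= cone2 * Cs].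
  move=> xF; have /andP[h0 h1'] := hC x xF; split; first by rewrite ger0_norm.
    by apply: le_trans (sc_b1 sc xF) _; exact: ler_wpM2l.
  by apply: le_trans (sc_b2 sc xF) _; exact: ler_wpM2l.
have hz x : x \notin F -> ~~ (c2 <= x <= c1) -> h x = 0 /\ dh x = 0.
  move=> xF xK; have h0 := ll_out hm xF xK; split => //.
  by apply/eqP; rewrite -normr_le0; have := sc_b1 sc xF; rewrite h0 mulr0.
pose g0 x := dh x * X x + h x * dX x.
pose g x := if x \in F then 0 else g0 x.
have gE x : x \notin F -> g x = g0 x by move=> xF; rewrite /g (negbTE xF).
have gz x : x \notin F -> ~~ (c2 <= x <= c1) -> g x = 0.
  by move=> xF xK; have [e1 e2] := hz x xF xK; rewrite gE// /g0 e1 e2 !mul0r addr0.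
have gB x : x \notin F -> `|g x| <= G0.
  move=> xF; have [xK|xK] := boolP (c2 <= x <= c1); last by rewrite gz// normr0.
  have [b1 b2 _] := XB (mk_inK mk xF xK); have [d1 d2 _] := hb x xF.
  rewrite gE// (le_trans (ler_normD _ _))// !normrM.
  by apply: lerD; apply: ler_pM.
pose dg x := if c2 <= x <= c1 then ddh x * X x + 2 * (dh x * dX x) + h x * ddX x else 0.
have dgx x : x \notin F -> is_derive x (1 : R) g (dg x).
  move=> xF; have xx := near_same_comp xF.
  have ggz : \forall y \near x, g y = g0 y.
    by apply: filterS xx => y xy; rewrite gE//; exact: (same_comp_notin (same_compC xy)).
  rewrite /dg; case: ifPn => xK; last first.
    apply: is_derive_near_eq (is_derive_constant 0 x).
    apply: filterS xx => y xy; apply: gz; first exact: (same_comp_notin (same_compC xy)).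
    by rewrite -(same_comp_itv (mk_c2F mk) (mk_c1F mk) xy).
  apply: (is_derive_near_eq ggz).
  have xKK := mk_inK mk xF xK.
  have H1 : is_derive x (1 : R) (fun y => dh y * X y) (dh x * dX x + ddh x * X x).
    exact: (is_derive_mul (sc_d2 sc xF) (X1 xKK)).
  have H2 : is_derive x (1 : R) (fun y => h y * dX y) (h x * ddX x + dh x * dX x).
    exact: (is_derive_mul (sc_d1 sc xF) (X2 xKK)).
  by apply: is_derive_eq (is_derive_add H1 H2) _; ring.
have dgB x : x \notin F -> `|dg x| <= G1.
  move=> xF; rewrite /dg; case: ifPn => xK; last by rewrite normr0.
  have [b1 b2 b3] := XB (mk_inK mk xF xK); have [d1 d2 d3] := hb x xF.
  apply: le_trans (ler_normD _ _) _; apply: lerD; last by rewrite normrM ler_pM.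
  apply: le_trans (ler_normD _ _) _; apply: lerD; first by rewrite normrM ler_pM.
  by rewrite normrM ger0_norm// ler_wpM2l// normrM ler_pM.
exists g; split.
- split; last first.
    exists G0 => x; have [xF|xF] := boolP (x \in F); last exact: gB.
    by rewrite /g xF normr0.
  move=> x xF; apply: differentiable_continuous; apply/derivable1_diffP.
  by have [] := dgx x xF.
- by [].
- move=> x xF; have xx := near_same_comp xF.
  have [xK|xK] := boolP (c2 <= x <= c1).
    rewrite gE// /g0 addrC; exact: (is_derive_mul (sc_d1 sc xF) (X1 (mk_inK mk xF xK))).
  rewrite gz//; apply: is_derive_near_eq (is_derive_constant 0 x).
  apply: filterS xx => y xy; have yF := same_comp_notin (same_compC xy).
  rewrite (ll_out hm yF) ?mul0r// -(same_comp_itv (mk_c2F mk) (mk_c1F mk) xy)//.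
- by move=> x /gB /le_trans; apply; rewrite lerDl divr_ge0// ltW.
- split.
  + move=> x xF; have := gB x xF; rewrite /unit_itv; case: ifPn => xK; last by rewrite gz// mulr0 addr0.
    rewrite mulr1 ler_norml => /andP[g1 _].
    have : 0 <= G1 / A by rewrite divr_ge0// ltW.
    lra.
  + by move=> x xF xK; rewrite /unit_itv (negbTE xK) mulr0 gz// addr0.
  + move=> x y xy; have xF := same_comp_notin xy; have yF := same_comp_notin (same_compC xy).
    have K := same_comp_itv (mk_c2F mk) (mk_c1F mk) xy.
    rewrite /unit_itv -K; case: ifPn => xK; last first.
      by rewrite !gz// -?K// mulr0 addr0 mulr0.
    have Lip : `|g x - g y| <= G1 * `|x - y|.
      apply: (same_comp_lipschitz (dg := dg) xy) => z xz;
        have zF := same_comp_notin (same_compC xz); [exact: dgx|exact: dgB].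
    have e1 : 1 + A * `|x - y| <= expR (A * `|x - y|) := expR_ge1Dx _.
    have gy : - G0 <= g y by have := gB y yF; rewrite ler_norml => /andP[].
    have gx : g x <= g y + G1 * `|x - y|.
      by rewrite -lerBlDl (le_trans (ler_norm _)).
    rewrite !mulr1.
    apply: (@le_trans _ _ ((1 + A * `|x - y|) * (G0 + G1 / A + g y))); last first.
      apply: ler_wpM2r => //; have : 0 <= G1 / A by rewrite divr_ge0// ltW.
      lra.
    have : G1 * `|x - y| <= A * `|x - y| * (G0 + G1 / A + g y).
      have -> : G1 * `|x - y| = A * `|x - y| * (G1 / A) by field; rewrite gt_eqF.
      by apply: ler_wpM2l; [rewrite mulr_ge0// ltW|lra].
    lra.
Qed.

End SmoothCone.

(** * Iterates of the susceptibility operator *)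

Section StepFunctions.
Variable R : realType.
Implicit Types (x y p q : R) (F : seq R) (s : seq (R * R)).

Definition step p x : R := if x < p then 1 else 0.

Definition steps s x : R := \sum_(t <- s) t.1 * step t.2 x.

Lemma same_comp_trans F x y z : same_comp F x y -> same_comp F x z -> same_comp F y z.
Proof.
move=> xy xz p pF; have xp := same_comp_refl (same_comp_notin xy) pF.
rewrite -(pmulr_rgt0 _ xp); have := mulr_gt0 (xy p pF) (xz p pF).
by congr (0 < _); ring.
Qed.

(** Induction on the sorted points, from the left: the smallest point [p] carries the jump of [w] at
    [p], and replacing [w] to the left of [p] by its value just to the right removes that jump. *)
Lemma locally_constant_steps F (w : R -> R) :
  (forall x y, same_comp F x y -> w x = w y) ->
  (forall x, (forall p, p \in F -> p < x) -> w x = 0) ->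
  exists2 s, (forall t, t \in s -> t.2 \in F) &
    forall x, x \notin F -> w x = steps s x.
Proof.
suff sorted_case (G : seq R) : sorted <%R G -> forall w : R -> R,
    (forall x y, same_comp G x y -> w x = w y) ->
    (forall x, (forall p, p \in G -> p < x) -> w x = 0) ->
    exists2 s, (forall t, t \in s -> t.2 \in G) &
      forall x, x \notin G -> w x = steps s x.
  move=> Hw H0; pose G := sort <=%R (undup F).
  have GF : G =i F by move=> x; rewrite mem_sort mem_undup.
  have sG : sorted <%R G by rewrite sort_lt_sorted undup_uniq.
  have [||s sF Hs] := sorted_case G sG w.
  - by move=> x y xy; apply: Hw => p pF; apply: xy; rewrite GF.
  - by move=> x Hx; apply: H0 => p pF; apply: Hx; rewrite GF.
  - exists s => [t /sF|x xF]; first by rewrite GF.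
    by apply: Hs; rewrite GF.
elim: G => [|p G IH] sG {}w Hw H0.
  exists [::] => // x _; rewrite /steps big_nil; exact: H0.
have pG q : q \in G -> p < q.
  by move: sG; rewrite /= (path_sortedE lt_trans) => /andP[/allP + _]; exact.
have pnG : p \notin G by apply/negP => /pG; rewrite ltxx.
(* A sample point in the component just to the right of [p]. *)
have [m pm sm] : exists2 m, p < m & same_comp G p m.
  have /nbhs_ballP[e /= e0 He] := near_same_comp pnG.
  exists (p + e / 2); first by rewrite ltrDl divr_gt0.
  apply: He; rewrite /ball/= opprD addrA subrr add0r normrN gtr0_norm ?divr_gt0//.
  by rewrite ltr_pdivrMr// ltr_pMr// ltr1n.
pose w' x := if x <= p then w m else w x.
have up x y : p < x -> p < y -> same_comp G x y -> w x = w y.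
  move=> px py xy; apply: Hw => q; rewrite inE => /predU1P[->|]; last exact: xy.
  by rewrite nmulr_rgt0 ?subr_lt0.
have [||s sF Hs] := IH (path_sorted sG) w'.
- move=> x y; rewrite /w'; case: (leP x p) => xp; case: (leP y p) => yp xy //.
  + apply: up => //; apply: (@same_comp_trans _ p) => //.
    apply: same_compC; apply: (same_comp_between (same_compC xy)).
    by rewrite ge_min le_max xp (ltW yp) orbT.
  + apply: up => //; apply: (@same_comp_trans _ p) => //; last first.
    apply: same_compC; apply: (same_comp_between xy).
    by rewrite ge_min le_max yp (ltW xp) !orbT.
  + exact: up.
- move=> x Hx; rewrite /w'; case: (leP x p) => xp.
    apply: H0 => q; rewrite inE => /predU1P[->//|qG].
    by have := lt_trans (pG q qG) (Hx q qG); rewrite ltNge xp.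
  by apply: H0 => q; rewrite inE => /predU1P[->//|]; exact: Hx.
(* All points to the left of the smallest point [p] form one component, sampled at [p - 1]. *)
exists ((w (p - 1) - w m, p) :: s).
  by move=> t; rewrite !inE => /predU1P[->|/sF ->]; rewrite ?eqxx ?orbT.
move=> x; rewrite inE negb_or => /andP[xp xG].
rewrite /steps big_cons/= -/(steps s x) -Hs// /w' /step.
case: (ltP x p) => xp'; last first.
  by rewrite mulr0 add0r leNgt lt_neqAle eq_sym xp xp'.
rewrite (ltW xp') mulr1 subrK; apply: Hw => q; rewrite inE => /predU1P[->|qG].
  by rewrite mulr_gt0// subr_gt0// ltrBlDr ltrDl.
rewrite mulr_gt0// subr_gt0 ?(lt_trans xp' (pG _ qG))//.
by rewrite (lt_trans _ (pG _ qG))// ltrBlDr ltrDl.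
Qed.

End StepFunctions.

(** * The susceptibility operator on jumps and on primitives *)

Section Susceptibility.
Variable R : realType.
Local Notation leb := (@lebesgue_measure R).
Implicit Types (x y z p q : R) (u v w g k : R -> R) (s : seq (R * R)).
Variables (c2 c c1 : R) (F : seq R) (f pp pm : R -> R) (th La D : R).
Hypothesis mk : markov_map c2 c c1 F f pp pm th La D.

Local Notation L := (transfer c1 pp pm).
Local Notation T := (L0 c f pp pm).
Local Notation mass := (mass c2 c1).
Let c21 : c2 < c1 := c2c1 mk.

Lemma L0_lt u x : x < c1 -> T u x = u (pp x) - u (pm x).
Proof. by move=> xc; rewrite /L0 /chi (mk_fc mk) xc !mul1r. Qed.

Lemma L0_gt u x : c1 < x -> T u x = 0.
Proof.
by move=> cx; rewrite /L0 /chi (mk_fc mk) ltNge (ltW cx)/= gt_eqF// !mul0r subrr.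
Qed.

Lemma notin_cases x : x \notin F -> x < c1 \/ c1 < x.
Proof.
move=> xF; have [xc|xc|xc] := ltgtP x c1; [by left|by right|].
by rewrite xc (mk_c1F mk) in xF.
Qed.

Lemma L0_off u v : (forall x, x \notin F -> u x = v x) ->
  forall x, x \notin F -> T u x = T v x.
Proof.
move=> uv x xF; have [xc|cx] := notin_cases xF; last by rewrite !L0_gt.
rewrite !L0_lt// !uv//; first exact: (br_notin (mk_pm mk)).
exact: (br_notin (mk_pp mk)).
Qed.

Lemma iter_L0B n u v x : iter n T (fun y => u y - v y) x = iter n T u x - iter n T v x.
Proof.
elim: n x => [//|n IH] x /=; rewrite {1}/L0 !IH /L0; ring.
Qed.

(** For [x < c1] the preimages satisfy [pp x < c < pm x]. If [p <= c], the second term vanishes and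
    the first tests [x < f p]. If [p > c], the first term is one and the second tests [f p < x]. The
    minus sign in [L0] thus undoes the orientation reversal of the decreasing branch, and the
    coefficient of the jump is kept. *)
Lemma L0_step p x : p \in F -> x \notin F -> T (step p) x = step (f p) x.
Proof.
move=> pF xF; have /andP[p2 p1] := mk_Fsub mk pF.
have fpF := mk_fF mk pF; have /andP[_ fp1] := mk_Fsub mk fpF.
have [xc|cx] := notin_cases xF; last first.
  by rewrite L0_gt// /step ltNge (le_trans fp1 (ltW cx)).
rewrite L0_lt// /step.
have ppx : pp x < c by rewrite -(mk_ppc1 mk); exact: (mk_ppmono mk).
have pmx : c < pm x by rewrite -(mk_pmc1 mk); exact: (mk_pmmono mk).
have xfp : x != f p by apply: contraNneq xF => ->.
have [pc|/ltW cp] := leP p c.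
  rewrite [pm x < p]ltNge (le_trans pc (ltW pmx))/= subr0.
  have E : pp (f p) = p by apply: (mk_left mk); rewrite p2 pc.
  have [xf|fx|e] := ltgtP x (f p); last by rewrite e eqxx in xfp.
    by rewrite -E (mk_ppmono mk).
  by rewrite -E ltNge ltW// (mk_ppmono mk)// ltW.
rewrite (lt_le_trans ppx cp).
have E : pm (f p) = p by apply: (mk_right mk); rewrite cp p1.
have [xf|fx|e] := ltgtP x (f p); last by rewrite e eqxx in xfp.
  by rewrite -[X in pm x < X]E ltNge ltW ?subr0// (mk_pmmono mk).
by rewrite -[X in pm x < X]E (mk_pmmono mk) ?subrr// ltW.
Qed.

Lemma L0_tail k x : pcont F k -> vanishing c2 c1 F k -> x \notin F ->
  T (tail c1 k) x = tail c1 (L k) x.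
Proof.
move=> pk k0 xF; have [xc|cx] := notin_cases xF.
  by rewrite L0_lt// (tail_transfer mk)// ltW.
by rewrite L0_gt// tail_ge// ltW.
Qed.

Lemma iter_f_in n p : p \in F -> iter n f p \in F.
Proof. by move=> pF; elim: n => [//|n IH]; exact: (mk_fF mk). Qed.

Lemma iter_vanishing n k : vanishing c2 c1 F k -> vanishing c2 c1 F (iter n L k).
Proof. by move=> k0 x xF xK; exact: (iter_transfer_out mk). Qed.

Lemma iter_L0_decomposition n s u g : pcont F g -> vanishing c2 c1 F g ->
  (forall t, t \in s -> t.2 \in F) ->
  (forall x, x \notin F -> u x = steps s x - tail c1 g x) ->
  forall x, x \notin F -> iter n T u x =
    \sum_(t <- s) t.1 * step (iter n f t.2) x - tail c1 (iter n L g) x.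
Proof.
move=> pg g0 sF ue; elim: n => [|n IH] x xF; first exact: ue.
rewrite /= (L0_off IH xF).
have -> : T (fun y => \sum_(t <- s) t.1 * step (iter n f t.2) y -
    tail c1 (iter n L g) y) x =
    \sum_(t <- s) t.1 * T (step (iter n f t.2)) x - T (tail c1 (iter n L g)) x.
  rewrite /L0 !mulrBr !mulr_sumr.
  under [X in _ = X - _]eq_bigr do rewrite mulrBr mulrCA (mulrCA _ (chi _ _ _)).
  by rewrite big_split/= sumrN; ring.
rewrite L0_tail//; last 2 first.
- exact: (iter_transfer_pcont mk).
- exact: iter_vanishing.
congr (_ - _); apply: eq_big_seq => t ts.
by rewrite L0_step//; apply: iter_f_in; exact: sF.
Qed.

(** [u + tail c1 g] has derivative zero off [F] and vanishes to the right of [c1], so it is a step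
    function. *)
Lemma primitive_decomposition u g : pcont F g -> vanishing c2 c1 F g ->
  vanishing c2 c1 F u ->
  (forall x, x \notin F -> is_derive x (1 : R) u (g x)) ->
  exists2 s, (forall t, t \in s -> t.2 \in F) &
    forall x, x \notin F -> u x = steps s x - tail c1 g x.
Proof.
move=> pg g0 u0 du; pose w x := u x + tail c1 g x.
have dw x : x \notin F -> is_derive x (1 : R) w 0.
  move=> xF; apply: is_derive_eq (is_derive_add (du x xF) (tail_derive pg xF _ _)) _.
  - by apply: contraNneq xF => ->; exact: (mk_c1F mk).
  - by move=> y yF; apply: vanishing_gt g0 yF.
  - by rewrite subrr.
have [||s sF Hs] := @locally_constant_steps R F w.
- move=> x y; wlog xy : x y / x <= y.
    move=> H; have [|/ltW] := leP x y; first exact: H.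
    by move=> yx /same_compC sxy; apply/esym; exact: H.
  move=> sxy.
  have zF z : x <= z <= y -> z \notin F.
    move=> xzy; apply: (same_comp_notin (same_compC (same_comp_between sxy _))).
    by rewrite min_l// max_r.
  apply: (@is_derive0_const R F) => //.
    apply: derivable_within_continuous => z; rewrite in_itv/= => /zF zF'.
    by have [] := dw z zF'.
- move=> x Hx; have cx : c1 < x by apply: Hx; exact: (mk_c1F mk).
  have xF : x \notin F by apply/negP => /Hx; rewrite ltxx.
  by rewrite /w (vanishing_gt u0 xF cx) tail_ge ?addr0// ltW.
- by exists s => // x xF; rewrite -Hs// /w addrK.
Qed.

(** At [c2 - 1], to the left of every jump, [u] vanishes, every step equals one and the tail is the
    whole mass of [g]. *)
Lemma steps_mass s u g : pcont F g -> vanishing c2 c1 F g -> vanishing c2 c1 F u ->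
  (forall t, t \in s -> t.2 \in F) ->
  (forall x, x \notin F -> u x = steps s x - tail c1 g x) ->
  \sum_(t <- s) t.1 = mass g.
Proof.
move=> pg g0 u0 sF ue; pose x := c2 - 1.
have xc : x < c2 by rewrite /x ltrBlDr ltrDl.
have xF : x \notin F by apply/negP => /(mk_Fsub mk); rewrite leNgt xc.
have := ue x xF; rewrite u0// ?leNgt ?xc// (tail_out mk pg g0 (ltW xc)).
move=> /esym/eqP; rewrite subr_eq0 => /eqP; rewrite /mass -/(tail c1 g c2) => <-.
rewrite /steps; apply: eq_big_seq => t /sF tF.
by rewrite /step (lt_le_trans xc) ?mulr1//; have /andP[] := mk_Fsub mk tF.
Qed.

(** Without jumps [u + tail c1 g] is constant, and it vanishes far to the right. This covers a field
    that vanishes on the postcritical set. *)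
Lemma primitive_continuous u g : pcont F g -> vanishing c2 c1 F g ->
  vanishing c2 c1 F u -> continuous u ->
  (forall x, x \notin F -> is_derive x (1 : R) u (g x)) ->
  forall x, u x = - tail c1 g x.
Proof.
move=> pg g0 u0 cu du x; pose w x := u x + tail c1 g x.
have dw y : y \notin F -> is_derive y (1 : R) w 0.
  move=> yF; apply: is_derive_eq (is_derive_add (du y yF) (tail_derive pg yF _ _)) _.
  - by apply: contraNneq yF => ->; exact: (mk_c1F mk).
  - by move=> z zF; apply: vanishing_gt g0 zF.
  - by rewrite subrr.
have cw : continuous w.
  by move=> y; apply: cvgD; [exact: cu|exact: (tail_continuous pg)].
pose y := Num.max x c1 + 1.
have yc : c1 < y by rewrite /y ltr_pwDr// le_max lexx orbT.
have yF : y \notin F by apply/negP => /(mk_Fsub mk); rewrite [y <= _]leNgt yc andbF.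
have wxy : w x = w y.
  apply: (@is_derive0_const R F).
  - by rewrite /y ler_wpDr// le_max lexx.
  - exact: continuous_subspaceT.
have wy : w y = 0 by rewrite /w (vanishing_gt u0 yF yc) tail_ge ?addr0// ltW.
by apply/eqP; rewrite -addr_eq0 -/(w x) wxy wy.
Qed.

Lemma L0_pcont u : pcont F u -> pcont F (T u).
Proof.
move=> [cu [M uM]]; split; last first.
  exists (2 * M) => x; rewrite /L0.
  have chi1 : `|chi c f x| <= 1.
    rewrite /chi; case: (x < f c); first by rewrite normr1.
    by case: (x == f c); rewrite ?normr0// ger0_norm// invf_le1// ler1n.
  apply: le_trans (ler_normB _ _) _; rewrite !normrM mulrDl !mul1r.
  by apply: lerD; rewrite -[M]mul1r ler_pM.
move=> x xF; have [xc|cx] := notin_cases xF.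
  apply: (@continuous_near_eq _ _ (fun y => u (pp y) - u (pm y))).
    have cont (e : R) psi : branch c2 c1 F th La D e psi -> {for x, continuous (u \o psi)}.
      move=> bp; apply: continuous_comp.
        apply: differentiable_continuous; apply/derivable1_diffP; exact: (br_der1 bp xc).
      by apply: cu; exact: (br_notin bp xc xF).
    by apply: cvgB; [exact: (cont _ _ (mk_pp mk))|exact: (cont _ _ (mk_pm mk))].
  by apply: filterS (lt_nbhsl xc) => y yc; rewrite L0_lt.
apply: (@continuous_near_eq _ _ (fun=> 0)); first exact: cvg_cst.
by apply: filterS (lt_nbhsr cx) => y cy; rewrite L0_gt.
Qed.

Lemma iter_L0_pcont n u : pcont F u -> pcont F (iter n T u).
Proof. by move=> pu; elim: n => [//|n IH]; exact: L0_pcont. Qed.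

(** The two terms of [L0] carry no weight, so each application may double the bound. *)
Lemma iter_L0_bound n u e : 0 <= e -> (forall x, x \notin F -> `|u x| <= e) ->
  forall x, x \notin F -> `|iter n T u x| <= 2 ^+ n * e.
Proof.
move=> e0 ue; elim: n => [|n IH] x xF; first by rewrite expr0 mul1r ue.
rewrite /=; have [xc|cx] := notin_cases xF; last first.
  by rewrite L0_gt// normr0 mulr_ge0// exprn_ge0.
rewrite L0_lt// (le_trans (ler_normB _ _))// exprS -mulrA.
have := IH _ (br_notin (mk_pp mk) xc xF); have := IH _ (br_notin (mk_pm mk) xc xF).
lra.
Qed.

End Susceptibility.

Section Asymptotics.
Variable R : realType.
Local Notation leb := (@lebesgue_measure R).
Implicit Types (x y z p q : R) (u v w g k h : R -> R) (s : seq (R * R)).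

Lemma is_derive_big (I : eqType) (s : seq I) (h : I -> R -> R) (d : I -> R) x :
  (forall t, t \in s -> is_derive x (1 : R) (h t) (d t)) ->
  is_derive x (1 : R) (fun y => \sum_(t <- s) h t y) (\sum_(t <- s) d t).
Proof.
elim: s => [|t s IH] H.
  rewrite big_nil (_ : (fun y => _) = fun=> 0); last by apply/funext => y; rewrite big_nil.
  exact: is_derive_constant.
rewrite big_cons (_ : (fun y => _) = fun y => h t y + \sum_(r <- s) h r y); last first.
  by apply/funext => y; rewrite big_cons.
apply: is_derive_add; first by apply: H; rewrite mem_head.
by apply: IH => r rs; apply: H; rewrite inE rs orbT.
Qed.

Lemma continuous_big (I : eqType) (s : seq I) (h : I -> R -> R) x :
  (forall t, t \in s -> {for x, continuous (h t)}) ->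
  {for x, continuous (fun y => \sum_(t <- s) h t y)}.
Proof.
elim: s => [|t s IH] H.
  rewrite (_ : (fun y => _) = fun=> 0); last by apply/funext => y; rewrite big_nil.
  exact: cvg_cst.
rewrite (_ : (fun y => _) = fun y => h t y + \sum_(r <- s) h r y); last first.
  by apply/funext => y; rewrite big_cons.
have Ht : {for x, continuous (h t)} by apply: H; rewrite mem_head.
have Hs : {for x, continuous (fun y => \sum_(r <- s) h r y)}.
  by apply: IH => r rs; apply: H; rewrite inE rs orbT.
exact: (cvgD Ht Hs).
Qed.

Lemma Rintegral_pcont_norm_le F h (M p q : R) : p <= q -> pcont F h ->
  (forall x, p < x < q -> x \notin F -> `|h x| <= M) ->
  `|\int[leb]_(t in `[p, q]) h t| <= M * (q - p).
Proof.
move=> pq ph hM.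
have cstE (r : R) : \int[leb]_(t in `[p, q]) cst r t = r * (q - p).
  rewrite Rintegral_cst// /= lebesgue_measure_itv/= lte_fin.
  case: ifPn => [_|]; first by rewrite -EFinD.
  rewrite -leNgt => qp; have -> : q = p by apply/eqP; rewrite eq_le pq qp.
  by rewrite subrr !mulr0.
rewrite ler_norml -mulNr -!cstE; apply/andP; split.
  apply: (Rintegral_pcont_le pq (pcont_cst F (- M)) ph) => x xpq xF.
  by have := hM x xpq xF; rewrite ler_norml => /andP[].
apply: (Rintegral_pcont_le pq ph (pcont_cst F M)) => x xpq xF.
by have := hM x xpq xF; rewrite ler_norml => /andP[].
Qed.

Lemma pcont_sub (F F2 : seq R) h : {subset F <= F2} -> pcont F h -> pcont F2 h.
Proof.
by move=> sF [ch bh]; split => // x xF; apply: ch; apply: contra xF; exact: sF.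
Qed.

(** Serves integrands with unknown endpoint values, such as [derive1 phi] at [a0] and [b], where
    [phi] is arbitrary on one side. *)
Lemma Rintegral_eq_interior F h k p q : pcont F k ->
  (forall x, p < x < q -> h x = k x) ->
  \int[leb]_(t in `[p, q]) h t = \int[leb]_(t in `[p, q]) k t.
Proof.
move=> [ck _] hk.
have mk' : measurable_fun `]p, q[ k.
  apply: measurable_funS (measurable_fun_pcont (p := p) (q := q) _) => //.
    exact: subset_itv_oo_cc.
  by move=> x _; exact: ck.
rewrite /Rintegral; congr fine; apply: eq_integral_itv_bounded => //.
  apply: eq_measurable_fun mk' => x; rewrite inE/= in_itv/= => /hk ->//. 
Qed.

End Asymptotics.

(** * Asymptotics of the terms of the series *)

Section TermAsymptotics.
Variable R : realType.
Local Notation leb := (@lebesgue_measure R).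
Implicit Types (x y z p q : R) (u v w g k h : R -> R) (s : seq (R * R)).
Variables (c2 c c1 : R) (F : seq R) (f pp pm : R -> R) (th La D : R).
Hypothesis mk : markov_map c2 c c1 F f pp pm th La D.
Variables (a0 b : R) (phi G dG : R -> R) (BG : R).
Hypothesis a0c2 : a0 <= c2.
Hypothesis c1b : c1 <= b.
Hypothesis phiG : forall x, a0 <= x <= b -> phi x = G x.
Hypothesis dGx : forall x, a0 <= x <= b -> is_derive x (1 : R) G (dG x).
Hypothesis cdG : forall x, a0 <= x <= b -> {for x, continuous dG}.
Hypothesis GB : forall x, a0 <= x <= b -> `|G x| <= BG.
Hypothesis dGB : forall x, a0 <= x <= b -> `|dG x| <= BG.

Local Notation L := (transfer c1 pp pm).
Local Notation T := (L0 c f pp pm).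
Local Notation mass := (mass c2 c1).
Local Notation start := (start c2 c1).
Let c21 : c2 < c1 := c2c1 mk.
Let a0b : a0 <= b.
Proof. by apply: le_trans a0c2 (le_trans (ltW c21) c1b). Qed.

Definition pairing (w : R -> R) : R := \int[leb]_(x in `[a0, b]) (w x * derive1 phi x).

(** [G] is a smooth extension of [phi], controlled only on [[a0, b]]. Cutting it makes it bounded on
    the line, with [a0] and [b] as additional exceptional points. *)
Definition Gcut x : R := if a0 <= x <= b then G x else 0.
Definition dGcut x : R := if a0 <= x <= b then dG x else 0.
Let F2 := a0 :: b :: F.

Let BG0 : 0 <= BG.
Proof. by apply: le_trans (GB (x := a0) _); rewrite ?lexx. Qed.

Let FF2 : {subset F <= F2}.
Proof. by move=> x xF; rewrite !inE xF !orbT. Qed.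

Lemma cut_pcont g : (forall x, a0 <= x <= b -> {for x, continuous g}) ->
  (forall x, a0 <= x <= b -> `|g x| <= BG) ->
  pcont F2 (fun x => if a0 <= x <= b then g x else 0).
Proof.
move=> cg gB; split; last first.
  by exists BG => x; case: ifPn => [/gB|] //; rewrite normr0.
move=> x xF; have xx := near_same_comp xF.
have aF : a0 \in F2 by rewrite !inE eqxx.
have bF : b \in F2 by rewrite !inE eqxx orbT.
have E y : same_comp F2 x y -> (a0 <= y <= b) = (a0 <= x <= b).
  by move=> xy; rewrite (same_comp_le aF xy) (same_comp_le' bF xy).
have [xI|xI] := boolP (a0 <= x <= b).
  apply: (continuous_near_eq (cg x xI)); apply: filterS xx => y xy.
  by rewrite (E _ xy) xI.
apply: (@continuous_near_eq _ _ (fun=> 0)); first exact: cvg_cst.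
by apply: filterS xx => y xy; rewrite (E _ xy) (negbTE xI).
Qed.

Lemma Gcut_pcont : pcont F2 Gcut.
Proof.
apply: cut_pcont => // x xI; apply: differentiable_continuous; apply/derivable1_diffP.
by have [] := dGx xI.
Qed.

Lemma dGcut_pcont : pcont F2 dGcut.
Proof. exact: cut_pcont. Qed.

Lemma pairingE w : pcont F w -> pairing w = \int[leb]_(x in `[a0, b]) (w x * dGcut x).
Proof.
move=> pw; apply: (@Rintegral_eq_interior R F2).
  by apply: pcontM dGcut_pcont; exact: pcont_sub pw.
move=> x /andP[ax xb]; rewrite /dGcut !ltW//; congr (_ * _).
apply: is_derive_derive1; apply: is_derive_near_eq (dGx _); last by rewrite !ltW.
near=> y; apply: phiG; apply/andP; split; apply: ltW; near: y.
  exact: lt_nbhsr.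
exact: lt_nbhsl.
Unshelve. all: by end_near. Qed.

Lemma pairingB w v : pcont F w -> pcont F v ->
  pairing (fun x => w x - v x) = pairing w - pairing v.
Proof.
move=> pw pv; rewrite !pairingE//; last exact: pcontB.
rewrite -RintegralB//; last 2 first.
- by apply: (@pcont_integrable _ F2); apply: pcontM dGcut_pcont; exact: pcont_sub pw.
- by apply: (@pcont_integrable _ F2); apply: pcontM dGcut_pcont; exact: pcont_sub pv.
by apply: eq_Rintegral => x _; rewrite mulrBl.
Qed.

Lemma pairing_bound w (e : R) : pcont F w -> (forall x, x \notin F -> `|w x| <= e) ->
  `|pairing w| <= e * BG * (b - a0).
Proof.
move=> pw we; rewrite pairingE//.
apply: (@Rintegral_pcont_norm_le R F2) => //.
  by apply: pcontM dGcut_pcont; exact: pcont_sub pw.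
move=> x /andP[/ltW ax /ltW xb] xF; have xI : a0 <= x <= b by rewrite ax xb.
rewrite normrM /dGcut xI; apply: ler_pM => //; last exact: dGB.
by apply: we; apply: contra xF; exact: FF2.
Qed.

(** Integration by parts, carried out at once for the jumps and the tail through an explicit
    primitive [W]. The boundary term at [a0] is zero because the coefficients of the jumps add up to
    the mass of [k]. *)
Lemma pairing_formula (s : seq (R * R)) w k : pcont F w ->
  pcont F k -> vanishing c2 c1 F k -> (forall t, t \in s -> t.2 \in F) ->
  (forall x, x \notin F -> w x = steps s x - tail c1 k x) ->
  mass k = \sum_(t <- s) t.1 ->
  pairing w = \sum_(t <- s) t.1 * G t.2 - \int[leb]_(x in `[a0, b]) (Gcut x * k x).
Proof.
move=> pw pk k0 sF wE mk1.
(* [G (Num.min x p)] is a primitive of [step p x * dG x] that stays continuous at [p]. *)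
pose W x := \sum_(t <- s) t.1 * G (Num.min x t.2) - G x * tail c1 k x.
have cG x : a0 <= x <= b -> {for x, continuous G}.
  move=> xI; apply: differentiable_continuous; apply/derivable1_diffP.
  by have [] := dGx xI.
have pwk : pcont F2 (fun x => w x * dGcut x + Gcut x * k x).
  apply: pcontD; apply: pcontM.
  - exact: pcont_sub pw.
  - exact: dGcut_pcont.
  - exact: Gcut_pcont.
  - exact: pcont_sub pk.
have sI t : t \in s -> a0 <= t.2 <= b.
  by move=> /sF/(mk_Fsub mk)/andP[t2 t1]; rewrite (le_trans a0c2 t2) (le_trans t1 c1b).
have [cwk [M wkM]] := pwk.
have I : \int[leb]_(x in `[a0, b]) (w x * dGcut x + Gcut x * k x) = W b - W a0.
  apply: (@FTC_pcont R F2 _ _ a0 b M) => //; last by move=> x _; exact: cwk.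
  - apply: continuous_in_subspaceT => x; rewrite inE/= in_itv/= => xI.
    apply: (@cvgB _ R^o); last first.
      apply: cvgM; first exact: (cG _ xI).
      exact: (tail_continuous pk).
    apply: (continuous_big (h := fun t y => t.1 * G (Num.min y t.2))) => t ts.
    apply: cvgM; first exact: cvg_cst.
    apply: (@continuous_comp _ _ _ (fun y => Num.min y t.2) G).
      by apply: (@continuous_min _ _ id (fun=> t.2)); [exact: cvg_id|exact: cvg_cst].
    by apply: cG; have := sI t ts; case: (leP x t.2).
  - move=> x xI xF2; have xI' : a0 <= x <= b by case/andP: xI => ? ?; rewrite !ltW.
    have xF : x \notin F by apply: contra xF2; exact: FF2.
    have dt t : t \in s -> is_derive x (1 : R) (fun y => t.1 * G (Num.min y t.2))
        (t.1 * (dG x * step t.2 x)).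
      move=> ts; apply: is_derive_scalel; rewrite /step.
      have [xt|tx|xt] := ltgtP x t.2; last by rewrite xt (sF t ts) in xF.
        rewrite mulr1; apply: is_derive_near_eq (dGx xI').
        by apply: filterS (lt_nbhsl xt) => y yt; rewrite min_l// ltW.
      rewrite mulr0; apply: is_derive_near_eq (is_derive_constant (G t.2) x).
      by apply: filterS (lt_nbhsr tx) => y yt; rewrite min_r// ltW.
    have dtl : is_derive x (1 : R) (tail c1 k) (- k x).
      apply: (tail_derive pk xF); first by apply: contraNneq xF => ->; exact: (mk_c1F mk).
      by move=> y yF; exact: (vanishing_gt k0 yF).
    apply: is_derive_eq (is_derive_sub (is_derive_big dt) (is_derive_mul (dGx xI') dtl)) _.
    rewrite (wE x xF) /dGcut /Gcut xI' /steps mulrBl mulr_suml.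
    rewrite (eq_bigr (fun t => t.1 * step t.2 x * dG x)); last by move=> t _; ring.
    by ring.
have : W b - W a0 = \sum_(t <- s) t.1 * G t.2.
  have tE : tail c1 k c2 = \sum_(t <- s) t.1 by rewrite -mk1.
  rewrite /W (tail_ge k c1b) mulr0 subr0 (tail_out mk pk k0 a0c2) tE.
  rewrite (eq_big_seq (fun t => t.1 * G t.2)); last first.
    by move=> t /sI/andP[_ tb]; rewrite min_r.
  rewrite [X in _ - (X - _)](eq_big_seq (fun t => t.1 * G a0)); last first.
    by move=> t /sI/andP[ta _]; rewrite min_l.
  by rewrite -mulr_suml; ring.
rewrite -I pairingE// RintegralD//; last 2 first.
- by apply: (@pcont_integrable _ F2); apply: pcontM dGcut_pcont; exact: pcont_sub pw.
- by apply: (@pcont_integrable _ F2); apply: (pcontM Gcut_pcont); exact: pcont_sub pk.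
by move=> <-; rewrite addrK.
Qed.

Variables (A Cs ki C tau : R) (N : nat).
Hypothesis db : doeblin c2 c1 F pp pm A Cs ki C tau N.
Variable rho : R -> R.
Hypothesis rhoCl : loglip c2 c1 F A rho.
Hypothesis prho : pcont F rho.
Hypothesis rho1 : mass rho = 1.
Hypothesis Lrho : forall x, x \notin F -> L rho x = rho x.
Hypothesis rho_lim : forall n x, x \notin F ->
  `|iter n L start x - rho x| <= C * tau ^+ n.
Variables (X dX ddX : R -> R) (B : R).
Hypothesis X_le1 : forall x, `|X x| <= 1.
Hypothesis XB : forall x, c2 < x < c1 -> [/\ `|X x| <= B, `|dX x| <= B & `|ddX x| <= B].
Hypothesis X1 : forall x, c2 < x < c1 -> is_derive x (1 : R) X (dX x).
Hypothesis X2 : forall x, c2 < x < c1 -> is_derive x (1 : R) dX (ddX x).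
Hypothesis Xcont : {within `[c2, c1], continuous X}.

Let t01 : 0 < tau < 1 := do_tau db.
Let C0 : 0 <= C := do_C db.

Definition mean : R := \int[leb]_(x in `[a0, b]) (Gcut x * rho x).

Lemma mul_field_pcont h : pcont F h -> vanishing c2 c1 F h ->
  pcont F (fun x => h x * X x).
Proof.
move=> [ch [M hM]] h0; split; last first.
  by exists M => x; rewrite normrM -[M]mulr1 ler_pM.
move=> x xF; have [xK|xK] := boolP (c2 <= x <= c1).
  apply: cvgM; first exact: (ch x xF).
  apply: differentiable_continuous; apply/derivable1_diffP.
  by have [] := X1 (mk_inK mk xF xK).
apply: (@continuous_near_eq _ _ (fun=> 0)); first exact: cvg_cst.
apply: filterS (near_same_comp xF) => y xy.
rewrite h0 ?mul0r//; first exact: (same_comp_notin (same_compC xy)).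
by rewrite -(same_comp_itv (mk_c2F mk) (mk_c1F mk) xy).
Qed.

Lemma mul_field_vanishing h : vanishing c2 c1 F h ->
  vanishing c2 c1 F (fun x => h x * X x).
Proof. by move=> h0 x xF xK; rewrite h0// mul0r. Qed.

(** At a point of [F] the field tends to zero within [[c2, c1]] while [h] is bounded; outside
    [[c2, c1]] the product is zero. *)
Lemma mul_field_continuous h : pcont F h -> vanishing c2 c1 F h ->
  (forall p, p \in F -> X p = 0) -> continuous (fun x => h x * X x).
Proof.
move=> ph h0 XF x; have [xF|xF] := boolP (x \in F); last first.
  by have [+ _] := mul_field_pcont ph h0; exact.
have [_ [M hM]] := ph.
have xK : `[c2, c1]%classic x by rewrite /= in_itv/=; exact: (mk_Fsub mk).
have cX : X y @[y --> within `[c2, c1] (nbhs x)] --> (0 : R).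
  by rewrite -(XF x xF); exact: ((subspace_continuousP _ _).1 Xcont x xK).
apply/cvgrPdist_le => e e0; rewrite XF// mulr0.
have M1 : 0 < `|M| + 1 by rewrite ltr_wpDl.
have H0 := (cvgrPdist_le _ _).1 cX (e / (`|M| + 1)) (divr_gt0 e0 M1).
near=> y; have Hy : `[c2, c1]%classic y -> `|0 - X y| <= e / (`|M| + 1) by near: y; exact: H0.
rewrite sub0r normrN.
have [yF|yF] := boolP (y \in F); first by rewrite XF// mulr0 normr0 ltW.
have [yK|yK] := boolP (c2 <= y <= c1); last by rewrite h0// mul0r normr0 ltW.
have := Hy; rewrite /= in_itv/= => /(_ yK); rewrite sub0r normrN ler_pdivlMr// => H.
rewrite normrM mulrC; apply: le_trans H; apply: ler_wpM2l => //.
by apply: le_trans (hM y) (le_trans (ler_norm _) _); rewrite lerDl.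
Unshelve. all: by end_near. Qed.

Lemma iter_transfer_rho n (r : R) x : x \notin F ->
  iter n L (fun y => r * rho y) x = r * rho x.
Proof.
move=> xF; rewrite iter_transferZ; congr (_ * _).
elim: n x xF => [//|n IH] x xF /=; rewrite -[RHS](Lrho xF).
exact: (transfer_off mk IH xF).
Qed.

(** [g] is the difference of [E * unit_itv + g] and [E * unit_itv], both in the cone; each is
    compared with its mass times [rho], which lies in the cone and is fixed. The two masses are at
    most [2 * E * (c1 - c2)] and [E * (c1 - c2)], whence the factor 3. *)
Lemma mixing_estimate (E : R) g n x : 0 <= E -> pcont F g -> vanishing c2 c1 F g ->
  (forall y, y \notin F -> `|g y| <= E) ->
  loglip c2 c1 F A (fun y => E * unit_itv c2 c1 y + g y) -> x \notin F ->
  `|iter n L g x - mass g * rho x| <= 3 * E * (c1 - c2) * C * tau ^+ n.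
Proof.
move=> E0 pg g0 gE Eg xF.
have pu := unit_itv_pcont mk; have A0 := ltW (do_A db).
pose h1 y := E * unit_itv c2 c1 y + g y.
pose h2 y := E * unit_itv c2 c1 y.
have ph2 : pcont F h2 := pcontZ E pu.
have ph1 : pcont F h1 := pcontD ph2 pg.
have m2 : mass h2 = E * (c1 - c2) by rewrite /h2 (massZ c2 c1 _ pu) (mass_unit_itv mk).
have m1 : mass h1 = mass h2 + mass g := massD c2 c1 ph2 pg.
have Ch2 : loglip c2 c1 F A h2 := loglipZ E0 (unit_itv_loglip mk A0).
have mg : `|mass g| <= E * (c1 - c2) by apply: (mass_norm_le mk pg) => y yF _; exact: gE.
have c210 : 0 <= c1 - c2 by rewrite subr_ge0 ltW.
have m20 : 0 <= mass h2 by rewrite m2 mulr_ge0.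
have m10 : 0 <= mass h1 by move: mg; rewrite m1 m2 ler_norml => /andP[]; lra.
have H h : loglip c2 c1 F A h -> pcont F h -> 0 <= mass h ->
    `|iter n L h x - mass h * rho x| <= C * tau ^+ n * mass h.
  move=> hh ph m0.
  have := do_mix db n hh ph (loglipZ m0 rhoCl) (pcontZ (mass h) prho).
  rewrite (massZ c2 c1 _ prho) rho1 mulr1 => /(_ x erefl xF).
  by rewrite iter_transfer_rho.
have H1 := H h1 Eg ph1 m10; have H2 := H h2 Ch2 ph2 m20.
have gE' : iter n L g x - mass g * rho x =
    (iter n L h1 x - mass h1 * rho x) - (iter n L h2 x - mass h2 * rho x).
  by rewrite m1 /h1 iter_transferD; ring.
rewrite gE'; apply: le_trans (ler_normB _ _) _.
apply: le_trans (lerD H1 H2) _; rewrite -mulrDr m1 m2.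
have t0 : 0 <= C * tau ^+ n by rewrite mulr_ge0// exprn_ge0//; case/andP: t01 => /ltW.
rewrite (_ : 3 * E * (c1 - c2) * C * tau ^+ n = C * tau ^+ n * (3 * (E * (c1 - c2)))); last by ring.
apply: ler_wpM2l => //; move: mg; rewrite ler_norml => /andP[]; lra.
Qed.

(** [K] is uniform in [m], while the jumps [s] and the mass [mu] of the derivative depend on [m] and
    come without a bound. *)
Lemma approximate_term : exists2 K : R, 0 <= K & forall m, exists s mu,
  [/\ (forall t, t \in s -> t.2 \in F),
    (forall n, `|pairing (iter n T (fun x => iter m L start x * X x)) -
       (\sum_(t <- s) t.1 * G (iter n f t.2) - mu * mean)| <= K * tau ^+ n) &
    ((forall p, p \in F -> X p = 0) -> s = [::] /\ mu = 0)].
Proof.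
have [E E0 HE] := observable_derivative mk db XB X1 X2.
pose K := 3 * E * (c1 - c2) * C * BG * (b - a0).
have K0 : 0 <= K.
  by rewrite /K !mulr_ge0// subr_ge0// ltW.
exists K => // m; have [g [pg g0 dg gE Eg]] := HE m.
have [hm ph hm1 _] := start_density mk db m.
have h0 : vanishing c2 c1 F (iter m L start) := loglip_vanishing hm.
pose u x := iter m L start x * X x.
have u0 : vanishing c2 c1 F u := mul_field_vanishing h0.
have pu : pcont F u := mul_field_pcont ph h0.
have [s [sF us sX]] : exists s, [/\ (forall t, t \in s -> t.2 \in F),
    (forall x, x \notin F -> u x = steps s x - tail c1 g x) &
    ((forall p, p \in F -> X p = 0) -> s = [::])].
  (* If the field vanishes on [F], the product has no jumps and the empty list is chosen;
     [steps_mass] then makes the mass of the derivative zero. *)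
  have [XF|XF] := pselect (forall p, p \in F -> X p = 0).
    exists [::]; split => // x xF; rewrite /steps big_nil sub0r.
    exact: (primitive_continuous mk pg g0 u0 (mul_field_continuous ph h0 XF) dg).
  have [s sF us] := primitive_decomposition mk pg g0 u0 dg.
  by exists s; split.
have smass := steps_mass mk pg g0 u0 sF us.
exists s, (mass g); split => //; last first.
  by move=> XF; rewrite -smass sX// big_nil.
move=> n.
have pLg := iter_transfer_pcont mk n pg.
have Lg0 := iter_vanishing mk n g0.
pose s' := [seq (t.1, iter n f t.2) | t <- s].
have := @pairing_formula s' (iter n T u) (iter n L g) (iter_L0_pcont mk n pu) pLg Lg0.
have s'F t : t \in s' -> t.2 \in F.
  by move=> /mapP[r rs ->] /=; apply: (iter_f_in mk); exact: sF.
have uE x : x \notin F -> iter n T u x = steps s' x - tail c1 (iter n L g) x.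
  move=> xF; rewrite (iter_L0_decomposition mk n pg g0 sF us xF).
  by rewrite /steps big_map.
have m' : mass (iter n L g) = \sum_(t <- s') t.1.
  by rewrite (mass_iter_transfer mk n pg g0) -smass big_map.
move=> /(_ s'F uE m'); rewrite big_map => ->.
rewrite (_ : _ - _ - (_ - _) = mass g * mean - \int[leb]_(x in `[a0, b]) (Gcut x * iter n L g x)); last by ring.
have pG := Gcut_pcont; have prho2 := pcont_sub FF2 prho; have pLg2 := pcont_sub FF2 pLg.
rewrite /mean -RintegralZl//; last exact: (pcont_integrable _ _ (pcontM pG prho2)).
rewrite -RintegralB//; last 2 first.
- exact: (pcont_integrable _ _ (pcontZ _ (pcontM pG prho2))).
- exact: (pcont_integrable _ _ (pcontM pG pLg2)).
rewrite (_ : K * tau ^+ n = 3 * E * (c1 - c2) * C * tau ^+ n * BG * (b - a0)); last by rewrite /K; ring.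
apply: (@Rintegral_pcont_norm_le R F2) => //.
  by apply: pcontB; [apply: pcontZ|]; exact: pcontM.
move=> x /andP[/ltW ax /ltW xb] xF2; have xI : a0 <= x <= b by rewrite ax xb.
have xF : x \notin F by apply: contra xF2; exact: FF2.
rewrite (_ : _ - _ = Gcut x * (mass g * rho x - iter n L g x)); last by ring.
rewrite normrM mulrC; apply: ler_pM => //.
  by rewrite distrC; exact: (mixing_estimate n E0 pg g0 gE Eg xF).
by rewrite /Gcut xI; exact: GB.
Qed.

(** The error [C * tau ^+ m] on the density, multiplied by a field of modulus at most one, may
    double at each of the [n] applications of [L0]. *)
Lemma approximation_error n m :
  `|pairing (iter n T (fun x => rho x * X x)) -
    pairing (iter n T (fun x => iter m L start x * X x))|
  <= 2 ^+ n * (C * tau ^+ m) * BG * (b - a0).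
Proof.
have [hm ph hm1 _] := start_density mk db m.
have h0 : vanishing c2 c1 F (iter m L start) := loglip_vanishing hm.
have r0 : vanishing c2 c1 F rho := loglip_vanishing rhoCl.
have p1 := iter_L0_pcont mk n (mul_field_pcont prho r0).
have p2 := iter_L0_pcont mk n (mul_field_pcont ph h0).
rewrite -(pairingB p1 p2); apply: pairing_bound; first exact: pcontB.
move=> x xF; rewrite -iter_L0B; apply: (iter_L0_bound mk) => //.
  by rewrite mulr_ge0// exprn_ge0//; case/andP: t01 => /ltW.
move=> y yF; rewrite -mulrBl normrM -[leRHS]mulr1; apply: ler_pM => //.
by rewrite distrC; exact: rho_lim.
Qed.

Definition susc n : R := pairing (iter n T (fun x => rho x * X x)).

(** The terms of index [n] and [n + n1] are compared through the same approximating density: by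
    periodicity their jump sums agree, and so do their mean terms. Both cancel whatever their
    size. *)
Lemma susc_asymptotics (n0 n1 : nat) :
  (forall p n, p \in F -> (n0 <= n)%N -> iter (n + n1) f p = iter n f p) ->
  exists2 K : R, 0 <= K &
  (forall n, (n0 <= n)%N -> `|susc (n + n1) - susc n| <= K * tau ^+ n) /\
  (((forall p n, p \in F -> (n0 <= n)%N -> G (iter n f p) = 0) /\ mean = 0) \/
   (forall p, p \in F -> X p = 0) ->
   forall n, (n0 <= n)%N -> `|susc n| <= K * tau ^+ n).
Proof.
move=> fper; have /andP[t0 t1] := t01.
have [K K0 HK] := approximate_term.
pose K' := C * BG * (b - a0).
have K'0 : 0 <= K' by rewrite /K' !mulr_ge0// subr_ge0.
(* With [tau ^+ k <= tau / 2], the choice [m = k * r] with [n <= r] gives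
   [2 ^+ n * tau ^+ m <= tau ^+ r]. *)
have [k Hk] := @expr_small R tau (tau / 2) ltac:(by rewrite ltW//= t1) ltac:(by rewrite divr_gt0).
have {}Hk := Hk k (leqnn k).
have err n r : (n <= r)%N -> 2 ^+ n * (C * tau ^+ (k * r)) * BG * (b - a0) <= K' * tau ^+ r.
  move=> nr; rewrite (_ : _ * _ * _ * _ = K' * (2 ^+ n * tau ^+ (k * r))); last by rewrite /K'; ring.
  apply: ler_wpM2l => //; apply: (@le_trans _ _ (2 ^+ r * tau ^+ (k * r))).
    by rewrite ler_wpM2r ?exprn_ge0 ?(ltW t0)// ler_eXn2l// ltr1n.
  rewrite exprM -exprMn; apply: lerXn2r; rewrite ?nnegrE ?mulr_ge0 ?exprn_ge0 ?(ltW t0)//.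
  by move: Hk; lra.
clearbody K'.
have tmono n r : (n <= r)%N -> tau ^+ r <= tau ^+ n.
  by move=> nr; apply: ler_wiXn2l; rewrite ?(ltW t0) ?(ltW t1).
exists (2 * K + 2 * K'); first by rewrite addr_ge0// mulr_ge0.
split=> [n n0n|cases n n0n].
- have [s [mu [sF Hs _]]] := HK (k * (n + n1))%N.
  have e1 := le_trans (approximation_error n (k * (n + n1))) (err n (n + n1)%N (leq_addr _ _)).
  have e2 := le_trans (approximation_error (n + n1) (k * (n + n1))) (err _ _ (leqnn _)).
  have h1 := Hs n; have h2 := Hs (n + n1)%N.
  have Es : \sum_(t <- s) t.1 * G (iter (n + n1) f t.2) = \sum_(t <- s) t.1 * G (iter n f t.2).
    by apply: eq_big_seq => t /sF tF; rewrite fper.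
  rewrite Es in h2.
  have m1 := ler_wpM2l K0 (tmono n (n + n1)%N (leq_addr _ _)).
  have m2 := ler_wpM2l K'0 (tmono n (n + n1)%N (leq_addr _ _)).
  rewrite mulrDl -!mulrA.
  move: e1 e2 h1 h2 m1 m2; rewrite -/(susc n) -/(susc (n + n1)).
  move: (_ - mu * mean) (susc n) (susc (n + n1)) (K * _) (K' * _) (K * _) (K' * _).
  move=> S u v a1 a2 a3 a4; rewrite !ler_norml => /andP[? ?] /andP[? ?] /andP[? ?] /andP[? ?] ? ?.
  by apply/andP; split; lra.
- have [s [mu [sF Hs sX]]] := HK (k * n)%N.
  have e1 := le_trans (approximation_error n (k * n)) (err n n (leqnn _)).
  have h1 := Hs n.
  have S0 : \sum_(t <- s) t.1 * G (iter n f t.2) - mu * mean = 0.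
    case: cases => [[Gz mz]|/sX[-> ->]]; last by rewrite big_nil mul0r subr0.
    rewrite mz mulr0 subr0 big1_seq// => t /andP[_ /sF tF].
    by rewrite Gz ?mulr0.
  rewrite S0 subr0 in h1.
  have a1 : 0 <= K * tau ^+ n by rewrite mulr_ge0// exprn_ge0// ltW.
  have a2 : 0 <= K' * tau ^+ n by rewrite mulr_ge0// exprn_ge0// ltW.
  rewrite mulrDl -!mulrA; move: e1 h1 a1 a2; rewrite -/(susc n).
  move: (susc n) (K * _) (K' * _) (pairing _) => u a1 a2 v.
  rewrite !ler_norml => /andP[? ?] /andP[? ?] ? ?.
  by apply/andP; split; lra.
Qed.

End TermAsymptotics.

(** * Power series over the complex numbers *)

Section ComplexLimits.
Variable R : realType.
Local Notation C := (Cplx R).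
Implicit Types (z w : C) (e d : nat -> C).

(** The norm of [Cplx R] takes values in the complex numbers. This is the same modulus as a real
    number, to which real estimates and real arithmetic apply. *)
Definition modC (z : C) : R := complex.Re `|z|.

Lemma modCE z : toC (modC z) = `|z|.
Proof. by rewrite /modC normc_def. Qed.

Lemma toC_le (x y : R) : (toC x <= toC y) = (x <= y).
Proof. exact: lecR. Qed.

Lemma toC_lt (x y : R) : (toC x < toC y) = (x < y).
Proof. exact: ltcR. Qed.

Lemma toCD (x y : R) : toC (x + y) = toC x + toC y.
Proof. exact: (rmorphD (real_complex R)). Qed.

Lemma toCB (x y : R) : toC (x - y) = toC x - toC y.
Proof. exact: (rmorphB (real_complex R)). Qed.

Lemma toCM (x y : R) : toC (x * y) = toC x * toC y.
Proof. exact: (rmorphM (real_complex R)). Qed.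

Lemma toC_inj : injective (@toC R).
Proof. exact: complexI. Qed.

Lemma toC0 : toC (0 : R) = 0. Proof. by []. Qed.

Lemma toC1 : toC (1 : R) = 1. Proof. by []. Qed.

Lemma modC_ge0 z : 0 <= modC z.
Proof. by rewrite -toC_le modCE toC0 normr_ge0. Qed.

Lemma modC0 : modC 0 = 0.
Proof. by apply: toC_inj; rewrite modCE normr0 toC0. Qed.

Lemma modC1 : modC 1 = 1.
Proof. by apply: toC_inj; rewrite modCE normr1 toC1. Qed.

Lemma modCD z w : modC (z + w) <= modC z + modC w.
Proof. by rewrite -toC_le toCD !modCE ler_normD. Qed.

Lemma modCN z : modC (- z) = modC z.
Proof. by rewrite /modC normrN. Qed.

Lemma modCBC z w : modC (z - w) = modC (w - z).
Proof. by rewrite /modC distrC. Qed.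

Lemma modCB z w : modC (z - w) <= modC z + modC w.
Proof. by rewrite -(modCN w) modCD. Qed.

Lemma modCM z w : modC (z * w) = modC z * modC w.
Proof. by apply: toC_inj; rewrite toCM !modCE normrM. Qed.

Lemma modCX z n : modC (z ^+ n) = modC z ^+ n.
Proof.
elim: n => [|n IH]; first by rewrite !expr0 modC1.
by rewrite !exprS modCM IH.
Qed.

Lemma modC_toC (x : R) : modC (toC x) = `|x|.
Proof.
by rewrite /modC normc_def /= expr0n/= addr0 sqrtr_sqr.
Qed.

Lemma modC_eq0 z : modC z <= 0 -> z = 0.
Proof. by move=> H; apply/eqP; rewrite -normr_le0 -modCE -toC0 toC_le. Qed.

Lemma modC_Re z : `|complex.Re z| <= modC z.
Proof. by rewrite -toC_le modCE; exact: normc_ge_Re. Qed.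

Lemma modC_Im z : `|complex.Im z| <= modC z.
Proof.
rewrite /modC normc_def/= -sqrtr_sqr; apply: ler_wsqrtr.
by rewrite lerDr sqr_ge0.
Qed.

Lemma modC_le_ReIm z : modC z <= `|complex.Re z| + `|complex.Im z|.
Proof.
rewrite [z in modC z]complexE; apply: le_trans (modCD _ _) _.
rewrite modCM -/(toC _) -/(toC _) !modC_toC lerD2l -[leRHS]mul1r ler_wpM2r//.
by rewrite /modC normc_def/= expr0n/= expr1n add0r sqrtr1.
Qed.

(** The radii of the complex topology are positive complex numbers, and positivity forces them to be
    real. *)
Lemma positive_toC (eps : C) : 0 < eps -> exists2 r : R, 0 < r & eps = toC r.
Proof.
move=> e0; exists (complex.Re eps).
  by move: e0; rewrite ltcE => /andP[_].
by rewrite /toC RRe_real// gtr0_real.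
Qed.

Lemma geometric_cvgC (a : nat -> C) l (K q : R) : 0 <= K -> 0 <= q < 1 ->
  (forall n, modC (a n - l) <= K * q ^+ n) -> a @ \oo --> l.
Proof.
move=> K0 q01 H; apply/cvgrPdist_le => eps /positive_toC[r r0 ->].
have [N HN] := geometric_small K0 q01 r0.
exists N => // n Nn; rewrite -modCE toC_le modCBC.
exact: le_trans (H n) (HN n Nn).
Qed.

Lemma geometric_uniqueC (a : nat -> C) l l' (K K' q : R) :
  0 <= K -> 0 <= K' -> 0 <= q < 1 ->
  (forall n, modC (a n - l) <= K * q ^+ n) ->
  (forall n, modC (a n - l') <= K' * q ^+ n) -> l = l'.
Proof.
move=> K0 K'0 q01 H H'; apply/eqP; rewrite -subr_eq0; apply/eqP; apply: modC_eq0.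
apply/ler_addgt0Pr => eps eps0; rewrite add0r.
have [N HN] := geometric_small (addr_ge0 K0 K'0) q01 eps0.
apply: le_trans (HN N (leqnn N)); rewrite mulrDl.
have -> : l - l' = (a N - l') - (a N - l) by ring.
by apply: le_trans (modCB _ _) _; rewrite addrC lerD.
Qed.

Lemma geometric_cauchyC (a : nat -> C) (K q : R) : 0 <= K -> 0 <= q < 1 ->
  (forall n k, modC (a n - a (n + k)%N) <= K * q ^+ n) ->
  exists l, forall n, modC (a n - l) <= 2 * K * q ^+ n.
Proof.
move=> K0 q01 H.
have [x Hx] := @geometric_cauchy R (fun n => complex.Re (a n)) K q K0 q01
  ltac:(by move=> n k; rewrite -(raddfB (@complex.Re R)); exact: le_trans (modC_Re _) (H n k)).
have [y Hy] := @geometric_cauchy R (fun n => complex.Im (a n)) K q K0 q01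
  ltac:(by move=> n k; rewrite -(raddfB (@complex.Im R)); exact: le_trans (modC_Im _) (H n k)).
exists (x +i* y)%C => n; apply: le_trans (modC_le_ReIm _) _.
rewrite !raddfB/= -mulrA mulr2n mulrDl !mul1r.
exact: lerD.
Qed.

Definition pser e z n : C := \sum_(k < n) e k * z ^+ k.

Lemma pser_rate e z (K t : R) : 0 <= K -> (forall n, modC (e n) <= K * t ^+ n) ->
  0 <= t -> t * modC z < 1 -> forall n k,
  modC (pser e z n - pser e z (n + k)) <= K / (1 - t * modC z) * (t * modC z) ^+ n.
Proof.
move=> K0 eK t0; set q := t * modC z => q1.
have q0 : 0 <= q by rewrite mulr_ge0 ?modC_ge0.
have q10 : 0 < 1 - q by rewrite subr_gt0.
move=> n k; elim: k n => [|k IH] n.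
  by rewrite addn0 subrr modC0 mulr_ge0 ?exprn_ge0// divr_ge0// ltW.
have -> : pser e z n - pser e z (n + k.+1) =
    (pser e z n.+1 - pser e z (n.+1 + k)) - e n * z ^+ n.
  by rewrite addnS addSn {3}/pser big_ord_recr/= -/(pser e z n); ring.
apply: le_trans (modCB _ _) _; apply: le_trans (lerD (IH _) (lexx _)) _.
rewrite modCM modCX.
have H : modC (e n) * modC z ^+ n <= K * q ^+ n.
  by rewrite exprMn mulrA ler_wpM2r ?exprn_ge0 ?modC_ge0.
apply: le_trans (lerD (lexx _) H) _.
rewrite le_eqVlt; apply/orP; left; apply/eqP.
by rewrite exprS; field; rewrite gt_eqF.
Qed.

(* [E] is the sum of the power series with coefficients [e] on the disc [t * |z| < 1]. *)
Lemma pser_sum_exists e (K t : R) : 0 <= K -> 0 <= t ->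
  (forall n, modC (e n) <= K * t ^+ n) ->
  exists E : C -> C, forall z, t * modC z < 1 -> forall n,
    modC (pser e z n - E z) <= 2 * K / (1 - t * modC z) * (t * modC z) ^+ n.
Proof.
move=> K0 t0 eK.
suff /choice[E HE] : forall z, exists l : C, t * modC z < 1 -> forall n,
    modC (pser e z n - l) <= 2 * K / (1 - t * modC z) * (t * modC z) ^+ n.
  by exists E.
move=> z; have [q1|q1] := ltP (t * modC z) 1; last by exists 0.
have q0 : 0 <= t * modC z by rewrite mulr_ge0 ?modC_ge0.
have q10 : 0 < 1 - t * modC z by rewrite subr_gt0.
have [l Hl] := @geometric_cauchyC (pser e z) (K / (1 - t * modC z)) (t * modC z)
  (divr_ge0 K0 (ltW q10)) ltac:(by rewrite q0 q1) (pser_rate K0 eK t0 q1).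
by exists l => _ n; rewrite -(mulrA 2); exact: Hl.
Qed.

(** Synthetic division: the quotient of [E z - E w] by [z - w] is a power series in [z] whose
    coefficients are the shifted sums [S n.+1] at [w]. They obey a bound with the same rate [t], so
    the operation can be repeated. *)
Lemma divided_difference e (K t : R) (E : C -> C) w : 0 <= K -> 0 <= t ->
  (forall n, modC (e n) <= K * t ^+ n) ->
  (forall z, t * modC z < 1 -> forall n,
    modC (pser e z n - E z) <= 2 * K / (1 - t * modC z) * (t * modC z) ^+ n) ->
  t * modC w < 1 ->
  exists d K', [/\ 0 <= K', (forall n, modC (d n) <= K' * t ^+ n) &
    forall E', (forall z, t * modC z < 1 -> forall n,
      modC (pser d z n - E' z) <= 2 * K' / (1 - t * modC z) * (t * modC z) ^+ n) ->
    forall z, t * modC z < 1 -> E z - E w = (z - w) * E' z].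
Proof.
move=> K0 t0 eK HE w1.
have qw0 : 0 <= t * modC w by rewrite mulr_ge0 ?modC_ge0.
have qw1 : 0 < 1 - t * modC w by rewrite subr_gt0.
have shiftK m n : modC (e (m + n)%N) <= (K * t ^+ m) * t ^+ n.
  by rewrite -mulrA -exprD.
(* [S m] is the sum over [k] of [e (m + k) * w ^+ k]; in particular [S 0 = E w]. *)
have [S HS] : exists S : nat -> C, forall m n,
    modC (pser (fun k => e (m + k)%N) w n - S m) <=
    2 * (K * t ^+ m) / (1 - t * modC w) * (t * modC w) ^+ n.
  suff /choice[S HS] : forall m, exists l, forall n,
    modC (pser (fun k => e (m + k)%N) w n - l) <=
    2 * (K * t ^+ m) / (1 - t * modC w) * (t * modC w) ^+ n by exists S.
  move=> m; have Km0 : 0 <= K * t ^+ m by rewrite mulr_ge0 ?exprn_ge0.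
  have [E' HE'] := pser_sum_exists Km0 t0 (shiftK m).
  by exists (E' w); exact: HE'.
have KS0 m : 0 <= 2 * (K * t ^+ m) / (1 - t * modC w).
  by rewrite divr_ge0 ?(ltW qw1)// !mulr_ge0// exprn_ge0.
have qw : 0 <= t * modC w < 1 by rewrite qw0.
have S0 : S 0 = E w.
  apply: (geometric_uniqueC (KS0 0) _ qw (HS 0) (HE w w1)).
  by have := KS0 0; rewrite expr0 mulr1.
have SS m : S m = e m + w * S m.+1.
  apply: (geometric_uniqueC (a := fun n => pser (fun k => e (m + k)%N) w n.+1)
     (K := 2 * (K * t ^+ m) / (1 - t * modC w))
     (K' := modC w * (2 * (K * t ^+ m.+1) / (1 - t * modC w))) _ _ qw).
  - exact: KS0.
  - by rewrite mulr_ge0 ?modC_ge0.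
  - move=> n; apply: le_trans (HS m n.+1) _; apply: ler_wpM2l => //.
    by rewrite exprS ler_piMl ?exprn_ge0// ltW.
  - move=> n; rewrite -mulrA; have -> : pser (fun k => e (m + k)%N) w n.+1 - (e m + w * S m.+1) =
        w * (pser (fun k => e (m.+1 + k)%N) w n - S m.+1).
      rewrite /pser big_ord_recl/= addn0 expr0 mulr1 mulrBr mulr_sumr opprD addrACA subrr add0r.
      congr (_ - _); apply: eq_bigr => i _.
      by rewrite /bump/= add1n addSnnS exprS mulrCA.
    by rewrite modCM; apply: ler_wpM2l; rewrite ?modC_ge0.
pose K' := 2 * K * t / (1 - t * modC w).
have K'0 : 0 <= K' by rewrite divr_ge0 ?(ltW qw1)// !mulr_ge0.
have dK n : modC (S n.+1) <= K' * t ^+ n.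
  have := HS n.+1 0%N; rewrite /pser big_ord0 sub0r modCN expr0 mulr1.
  move=> /le_trans; apply; rewrite le_eqVlt; apply/orP; left; apply/eqP.
  by rewrite /K' exprS; ring.
exists (fun n => S n.+1), K'; split => // E' HE' z z1.
have qz0 : 0 <= t * modC z by rewrite mulr_ge0 ?modC_ge0.
have qz1 : 0 < 1 - t * modC z by rewrite subr_gt0.
have qz : 0 <= t * modC z < 1 by rewrite qz0.
(* The recursion [SS] makes the product telescope, up to the boundary term [S n * z ^+ n], which
   tends to zero. *)
have tele n : (z - w) * pser (fun k => S k.+1) z n = S n * z ^+ n + pser e z n - S 0.
  elim: n => [|n IH]; first by rewrite /pser !big_ord0 mulr0 expr0 mulr1 addr0 subrr.
  rewrite /pser !big_ord_recr/= -/(pser _ z n) -/(pser e z n) mulrDr IH (SS n) exprS.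
  by ring.
have Sn n : modC (S n) <= 2 * K / (1 - t * modC w) * t ^+ n.
  have := HS n 0%N; rewrite /pser big_ord0 sub0r modCN expr0 mulr1.
  move=> /le_trans; apply; rewrite le_eqVlt; apply/orP; left; apply/eqP.
  by ring.
pose Kw := 2 * K / (1 - t * modC w).
pose Kz := 2 * K / (1 - t * modC z).
have Kw0 : 0 <= Kw by rewrite divr_ge0 ?(ltW qw1)// mulr_ge0.
have Kz0 : 0 <= Kz by rewrite divr_ge0 ?(ltW qz1)// mulr_ge0.
apply: (geometric_uniqueC (a := fun n => pser e z n - E w) (K := Kz)
   (K' := Kw + modC (z - w) * (2 * K' / (1 - t * modC z))) _ _ qz) => //.
- by rewrite addr_ge0// mulr_ge0 ?modC_ge0// divr_ge0 ?(ltW qz1)// mulr_ge0.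
- by move=> n; rewrite opprB addrA subrK; exact: HE.
- move=> n; have -> : pser e z n - E w - (z - w) * E' z =
      (z - w) * (pser (fun k => S k.+1) z n - E' z) - S n * z ^+ n.
    by rewrite mulrBr tele S0; ring.
  apply: le_trans (modCB _ _) _; rewrite [leRHS]mulrDl [leLHS]addrC; apply: lerD.
    rewrite modCM modCX exprMn mulrA; apply: ler_wpM2r; first by rewrite exprn_ge0 ?modC_ge0.
    exact: Sn.
  by rewrite modCM -mulrA; apply: ler_wpM2l; [exact: modC_ge0|exact: HE'].
Qed.

End ComplexLimits.

(** * Splitting off the periodic part of a sequence *)

Section PeriodicPart.
Variable R : realType.

(** [l n] is the limit of [t] along [n + k * n1], whose increments are geometric once [n0 <= n]. For
    [n < n0] the limit exists after a shift of [k], and the finitely many errors there are absorbed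
    in the constant through the sum [S]. *)
Lemma periodic_part (t : nat -> R) (n0 n1 : nat) (K tau : R) :
  (0 < n1)%N -> 0 <= K -> 0 < tau < 1 ->
  (forall n, (n0 <= n)%N -> `|t (n + n1)%N - t n| <= K * tau ^+ n) ->
  exists (l : nat -> R) (K' : R), [/\ 0 <= K', forall n, l (n + n1)%N = l n,
    forall n, `|t n - l n| <= K' * tau ^+ n &
    (forall n, (n0 <= n)%N -> `|t n| <= K * tau ^+ n) -> forall n, l n = 0].
Proof.
move=> n10 K0 /andP[t0 t1] Ht.
pose q := tau ^+ n1.
have q01 : 0 <= q < 1.
  by rewrite exprn_ge0 ?(ltW t0)// exprn_ilt1 ?(ltW t0)// -lt0n.
have /andP[q0 q1] := q01.
have q10 : 0 < 1 - q by rewrite subr_gt0.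
pose a n k := t (n + k * n1)%N.
have tq n k : tau ^+ (n + k * n1) = tau ^+ n * q ^+ k by rewrite exprD mulnC exprM.
have step n k : (n0 <= n)%N -> `|a n k - a n k.+1| <= K * tau ^+ n * q ^+ k.
  move=> nn; rewrite distrC /a mulSn addnCA addnC -mulrA -tq; apply: Ht.
  by rewrite (leq_trans nn)// leq_addr.
have cauchy n k j : (n0 <= n)%N ->
    `|a n k - a n (k + j)%N| <= K * tau ^+ n / (1 - q) * q ^+ k.
  move=> nn; have Kn : 0 <= K * tau ^+ n by rewrite mulr_ge0// exprn_ge0// ltW.
  elim: j k => [|j IH] k.
    rewrite addn0 subrr normr0; apply: mulr_ge0; last exact: exprn_ge0.
    by apply: divr_ge0 => //; exact: ltW.
  have -> : a n k - a n (k + j.+1)%N = (a n k - a n k.+1) + (a n k.+1 - a n (k.+1 + j)%N).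
    by rewrite addnS addSn subrKA.
  apply: le_trans (ler_normD _ _) _; apply: le_trans (lerD (step n k nn) (IH k.+1)) _.
  rewrite le_eqVlt; apply/orP; left; apply/eqP.
  by rewrite exprS; field; rewrite gt_eqF.
have lim_ge n : (n0 <= n)%N -> exists l : R, a n @ \oo --> l /\
    `|t n - l| <= K / (1 - q) * tau ^+ n.
  move=> nn; have Kn : 0 <= K * tau ^+ n / (1 - q).
    by rewrite divr_ge0 ?(ltW q10)// mulr_ge0// exprn_ge0// ltW.
  have [l Hl] := geometric_cauchy Kn q01 (fun k j => cauchy n k j nn).
  exists l; split; first exact: geometric_cvg Kn q01 Hl.
  have := Hl 0%N; rewrite /a mul0n addn0 expr0 mulr1 => /le_trans; apply.
  by rewrite mulrAC.
have lim_ex n : exists l : R, a n @ \oo --> l.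
  have [|l [Hl _]] := lim_ge (n + n0 * n1)%N.
    by rewrite (leq_trans _ (leq_addl _ _))// leq_pmulr.
  exists l; rewrite -(cvg_shiftn n0).
  have -> : (fun k => a n (k + n0)%N) = a (n + n0 * n1)%N.
    by apply/funext => k; rewrite /a mulnDl addnAC addnA.
  exact: Hl.
have [l Hl] := choice lim_ex.
have lE n x : a n @ \oo --> x -> l n = x.
  by move=> Hx; apply: (@cvg_unique _ (@Rhausdorff R) _ _ _ _ (Hl n)).
pose S := \sum_(n < n0) `|t n - l n| / tau ^+ n.
have S0 : 0 <= S by apply: sumr_ge0 => i _; rewrite divr_ge0// exprn_ge0// ltW.
have Kq0 : 0 <= K / (1 - q) by rewrite divr_ge0// ltW.
exists l, (K / (1 - q) + S); split.
- exact: addr_ge0.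
- move=> n; apply: lE; have := Hl n; rewrite -(cvg_shiftS (a n)).
  have -> : (fun k => a n k.+1) = a (n + n1)%N.
    by apply/funext => k; rewrite /a mulSn addnA.
  exact.
- move=> n; have [nn|nn] := leqP n0 n.
    have [x [Hx Hb]] := lim_ge n nn; rewrite (lE n x Hx).
    apply: le_trans Hb _; apply: ler_wpM2r; first by rewrite exprn_ge0// ltW.
    by rewrite lerDl.
  apply: (@le_trans _ _ (S * tau ^+ n)); last first.
    by apply: ler_wpM2r; [rewrite exprn_ge0// ltW|rewrite lerDr].
  rewrite -ler_pdivrMr ?exprn_gt0// /S (bigD1 (Ordinal nn))//= lerDl.
  by apply: sumr_ge0 => i _; rewrite divr_ge0// exprn_ge0// ltW.
- move=> Hz n; apply: lE; rewrite -(cvg_shiftn n0).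
  apply: (@geometric_cvg _ _ _ K q K0 q01) => k; rewrite subr0 /a.
  apply: le_trans (Hz _ _) _.
    by rewrite (leq_trans _ (leq_addl _ _))// (leq_trans (leq_addl k n0))// leq_pmulr.
  apply: ler_wpM2l => //; rewrite /q -exprM.
  apply: ler_wiXn2l; rewrite ?(ltW t0) ?(ltW t1)//.
  by rewrite (leq_trans _ (leq_addl _ _))// mulnC leq_mul2r leq_addr orbT.
Qed.

End PeriodicPart.

(** * Holomorphy of power series and removable poles *)

Section MeromorphicSeries.
Variable R : realType.
Local Notation C := (Cplx R).
Implicit Types (z w : C) (e d : nat -> C).

Lemma derivable_continuousC (g : C -> C) w : derivable g w 1 -> {for w, continuous g}.
Proof. by move=> /derivable1_diffP/differentiable_continuous. Qed.

Lemma derivableC_add (g h : C -> C) w : derivable g w 1 -> derivable h w 1 ->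
  derivable (fun z => g z + h z) w 1.
Proof. by move=> dg dh; exact: (@derivableD C C C g h w 1 dg dh). Qed.

Lemma derivableC_mul (g h : C -> C) w : derivable g w 1 -> derivable h w 1 ->
  derivable (fun z => g z * h z) w 1.
Proof. by move=> dg dh; exact: (@derivableM C C g h w 1 dg dh). Qed.

Lemma derivableC_cst (a w : C) : derivable (fun=> a) w 1.
Proof. exact: (@derivable_cst C C C a w 1). Qed.

Lemma derivableC_id w : derivable (fun z => z) w 1.
Proof. exact: (@derivable_id C C w 1). Qed.

Lemma derivableC_inv (g : C -> C) w : g w != 0 -> derivable g w 1 ->
  derivable (fun z => (g z)^-1) w 1.
Proof. by move=> g0 dg; exact: (@derivableV C C g w 1 g0 dg). Qed.

Lemma derivableC_horner (p : {poly C}) w : derivable (fun z : C => p.[z]) w 1.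
Proof.
have -> : (fun z : C => p.[z]) = fun z => \sum_(i < size p) p`_i * z ^+ i.
  by apply/funext => z; rewrite horner_coef.
elim: (size p) => [|n IH].
  have -> : (fun z : C => \sum_(i < 0) p`_i * z ^+ i) = fun=> 0.
    by apply/funext => z; rewrite big_ord0.
  exact: derivableC_cst.
have -> : (fun z : C => \sum_(i < n.+1) p`_i * z ^+ i) =
    fun z => \sum_(i < n) p`_i * z ^+ i + p`_n * z ^+ n.
  by apply/funext => z; rewrite big_ord_recr.
apply: (derivableC_add IH); apply: derivableC_mul; first exact: derivableC_cst.
elim: n {IH} => [|n IH].
  have -> : (fun z : C => z ^+ 0) = fun=> 1 by apply/funext => z; rewrite expr0.
  exact: derivableC_cst.
have -> : (fun z : C => z ^+ n.+1) = fun z => z * z ^+ n by apply/funext => z; rewrite exprS.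
exact: (derivableC_mul (@derivableC_id w) IH).
Qed.

(** Two divided differences at [w]: the first one, [E1], is the difference quotient, and its value
    at [w] is the derivative; the second one, [E2], is bounded near [w] and makes [E1] continuous
    there. *)
Lemma power_series_derivable e (K t : R) (E : C -> C) w : 0 <= K -> 0 < t ->
  (forall n, modC (e n) <= K * t ^+ n) ->
  (forall z, t * modC z < 1 -> forall n,
    modC (pser e z n - E z) <= 2 * K / (1 - t * modC z) * (t * modC z) ^+ n) ->
  t * modC w < 1 -> derivable E w 1.
Proof.
move=> K0 t0 eK HE w1; have t0' := ltW t0.
have [d [K1 [K10 dK Hd]]] := divided_difference K0 t0' eK HE w1.
have [E1 HE1] := pser_sum_exists K10 t0' dK.
have [d2 [K2 [K20 dK2 Hd2]]] := divided_difference K10 t0' dK HE1 w1.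
have [E2 HE2] := pser_sum_exists K20 t0' dK2.
have {}Hd := Hd E1 HE1; have {}Hd2 := Hd2 E2 HE2.
(* Half of the room left in the disc: [modC h <= eta / t] ensures [t * modC (h + w) <= 1 - eta]. *)
pose eta := (1 - t * modC w) / 2.
have eta0 : 0 < eta by rewrite /eta divr_gt0// subr_gt0.
pose M := 2 * K2 / eta.
have M0 : 0 <= M by rewrite /M; apply: divr_ge0; [exact: mulr_ge0|exact: ltW].
have disc h : modC h <= eta / t -> t * modC (h + w) <= 1 - eta.
  move=> hd; apply: (@le_trans _ _ (t * (modC h + modC w))).
    by rewrite ler_wpM2l// modCD.
  rewrite mulrDr; move: hd; rewrite ler_pdivlMr// mulrC => hd.
  apply: le_trans (lerD hd (lexx _)) _; rewrite /eta; lra.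
have E2b h : modC h <= eta / t -> modC (E2 (h + w)) <= M.
  move=> /disc hd; have h1 : t * modC (h + w) < 1.
    by apply: le_lt_trans hd _; rewrite ltrBlDr ltrDl.
  have := HE2 _ h1 0%N; rewrite /pser big_ord0 sub0r modCN expr0 mulr1.
  move=> /le_trans; apply; rewrite /M ler_wpM2l ?mulr_ge0// lef_pV2 ?posrE ?subr_gt0//.
  by rewrite lerBrDr addrC -lerBrDr.
apply/cvg_ex; exists (E1 w); apply/cvgrPdist_le => eps /positive_toC[r r0 ->].
(* The first bound keeps [h + w] in the disc, the second one makes [modC h * M] at most [r]. *)
pose de := Num.min (eta / t) (r / (M + 1)).
have M10 : 0 < M + 1 by rewrite ltr_wpDl.
have de0 : 0 < de by rewrite /de lt_min; apply/andP; split; exact: divr_gt0.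
near=> h.
have h0 : h != 0 by near: h; exact: nbhs_dnbhs_neq.
have hde : modC h <= de.
  rewrite -toC_le modCE; near: h; apply: dnbhs0_le.
  by rewrite -toC0 toC_lt.
have h1 : modC h <= eta / t by apply: le_trans hde _; rewrite ge_min lexx.
have h2 : modC h <= r / (M + 1) by apply: le_trans hde _; rewrite ge_min lexx orbT.
have hw1 : t * modC (h + w) < 1.
  by apply: le_lt_trans (disc h h1) _; rewrite ltrBlDr ltrDl.
rewrite -modCE toC_le.
have -> : (E \o shift w) (h *: (1 : C)) = E (h + w) by rewrite /= /GRing.scale/= mulr1.
rewrite (Hd _ hw1) addrK.
have -> : h^-1 *: (h * E1 (h + w)) = E1 (h + w) by rewrite /GRing.scale/= mulKf.
rewrite modCBC (Hd2 _ hw1) addrK modCM.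
apply: (@le_trans _ _ (r / (M + 1) * M)).
  by apply: ler_pM => //; rewrite ?modC_ge0//; exact: E2b.
by rewrite mulrAC ler_pdivrMr// ler_wpM2l ?(ltW r0)// lerDl.
Unshelve. all: by end_near. Qed.

Lemma near_ball (w : C) (r : R) : 0 < r -> \forall z \near w, modC (z - w) < r.
Proof.
move=> r0; apply/nbhs_ballP; exists (toC r); first by rewrite /= -toC0 toC_lt.
by move=> z; rewrite /ball/= -modCE toC_lt modCBC.
Qed.

Lemma near_disc (w : C) (r : R) : modC w < r -> \forall z \near w, modC z < r.
Proof.
move=> wr; have r0 : 0 < r - modC w by rewrite subr_gt0.
apply: filterS (near_ball w r0) => z zw.
have -> : z = (z - w) + w by rewrite subrK.
by apply: le_lt_trans (modCD _ _) _; rewrite -ltrBrDr.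
Qed.

Lemma CdiscE (r : R) z : Cdisc r z = (modC z < r).
Proof. by rewrite /Cdisc/= -modCE toC_lt. Qed.

(** Both sides of the equation have a limit at [w], and the one on the right is zero. This excludes
    poles at points of continuity and poles of too high an order. *)
Lemma not_pole_of_continuous (h g : C -> C) w :
  {for w, continuous h} -> {for w, continuous g} ->
  (\forall z \near w^', h z = g z * (z - w)) -> h w = 0.
Proof.
move=> ch cg hg.
have c1 : h z @[z --> w^'] --> h w by apply: cvg_within_filter; exact: ch.
have cz : {for w, continuous (fun z => g z * (z - w))}.
  have cid : {for w, continuous (fun z : C => z - w)}.
    exact: (derivable_continuousC (derivableC_add (@derivableC_id w) (@derivableC_cst (- w) w))).
  exact: (cvgM cg cid).
have c2 : h z @[z --> w^'] --> g w * (w - w).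
  have : g z * (z - w) @[z --> w^'] --> g w * (w - w) by apply: cvg_within_filter; exact: cz.
  by apply: cvg_trans; apply: near_eq_cvg; apply: filterS hg => z ->.
rewrite -[RHS](mulr0 (g w)) -(subrr w).
exact: (@cvg_unique _ (@norm_hausdorff _ C) _ _ _ _ c1 c2).
Qed.

End MeromorphicSeries.

(** * Meromorphic extension of the series *)

Section RationalPart.
Variable R : realType.
Local Notation C := (Cplx R).
Implicit Types (z w : C).

(** Finite form of the geometric sum. For [|z| < 1] the last term tends to zero, and the series sums
    to a polynomial divided by [1 - z ^+ n1]. *)
Lemma periodic_partial_sums (l : nat -> C) (n1 : nat) z (N : nat) :
  (forall n, l (n + n1)%N = l n) ->
  (1 - z ^+ n1) * (\sum_(n < N) z ^+ n * l n) =
  \sum_(j < n1) z ^+ j * l j - z ^+ N * \sum_(j < n1) z ^+ j * l (N + j)%N.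
Proof.
move=> lper; elim: N => [|N IH].
  by rewrite big_ord0 mulr0 expr0 mul1r subrr.
rewrite big_ord_recr/= mulrDr IH.
have E : \sum_(j < n1) z ^+ j * l (N + j)%N + z ^+ n1 * l N =
    l N + z * \sum_(j < n1) z ^+ j * l (N.+1 + j)%N.
  rewrite -[in z ^+ n1 * l N](lper N).
  have -> : \sum_(j < n1) z ^+ j * l (N + j)%N + z ^+ n1 * l (N + n1)%N =
      \sum_(j < n1.+1) z ^+ j * l (N + j)%N by rewrite big_ord_recr.
  rewrite big_ord_recl/= expr0 mul1r addn0; congr (_ + _).
  rewrite mulr_sumr; apply: eq_bigr => i _.
  by rewrite /bump/= add1n exprS mulrA addSnnS.
move: E; set S := (\sum_(j < n1) z ^+ j * l (N + j)%N); set S' := (\sum_(j < n1) z ^+ j * l (N.+1 + j)%N).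
move=> E; have -> : S = l N + z * S' - z ^+ n1 * l N by rewrite -E addrK.
by rewrite exprS; ring.
Qed.

(** The periodic part contributes a rational function with denominator [1 - z ^+ n1], the remainder
    a power series that converges for [tau * |z| < 1]. The fraction is put in lowest terms because
    [meromorphic_on] wants removable singularities removed, and a division by zero would leave a
    wrong value there. *)
Lemma meromorphic_series (t : nat -> R) (n0 n1 : nat) (K tau : R) :
  (0 < n1)%N -> 0 <= K -> 0 < tau < 1 ->
  (forall n, (n0 <= n)%N -> `|t (n + n1)%N - t n| <= K * tau ^+ n) ->
  exists (r : R) (Psi : C -> C),
  [/\ 1 < r, meromorphic_on (Cdisc r) Psi,
    forall z : C, `|z| < 1 -> (fun k => \sum_(n < k) z ^+ n * toC (t n)) @ \oo --> Psi z,
    forall (z : C) (m : nat), `|z| <= 1 -> is_pole Psi z m -> m = 1%N /\ z ^+ n1 = 1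
  & (forall n, (n0 <= n)%N -> `|t n| <= K * tau ^+ n) ->
    (forall z : C, `|z| = 1 -> is_residue Psi z 0) /\
    (fun k : nat => \sum_(0 <= n < k.+1) toC (t n)) @ \oo --> Psi 1].
Proof.
move=> n10 K0 t01 Ht; have /andP[t0 t1] := t01.
have [l [K' [K'0 lper tl lz]]] := periodic_part n10 K0 t01 Ht.
pose e n := toC (t n - l n).
have eK n : modC (e n) <= K' * tau ^+ n by rewrite modC_toC; exact: tl.
have [E HE] := pser_sum_exists K'0 (ltW t0) eK.
have dE w : tau * modC w < 1 -> derivable E w 1.
  exact: (power_series_derivable K'0 t0 eK HE).
pose num : {poly C} := \poly_(j < n1) toC (l j).
(* Monic, hence the opposite of [1 - z ^+ n1]; this explains the sign in [Psi]. *)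
pose den : {poly C} := 'X^n1 - 1.
have den0 : den != 0 by apply: monic_neq0; exact: monic_Xn_sub_1.
pose P : {poly C} := num %/ gcdp num den.
pose Q : {poly C} := den %/ gcdp num den.
have cPQ : coprimep P Q by apply: coprimep_div_gcd; rewrite den0 orbT.
have numE : num = P * gcdp num den by rewrite divpK// dvdp_gcdl.
have denE : den = Q * gcdp num den by rewrite divpK// dvdp_gcdr.
have denz z : den.[z] = z ^+ n1 - 1 by rewrite /den hornerD hornerN hornerXn hornerC.
have Qroot z : root Q z -> z ^+ n1 = 1.
  move=> /rootP Qz; apply/eqP; rewrite -subr_eq0 -denz denE hornerM Qz mul0r//.
pose Psi z := - (P.[z] / Q.[z]) + E z.
(* The midpoint between one and the radius of convergence guaranteed for [E]. *)
pose r := (1 + tau^-1) / 2.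
have ti1 : 1 < tau^-1 by rewrite invf_gt1.
have r1 : 1 < r by rewrite /r; lra.
have rt : r < tau^-1 by rewrite /r; lra.
have disc w : modC w < r -> tau * modC w < 1.
  move=> wr; rewrite mulrC -ltr_pdivlMr// div1r; exact: lt_trans rt.
have holo w : modC w < r -> Q.[w] != 0 -> holomorphic_at Psi w.
  move=> wr Qw.
  have cQ := derivable_continuousC (@derivableC_horner R Q w).
  have nQ : \forall z \near w, Q.[z] != 0.
    exact: (@cvgr_neq0 _ _ _ (nbhs w) _ (fun z : C => Q.[z]) Q.[w] cQ Qw).
  near=> z.
  have Qz : Q.[z] != 0 by near: z.
  have zr : modC z < r by near: z; exact: near_disc.
  apply: derivableC_add; last exact: dE (disc z zr).
  have -> : (fun z : C => - (P.[z] / Q.[z])) = fun z => (- P).[z] * (Q.[z])^-1.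
    by apply/funext => y; rewrite hornerN mulNr.
  apply: derivableC_mul; first exact: derivableC_horner.
  exact: (derivableC_inv Qz (@derivableC_horner R Q z)).
have pole w : modC w < r -> root Q w -> exists h : C -> C,
    [/\ holomorphic_at h w, h w != 0 & \forall z \near w^', Psi z = h z / (z - w)].
  move=> wr Qw; have /factor_theorem[Q1 QE] := Qw.
  have Q1w : Q1.[w] != 0.
    apply/eqP => Q1w.
    have /factor_theorem[Q2 Q2E] : root Q1 w by apply/rootP.
    (* A double root of [Q] would be a double root of [den], whose derivative does not vanish at a
       root of unity; hence poles are simple. *)
    have : (den^`()).[w] = 0.
      rewrite denE QE Q2E !derivM !hornerE.
      by rewrite subrr !(mul0r, mulr0, addr0).
    rewrite /den derivB derivXn derivC subr0 hornerMn hornerXn.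
    have w0 : w ^+ n1.-1 != 0.
      rewrite expf_neq0//; apply: contra_eq_neq (Qroot w Qw) => ->.
      by rewrite expr0n gtn_eqF// eq_sym oner_eq0.
    by move=> /eqP; rewrite -mulr_natr mulf_eq0 (negbTE w0) pnatr_eq0 -leqn0 leqNgt n10.
  have Pw : P.[w] != 0 by apply: (coprimep_root _ Qw); rewrite coprimep_sym.
  exists (fun z => - (P.[z] / Q1.[z]) + E z * (z - w)); split.
  - have cQ := derivable_continuousC (@derivableC_horner R Q1 w).
    have nQ : \forall z \near w, Q1.[z] != 0.
      exact: (@cvgr_neq0 _ _ _ (nbhs w) _ (fun z : C => Q1.[z]) Q1.[w] cQ Q1w).
    near=> z.
    have Qz : Q1.[z] != 0 by near: z.
    have zr : modC z < r by near: z; exact: near_disc.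
    apply: derivableC_add.
      have -> : (fun z : C => - (P.[z] / Q1.[z])) = fun z => (- P).[z] * (Q1.[z])^-1.
        by apply/funext => y; rewrite hornerN mulNr.
      apply: derivableC_mul; first exact: derivableC_horner.
      exact: (derivableC_inv Qz (@derivableC_horner R Q1 z)).
    apply: derivableC_mul; first exact: dE (disc z zr).
    exact: (derivableC_add (@derivableC_id R z) (@derivableC_cst R (- w) z)).
  - by rewrite subrr mulr0 addr0 oppr_eq0 mulf_neq0// invr_neq0.
  - near=> z.
    have zw : z != w by near: z; exact: nbhs_dnbhs_neq.
    have zw0 : z - w != 0 by rewrite subr_eq0.
    rewrite /Psi QE hornerM hornerXsubC invfM mulrDl mulfK//.
    by rewrite mulNr mulrA.
exists r, Psi; split => //.
- move=> w; rewrite CdiscE => wr.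
  have [Qw|Qw] := boolP (root Q w).
    right; exists 1%N; split => //; have [h [hh hw Hh]] := pole w wr Qw.
    by exists h; split.
  by left; apply: holo.
- move=> z z1.
  have {}z1 : modC z < 1 by rewrite -toC_lt modCE toC1.
  have zr : modC z < r by exact: lt_trans r1.
  have z0 := modC_ge0 z.
  have z01 : 0 <= modC z < 1 by rewrite z0.
  have zn1 : 1 - z ^+ n1 != 0.
    rewrite subr_eq0; apply/eqP => E1.
    have : modC z ^+ n1 < 1 by rewrite exprn_ilt1// -lt0n.
    by rewrite -modCX -E1 modC1 ltxx.
  have Qz : Q.[z] != 0.
    by apply: contra zn1 => Qz0; rewrite (Qroot z Qz0) subrr.
  have PQ : - (P.[z] / Q.[z]) = num.[z] / (1 - z ^+ n1).
    have gz : (gcdp num den).[z] != 0.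
      apply: contra zn1 => /eqP gz.
      by rewrite -opprB oppr_eq0 -denz denE hornerM gz mulr0.
    have -> : num.[z] = P.[z] * (gcdp num den).[z] by rewrite -hornerM -numE.
    have -> : 1 - z ^+ n1 = - (Q.[z] * (gcdp num den).[z]).
      by rewrite -hornerM -denE denz opprB.
    by field; rewrite gz Qz.
  have c1 : (fun k => \sum_(n < k) z ^+ n * toC (l n)) @ \oo --> num.[z] / (1 - z ^+ n1).
    have [M lM] : exists M : R, forall n, `|l n| <= M.
      exists (\sum_(j < n1) `|l j|) => n.
      have -> : l n = l (n %% n1)%N.
        rewrite {1}(divn_eq n n1); elim: (n %/ n1)%N => [|k IH]; first by rewrite mul0n add0n.
        by rewrite mulSn -addnA addnC lper.
      rewrite (bigD1 (Ordinal (ltn_pmod n n10)))//= lerDl.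
      by apply: sumr_ge0.
    have M0 : 0 <= M by apply: le_trans (lM 0%N).
    apply: (@geometric_cvgC _ _ _ (modC (1 - z ^+ n1)^-1 * (n1%:R * M)) (modC z)) => //.
      by rewrite mulr_ge0 ?modC_ge0// mulr_ge0.
    move=> k; have := @periodic_partial_sums (fun n => toC (l n)) n1 z k
      ltac:(by move=> n /=; rewrite lper).
    rewrite horner_poly; under [\sum_(j < n1) z ^+ j * toC (l j)]eq_bigr do rewrite mulrC.
    set S := \sum_(n < k) _; set N := \sum_(i < n1) _ => HS.
    have -> : S - N / (1 - z ^+ n1) =
        - ((1 - z ^+ n1)^-1 * (\sum_(j < n1) z ^+ j * toC (l (k + j)%N)) * z ^+ k).
      set T := \sum_(j < n1) _ in HS *; clearbody S.
      have -> : S = (N - z ^+ k * T) / (1 - z ^+ n1) by rewrite -HS mulrC mulKf.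
      by clearbody N T; move: (z ^+ k) (z ^+ n1) zn1 => u y y0; field.
    rewrite modCN !modCM modCX; apply: ler_wpM2r; first by rewrite exprn_ge0.
    apply: ler_wpM2l; first exact: modC_ge0.
    apply: (@le_trans _ _ (\sum_(j < n1) M)); last first.
      by rewrite sumr_const card_ord mulr_natl.
    elim/big_ind2 : _ => [|x1 x2 y1 y2 h1 h2|i _]; first by rewrite modC0.
      by apply: le_trans (modCD _ _) _; exact: lerD.
    rewrite modCM modCX modC_toC -[M]mul1r; apply: ler_pM => //.
      by rewrite exprn_ge0.
    by rewrite exprn_ile1// ltW.
  have c2 : (fun k => pser e z k) @ \oo --> E z.
    have tz : tau * modC z < 1 by exact: disc.
    apply: (@geometric_cvgC _ _ _ (2 * K' / (1 - tau * modC z)) (tau * modC z)).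
    - by rewrite divr_ge0 ?mulr_ge0// subr_ge0 ltW.
    - by rewrite tz mulr_ge0// ltW.
    - exact: HE.
  rewrite /Psi PQ.
  have -> : (fun k => \sum_(n < k) z ^+ n * toC (t n)) =
     (fun k => \sum_(n < k) z ^+ n * toC (l n) + pser e z k).
    apply/funext => k; rewrite /pser -big_split/=; apply: eq_bigr => n _.
    by rewrite /e toCB; ring.
  exact: (cvgD c1 c2).
- move=> z m z1 [m0 [h [hh hz Hh]]].
  have {}z1 : modC z <= 1 by rewrite -toC_le modCE toC1.
  have zr : modC z < r by exact: le_lt_trans r1.
  have ch : {for z, continuous h} by apply: derivable_continuousC; exact: nbhs_singleton hh.
  have cz k : {for z, continuous (fun y : C => (y - z) ^+ k)}.
    have -> : (fun y : C => (y - z) ^+ k) = fun y => (('X - z%:P) ^+ k).[y].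
      by apply/funext => y; rewrite horner_exp hornerXsubC.
    exact: (derivable_continuousC (@derivableC_horner R _ z)).
  have [Qz|Qz] := boolP (root Q z); last first.
    have hP : holomorphic_at Psi z by apply: holo.
    have cP : {for z, continuous Psi}.
      by apply: derivable_continuousC; exact: nbhs_singleton hP.
    case/eqP: hz; apply: (@not_pole_of_continuous R h (fun y => Psi y * (y - z) ^+ m.-1) z ch).
      exact: (cvgM cP (cz m.-1)).
    near=> y.
    have yz : y != z by near: y; exact: nbhs_dnbhs_neq.
    have -> : Psi y = h y / (y - z) ^+ m by near: y.
    rewrite -mulrA -exprSr prednK// divfK// expf_neq0// subr_eq0//.
  split; last exact: Qroot.
  have [h1 [hh1 h1z Hh1]] := pole z zr Qz.
  have ch1 : {for z, continuous h1} by apply: derivable_continuousC; exact: nbhs_singleton hh1.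
  apply/eqP; rewrite eqn_leq m0 andbT leqNgt; apply/negP => m2.
  (* [Psi] times [y - z] is continuous at [z] after extension by [h1], so an order of at least two
     would force [h z = 0]. *)
  case/eqP: hz; apply: (@not_pole_of_continuous R h (fun y => h1 y * (y - z) ^+ m.-2) z ch).
    exact: (cvgM ch1 (cz m.-2)).
  near=> y.
  have yz : y != z by near: y; exact: nbhs_dnbhs_neq.
  have yz0 : y - z != 0 by rewrite subr_eq0.
  have e1 : Psi y = h y / (y - z) ^+ m by near: y.
  have e2 : Psi y = h1 y / (y - z) by near: y.
  have -> : h y = Psi y * (y - z) ^+ m by rewrite e1 divfK// expf_neq0.
  have mE : m = m.-2.+2 by case: (m) m2 => [|[|]].
  by rewrite e2 {1}mE !exprS; field.
- move=> /lz l0.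
  have num0 : num = 0.
    by apply/polyP => i; rewrite coef_poly coef0 l0 toC0; case: ifP.
  have PsiE : Psi = E.
    by apply/funext => z; rewrite /Psi /P num0 div0p horner0 mul0r oppr0 add0r.
  rewrite PsiE; split.
    move=> z z1; have zr : modC z < r.
      by have -> : modC z = 1 by apply: toC_inj; rewrite modCE z1 toC1.
    (* [is_residue] asks for a quotient by a power at least one; the numerator is given a zero at
       [z], and its value there is the residue. *)
    exists 0%N, (fun y => E y * (y - z)); split.
    - have := near_disc zr; apply: filterS => y yr.
      apply: derivableC_mul; first exact: dE (disc y yr).
      exact: (derivableC_add (@derivableC_id R y) (@derivableC_cst R (- z) y)).
    - near=> y; have yz : y != z by near: y; exact: nbhs_dnbhs_neq.
      by rewrite expr1 mulfK// subr_eq0.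
    - by rewrite /= subrr mulr0 mul0r.
  have tz : tau * modC (1 : C) < 1 by rewrite modC1 mulr1.
  have H := HE 1 tz; rewrite modC1 mulr1 in H.
  have c : pser e 1 @ \oo --> E 1.
    apply: (@geometric_cvgC _ _ _ (2 * K' / (1 - tau)) tau) => //.
      by rewrite divr_ge0 ?mulr_ge0// subr_ge0 ltW.
    by rewrite (ltW t0).
  have -> : (fun k => \sum_(0 <= n < k.+1) toC (t n)) = fun k => pser e 1 k.+1.
    apply/funext => k; rewrite /pser big_mkord; apply: eq_bigr => n _.
    by rewrite expr1n mulr1 /e l0 subr0.
  by have := c; rewrite -(cvg_shiftS (pser e 1)).
Unshelve. all: by end_near. Qed.

End RationalPart.

(** * The Markov structure of a preperiodic unimodal map *)

Section SmoothExtensions.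
Variable R : realType.
Implicit Types (x y : R) (g h psi : R -> R) (A U V : set R).

Lemma eq_open_derivable V psi g x : open V -> (forall y, V y -> psi y = g y) -> V x ->
  derivable g x 1 -> derivable psi x 1 /\ derive1 psi x = derive1 g x.
Proof.
move=> oV pg Vx dg.
have dpsi : is_derive x (1 : R) psi (derive1 g x).
  apply: is_derive_near_eq (derive1_is_derive dg erefl).
  by have := open_nbhs_nbhs (conj oV Vx); apply: filterS.
by split; [have [] := dpsi|exact: is_derive_derive1].
Qed.

(** The derivatives of [psi] agree with those of its extension only where the two coincide on a
    neighbourhood; hence the open set [V]. *)
Lemma C3_extension A psi g V : Ck_extension 3 A psi g -> open V -> V `<=` A ->
  forall x, V x -> [/\ derivable psi x 1, derivable (derive1 psi) x 1,
    derivable (derive1 (derive1 psi)) x 1 &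
    [/\ derive1 psi x = derive1 g x, derive1 (derive1 psi) x = derive1 (derive1 g) x &
        derive1 (derive1 (derive1 psi)) x = derive1 (derive1 (derive1 g)) x]].
Proof.
move=> [gA [U [oU AU Cg]]] oV VA.
have e0 y : V y -> psi y = g y by move=> /VA/gA.
have d j : (j < 3)%N -> forall y, V y -> derivable (derive1n j g) y 1.
  by move=> j3 y /VA/AU Uy; have [_] := Cg j (ltnW j3) y Uy; exact.
have e1 y (Vy : V y) := eq_open_derivable oV e0 Vy (d 0%N isT y Vy).
have e2 y (Vy : V y) :=
  eq_open_derivable oV (fun z Vz => (e1 z Vz).2) Vy (d 1%N isT y Vy).
have e3 y (Vy : V y) :=
  eq_open_derivable oV (fun z Vz => (e2 z Vz).2) Vy (d 2%N isT y Vy).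
move=> x Vx; have [a1 b1] := e1 x Vx; have [a2 b2] := e2 x Vx; have [a3 b3] := e3 x Vx.
split; [exact: a1|exact: a2|exact: a3|].
by split; [exact: b1|exact: b2|exact: b3].
Qed.

Lemma Ck_bounded k A psi g p q : p <= q -> Ck_extension k A psi g -> `[p, q] `<=` A ->
  exists2 M : R, 0 <= M &
    forall j x, (j <= k)%N -> p <= x <= q -> `|derive1n j g x| <= M.
Proof.
move=> pq [gA [U [oU AU Cg]]] pqA.
have bd j : exists M : R, 0 <= M /\
    ((j <= k)%N -> forall x, p <= x <= q -> `|derive1n j g x| <= M).
  have [jk|kj] := leqP j k; last by exists 0.
  have cj : {within `[p, q], continuous (fun x => `|derive1n j g x|)}.
    apply: continuous_in_subspaceT => x; rewrite inE => /pqA/AU Ux.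
    by apply: cvg_norm; have [] := Cg j jk x Ux.
  have [m _ Hm] := EVT_max pq cj.
  by exists `|derive1n j g m|; split=> // _ x xpq; exact: Hm.
have [M HM] := choice bd.
exists (\sum_(j < k.+1) M j); first by apply: sumr_ge0 => j _; have [] := HM j.
move=> j x jk xpq; have [_ /(_ jk x xpq) H] := HM j; apply: le_trans H _.
rewrite (bigD1 (Ordinal (jk : (j < k.+1)%N)))//= lerDl.
by apply: sumr_ge0 => i _; have [] := HM i.
Qed.

Lemma Ck_continuous k A psi g x : Ck_extension k A psi g -> A x -> {for x, continuous g}.
Proof. by move=> [_ [U [_ AU Cg]]] /AU Ux; have [] := Cg 0%N (leq0n k) x Ux. Qed.

End SmoothExtensions.

(** * The core interval, the postcritical set and the covering property *)

Section InducedMarkovMap.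
Variable R : realType.
Implicit Types (x y z p q : R).
Variables (a c b a0 : R) (f psip psim : R -> R) (n0 n1 : nat).
Hypothesis hf : expanding_unimodal a c b f.
Hypothesis hpsi : inverse_branches a c b f psip psim.
Hypothesis ha0 : a0 <= a.
Hypothesis ha0fix : psip a0 = a0.
Hypothesis hn0 : (2 <= n0)%N.
Hypothesis hn1 : minimal_period f (iter n0 f c) n1.

Let c1 := f c.
Let c2 := f (f c).

(** The points from [c_1] up to the one of index [n0 + n1 - 1]; the next image is [c_n0] again. *)
Definition postcritical : seq R := [seq iter k f c | k <- iota 1 (n0 + n1 - 1)].
Local Notation F := postcritical.

Let ac : a < c. Proof. by have /andP[] := eu_order hf. Qed.
Let cb : c < b. Proof. by have /andP[] := eu_order hf. Qed.

Lemma f_maps x : a <= x <= b -> a <= f x <= b.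
Proof.
move=> xI; have := eu_maps hf; move=> /(_ (f x)) H.
have : `[a, b]%classic (f x) by apply: H; exists x => //; rewrite /= in_itv.
by rewrite /= in_itv.
Qed.

Lemma f_increasing x y : x < y -> a <= x -> y <= c -> f x < f y.
Proof.
by move=> xy ax yc; apply: (eu_increasing hf); rewrite ?in_itv/= ?ax ?yc ?(ltW xy)//
  ?(le_trans (ltW xy))// (le_trans ax (ltW xy)).
Qed.

Lemma f_decreasing x y : x < y -> c <= x -> y <= b -> f y < f x.
Proof.
by move=> xy ax yc; apply: (eu_decreasing hf); rewrite ?in_itv/= ?ax ?yc ?(ltW xy)//
  ?(le_trans (ltW xy))// (le_trans ax (ltW xy)).
Qed.

Lemma expanding_piece p q l r : piecewise_expanding_on f `[l, r] -> l <= p -> p < q -> q <= r ->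
  q - p < `|f q - f p|.
Proof.
move=> [g [Cg ge1]] lp pq qr; have [gf [U [oU AU CU]]] := Cg.
have Ux x : l <= x <= r -> U x by move=> xlr; apply: AU; rewrite /= in_itv.
have gx x : l <= x <= r -> g x = f x by move=> xlr; apply: gf; rewrite /= in_itv.
have inn x : p <= x <= q -> l <= x <= r.
  by move=> /andP[px xq]; rewrite (le_trans lp px) (le_trans xq qr).
have [||m mpq E] := @MVT R g (derive1 g) p q pq.
- move=> x; rewrite in_itv/= => /andP[/ltW px /ltW xq].
  have xpq : p <= x <= q by rewrite px xq.
  have [_ /(_ isT) dg] := CU 0%N isT x (Ux x (inn x xpq)).
  exact: derive1_is_derive dg erefl.
- apply: continuous_in_subspaceT => x; rewrite inE/= in_itv/= => xpq.
  by have [] := CU 0%N isT x (Ux x (inn x xpq)).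
have mI : p <= m <= q by move: mpq; rewrite in_itv/= => /andP[/ltW -> /ltW ->].
rewrite -!gx ?inn ?lexx ?(ltW pq)// E normrM [`|q - p|]gtr0_norm ?subr_gt0//.
rewrite ltr_pMl ?subr_gt0//.
have := lt_le_trans ge1 (ereal_inf_lbound _); move=> /(_ `|derive1 g m|%:E); rewrite lte_fin.
by apply; exists m => //=; rewrite in_itv/=; exact: inn.
Qed.

(** Otherwise the increasing branch would map [[a, c]] into itself, while expansion makes the image
    strictly longer. *)
Lemma c_lt_c1 : c < c1.
Proof.
rewrite ltNge; apply/negP => c1c.
have := expanding_piece (eu_expanding_l hf) (lexx a) ac (lexx c).
have fac := f_increasing ac (lexx a) (lexx c); rewrite gtr0_norm ?subr_gt0//.
have /andP[fa _] := @f_maps a ltac:(by rewrite lexx ltW// (lt_trans ac cb)).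
by move: c1c; rewrite /c1; lra.
Qed.

Lemma c1_le_b : c1 <= b.
Proof. by have /andP[] := @f_maps c ltac:(by rewrite !ltW). Qed.

Lemma a_le_c2 : a <= c2.
Proof.
have /andP[] // := @f_maps c1 ltac:(by rewrite c1_le_b (le_trans (ltW ac) (ltW c_lt_c1))).
Qed.

(** Otherwise the decreasing branch would map [[c, c1]] into itself, which expansion excludes. *)
Lemma c2_lt_c : c2 < c.
Proof.
rewrite ltNge; apply/negP => cc2.
have := expanding_piece (eu_expanding_r hf) (lexx c) c_lt_c1 c1_le_b.
have fcc := f_decreasing c_lt_c1 (lexx c) c1_le_b; rewrite ltr0_norm ?subr_lt0//.
by move: cc2 fcc; rewrite /c2 /c1; lra.
Qed.

(** If [a < c2], expansion on [[a, c2]] gives [f c2 - f a > c2 - a], and [f a >= a]. *)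
Lemma c2_le_c3 : c2 <= f c2.
Proof.
have := a_le_c2; rewrite le_eqVlt => /predU1P[E|ac2].
  have /andP[fa _] := @f_maps a ltac:(by rewrite lexx ltW// (lt_trans ac cb)).
  by rewrite -E.
have := expanding_piece (eu_expanding_l hf) (lexx a) ac2 (ltW c2_lt_c).
have fac := f_increasing ac2 (lexx a) (ltW c2_lt_c); rewrite gtr0_norm ?subr_gt0//.
have /andP[fa _] := @f_maps a ltac:(by rewrite lexx ltW// (lt_trans ac cb)).
lra.
Qed.

Lemma f_core y : c2 <= y <= c1 -> c2 <= f y <= c1.
Proof.
move=> /andP[y2 y1]; have [yc|cy] := leP y c.
  apply/andP; split.
    apply: le_trans c2_le_c3 _; move: y2; rewrite le_eqVlt => /predU1P[<-//|y2].
    by rewrite ltW// f_increasing// a_le_c2.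
  move: yc; rewrite le_eqVlt => /predU1P[->//|yc].
  by rewrite ltW// f_increasing// (le_trans a_le_c2).
apply/andP; split.
  move: y1; rewrite le_eqVlt => /predU1P[->//|y1].
  by rewrite ltW// /c2 -/c1 f_decreasing ?(ltW cy) ?c1_le_b.
by rewrite ltW// f_decreasing// (le_trans y1 c1_le_b).
Qed.

Let n10 : (0 < n1)%N. Proof. by case: hn1. Qed.
Let per : iter (n0 + n1) f c = iter n0 f c.
Proof. by rewrite addnC iterD; case: hn1. Qed.

Lemma iter_core k : (0 < k)%N -> c2 <= iter k f c <= c1.
Proof.
case: k => // k _; elim: k => [|k IH]; last exact: (f_core IH).
by rewrite /= -/c1 lexx (ltW (lt_trans c2_lt_c c_lt_c1)).
Qed.

Lemma postcriticalP p : reflect (exists2 k, (0 < k)%N & p = iter k f c) (p \in F).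
Proof.
apply: (iffP mapP) => [[k]|[k k0 ->]].
  by rewrite mem_iota => /andP[k1 _] ->; exists k.
have N1 : (1 + (n0 + n1 - 1) = n0 + n1)%N by rewrite subnKC// addn_gt0 n10 orbT.
have n0n1 : (n0 < n0 + n1)%N by rewrite -[X in (X < _)%N]addn0 ltn_add2l.
suff [j /andP[j0 jN] ->] : exists2 j, (0 < j < n0 + n1)%N & iter k f c = iter j f c.
  by exists j => //; rewrite mem_iota N1 j0.
elim: k {k0} (k0 : (0 < k)%N) => // k IH _.
have [->|k0] := posnP k; first by exists 1%N => //; rewrite (leq_trans _ n0n1)// ltnW.
have [j /andP[j0 jN] E] := IH k0.
have [jn|nj] := ltnP j.+1 (n0 + n1).
  by exists j.+1; rewrite ?jn//= E.
(* Past the end of the list the orbit re-enters at [c_n0]. *)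
have jE : j.+1 = (n0 + n1)%N by apply/eqP; rewrite eqn_leq nj jN.
exists n0; first by rewrite n0n1 (leq_trans _ hn0).
by rewrite iterS E -iterS jE per.
Qed.

Lemma postcritical_f p : p \in F -> f p \in F.
Proof. by move=> /postcriticalP[k k0 ->]; apply/postcriticalP; exists k.+1. Qed.

Lemma postcritical_core p : p \in F -> c2 <= p <= c1.
Proof. by move=> /postcriticalP[k k0 ->]; exact: iter_core. Qed.

Lemma postcritical_c1 : c1 \in F. Proof. by apply/postcriticalP; exists 1%N. Qed.

Lemma postcritical_c2 : c2 \in F. Proof. by apply/postcriticalP; exists 2%N. Qed.

Lemma postcritical_periodic p n : p \in F -> (n0 <= n)%N -> iter (n + n1) f p = iter n f p.
Proof.
move=> /postcriticalP[k _ ->] nn; rewrite -!iterD.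
have -> : (n + n1 + k = (n - n0 + k) + (n0 + n1))%N by clear -nn; lia.
have -> : (n + k = (n - n0 + k) + n0)%N by clear -nn; lia.
by rewrite !(iterD (n - n0 + k)) per.
Qed.

(** [f] is controlled on [[a, b]] only, whereas the intermediate value theorem is applied to
    iterates of a map continuous on the line. Each smooth half is composed with the clamping to its
    interval; on the side of the other half it equals [f c], which is subtracted once. *)
Lemma continuous_extension : exists2 ft : R -> R, continuous ft &
  forall x, a <= x <= b -> ft x = f x.
Proof.
have [gl [Cl _]] := eu_expanding_l hf; have [gr [Cr _]] := eu_expanding_r hf.
have [gle _] := Cl; have [gre _] := Cr.
have glE x : a <= x <= c -> gl x = f x by move=> xI; apply: gle; rewrite /= in_itv.
have grE x : c <= x <= b -> gr x = f x by move=> xI; apply: gre; rewrite /= in_itv.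
exists (fun x => gl (Num.max a (Num.min x c)) + gr (Num.max c (Num.min x b)) - f c).
  have cl (p q : R) (g : R -> R) x : (forall y, p <= y <= q -> {for y, continuous g}) -> p <= q ->
      {for x, continuous (g \o (fun x => Num.max p (Num.min x q)))}.
    move=> cg pq; apply: continuous_comp.
      apply: (@continuous_max _ _ (fun=> p) (fun x => Num.min x q)); first exact: cvg_cst.
      by apply: (@continuous_min _ _ id (fun=> q)); [exact: cvg_id|exact: cvg_cst].
    by apply: cg; rewrite le_max lexx/= ge_max pq ge_min lexx orbT.
  move=> x; have c1' : {for x, continuous (fun x => gl (Num.max a (Num.min x c)))}.
    by apply: cl (ltW ac) => y yI; apply: (Ck_continuous Cl); rewrite /= in_itv.
  have c2' : {for x, continuous (fun x => gr (Num.max c (Num.min x b)))}.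
    by apply: cl (ltW cb) => y yI; apply: (Ck_continuous Cr); rewrite /= in_itv.
  have c3' : {for x, continuous (fun=> f c : R)} by exact: cvg_cst.
  exact: (cvgB (cvgD c1' c2') c3').
move=> x /andP[ax xb]; have [xc|/ltW cx] := leP x c.
  rewrite /= (max_r ax) (min_l xb) ?(max_l xc) glE ?ax// grE ?lexx ?ltW//.
  by rewrite addrK.
rewrite /= (max_r (ltW ac)) (min_l xb) ?(max_r cx) glE ?lexx ?ltW// grE ?cx//.
by rewrite addrAC subrr add0r.
Qed.

Let c2c1' : c2 < c1 := lt_trans c2_lt_c c_lt_c1.

(** Choose [d] in [[c, c1]] with [f d = c]. By mixing, late iterates of []u, v[] have points below
    [c] and points above [d], hence take the values [c] and [d]. Two more steps send these to [c2]
    and [c1], and continuity fills in everything between. *)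
Lemma covering u v : c2 <= u -> u < v -> v <= c1 -> exists N : nat,
  forall n, (N <= n)%N -> forall x, c2 < x < c1 -> exists y, u < y < v /\ iter n f y = x.
Proof.
move=> c2u uv vc1; have [ft cft ftE] := continuous_extension.
have inI x : c2 <= x <= c1 -> a <= x <= b.
  by move=> /andP[x2 x1]; rewrite (le_trans a_le_c2 x2) (le_trans x1 c1_le_b).
have iterE n x : c2 <= x <= c1 -> iter n ft x = iter n f x /\ c2 <= iter n f x <= c1.
  move=> xK; elim: n => [//|n [IH1 IH2]] /=; split; last exact: f_core.
  by rewrite IH1 ftE//; exact: inI.
have cit n : continuous (iter n ft).
  elim: n => [|n IH] x; first exact: cvg_id.
  by apply: (@continuous_comp _ _ _ (iter n ft) ft); [exact: IH|exact: cft].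
have ivt n p q z : u < p < v -> u < q < v -> iter n f p <= z <= iter n f q ->
    exists2 y, u < y < v & iter n f y = z.
  move=> /andP[up pv] /andP[uq qv].
  have K y : u < y < v -> c2 <= y <= c1.
    by move=> /andP[uy yv]; rewrite (le_trans c2u (ltW uy)) (le_trans (ltW yv) vc1).
  have [pE _] := iterE n p (K p ltac:(by rewrite up pv)).
  have [qE _] := iterE n q (K q ltac:(by rewrite uq qv)).
  rewrite -pE -qE => /andP[pz zq].
  have [pq|/ltW qp] := leP p q.
    have [||y ypq E] := @IVT R (iter n ft) p q z pq.
    - exact: continuous_subspaceT.
    - by rewrite ge_min le_max pz zq orbT.
    have yI : u < y < v.
      move: ypq; rewrite in_itv/= => /andP[py yq].
      by rewrite (lt_le_trans up py) (le_lt_trans yq qv).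
    by exists y => //; have [<- _] := iterE n y (K y yI).
  have [||y ypq E] := @IVT R (iter n ft) q p z qp.
  - exact: continuous_subspaceT.
  - by rewrite ge_min le_max pz zq !orbT.
  have yI : u < y < v.
    move: ypq; rewrite in_itv/= => /andP[py yq].
    by rewrite (lt_le_trans uq py) (le_lt_trans yq pv).
  by exists y => //; have [<- _] := iterE n y (K y yI).
have [d cd dc] : exists2 d, c <= d <= c1 & f d = c.
  have [||d] := @IVT R ft c c1 c (ltW c_lt_c1).
  - exact: continuous_subspaceT.
  - rewrite !ftE ?inI ?(ltW c2_lt_c) ?(ltW c_lt_c1) ?lexx ?(ltW c2c1')//.
    by rewrite ge_min le_max (ltW c2_lt_c) (ltW c_lt_c1) orbT.
  - rewrite in_itv/= => dI; exists d => //; rewrite -ftE//; apply: inI.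
    by move: dI => /andP[cd dc1]; rewrite dc1 (le_trans (ltW c2_lt_c)).
have /andP[cd1 cd2] := cd.
have dlt : d < c1.
  rewrite lt_neqAle cd2 andbT; apply/eqP => dE.
  by have := c2_lt_c; rewrite -dc dE ltxx.
have Uo : open `]u, v[%classic by exact: interval_open.
have KU : `[f (f c), f c]%classic `&` `]u, v[%classic !=set0.
  exists ((u + v) / 2); split; rewrite /= in_itv/=; move: c2u uv vc1; rewrite /c2 /c1; lra.
have V1 : open `]-oo, c[%classic by exact: interval_open.
have V2 : open `]d, +oo[%classic by exact: interval_open.
have KV1 : `[f (f c), f c]%classic `&` `]-oo, c[%classic !=set0.
  by exists c2; split; rewrite /= in_itv/= ?c2_lt_c// lexx (ltW c2c1').
have KV2 : `[f (f c), f c]%classic `&` `]d, +oo[%classic !=set0.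
  by exists c1; split; rewrite /= in_itv/= ?dlt// lexx (ltW c2c1').
have [N1 H1] := eu_mixing hf Uo V1 KU KV1.
have [N2 H2] := eu_mixing hf Uo V2 KU KV2.
exists (maxn N1 N2).+2 => -[//|[//|n]]; rewrite !ltnS geq_max => /andP[h1 h2] x /andP[/ltW x2 /ltW x1].
have [_ [[y1 [_ U1] <-] [_ E1]]] := H1 n h1.
have [_ [[y2 [_ U2] <-] [_ E2]]] := H2 n h2.
rewrite /= !in_itv/= in U1 U2 E1 E2; rewrite andbT in E2.
have [z1 Z1 F1] := ivt n y1 y2 c U1 U2 ltac:(by rewrite (ltW E1) (le_trans cd1 (ltW E2))).
have [z2 Z2 F2] := ivt n y1 y2 d U1 U2 ltac:(by rewrite (le_trans (ltW E1) cd1) (ltW E2)).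
have [y yI yE] := ivt n.+2 z1 z2 x Z1 Z2 ltac:(by rewrite /= F1 F2 dc -/c1 x2 x1).
by exists y.
Qed.

Lemma contracting_bound psi : contracting_on psi `]-oo, c1] -> exists g th,
  [/\ Ck_extension 3 `]-oo, c1] psi g, 0 <= th < 1 & forall x, x <= c1 -> `|derive1 g x| <= th].
Proof.
move=> [g [Cg s1]]; set s := ereal_sup _ in s1.
have sg x : x <= c1 -> (`|derive1 g x|%:E <= s)%E.
  by move=> xc; apply: ereal_sup_ubound; exists x => //=; rewrite in_itv.
have s0 : (0 <= s)%E by apply: le_trans (sg c1 (lexx _)); rewrite lee_fin.
have sfin : s \is a fin_num by rewrite ge0_fin_numE// (lt_trans s1)// ltry.
exists g, (fine s); split => //.
  by rewrite -lee_fin -lte_fin fineK// s0 s1.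
by move=> x xc; rewrite -lee_fin fineK// sg.
Qed.

(** Lets the two branches share the same constants. *)
Lemma branch_weaken th La D th' La' D' s psi : 0 <= La -> 0 <= D ->
  th <= th' -> La <= La' -> D <= D' ->
  branch c2 c1 F th La D s psi -> branch c2 c1 F th' La' D' s psi.
Proof.
move=> La0 D0 tt LL DD bp.
have w0 x : x < c1 -> 0 <= s * derive1 psi x by move=> /(br_weight bp)/andP[].
split.
- exact: (br_sign bp).
- exact: (br_der1 bp).
- exact: (br_der2 bp).
- exact: (br_der3 bp).
- move=> x xc; rewrite w0//=; have /andP[_ wt] := br_weight bp xc; exact: le_trans tt.
- exact: (br_notin bp).
- exact: (br_out bp).
- move=> x xc xF xK; apply: le_trans (br_low bp xc xF xK) _.
  by apply: ler_wpM2r => //; exact: w0.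
- move=> x xc xF xK; apply: le_trans (br_bound2 bp xc xF xK) _.
  by apply: ler_wpM2r => //; exact: w0.
- move=> x xc xF xK; apply: le_trans (br_bound3 bp xc xF xK) _.
  by apply: ler_wpM2r => //; exact: w0.
Qed.

(** [th] comes from the contraction of [psi], [La] from a bound on the derivative of [f], and [D]
    from absolute bounds on the second and third derivatives of [psi], made relative by
    [1 <= La * |psi'|]. The complement of the postcritical set is preserved because that set is
    forward invariant. *)
Lemma branch_intro psi (s l r : R) : `|s| = 1 -> a <= l -> r <= b -> l < r ->
  contracting_on psi `]-oo, c1] -> piecewise_expanding_on f `[l, r] ->
  (forall x, l <= x <= r -> psi (f x) = x) ->
  (forall x, x < c1 -> 0 <= s * derive1 psi x) ->
  (forall x, x < c1 -> c2 <= psi x <= c1 -> f (psi x) = x) ->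
  (forall x, x < c1 -> c2 < psi x < c1 -> l < psi x < r) ->
  (forall x, x < c2 -> ~~ (c2 <= psi x <= c1)) ->
  exists th La D, [/\ 0 <= th < 1, 1 <= La, 0 < D & branch c2 c1 F th La D s psi].
Proof.
move=> s1 al rb lr Hc [gf [Cgf _]] inv sgn inv2 psir out.
have [g [th [Cg th01 gth]]] := contracting_bound Hc.
have oV : open `]-oo, c1[%classic by exact: interval_open.
have VJ : `]-oo, c1[ `<=` `]-oo, c1] by move=> x /=; rewrite !in_itv/=; exact: ltW.
have psiE x : x < c1 -> [/\ derivable psi x 1, derivable (derive1 psi) x 1,
    derivable (derive1 (derive1 psi)) x 1 &
    [/\ derive1 psi x = derive1 g x, derive1 (derive1 psi) x = derive1 (derive1 g) x &
        derive1 (derive1 (derive1 psi)) x = derive1 (derive1 (derive1 g)) x]].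
  by move=> xc; apply: (C3_extension Cg oV VJ); rewrite /= in_itv.
have c21J : `[c2, c1] `<=` `]-oo, c1] by move=> x /=; rewrite !in_itv/= => /andP[].
have [M M0 HM] := Ck_bounded (ltW c2c1') Cg c21J.
have [La0 La00 HLa] := Ck_bounded (ltW lr) Cgf (fun x => id).
pose La := La0 + 1.
have La1 : 1 <= La by rewrite /La lerDr.
have norm_w x : x < c1 -> `|derive1 psi x| = s * derive1 psi x.
  by move=> xc; rewrite -(ger0_norm (sgn x xc)) normrM s1 mul1r.
have notin x : x < c1 -> x \notin F -> psi x \notin F.
  move=> xc xF; apply: contra xF => pF.
  by rewrite -(inv2 x xc (postcritical_core pF)); exact: postcritical_f.
have low x : x < c1 -> x \notin F -> c2 <= psi x <= c1 -> 1 <= La * (s * derive1 psi x).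
  move=> xc xF xK; have fx := inv2 x xc xK.
  have pF := notin x xc xF.
  have xK' : c2 < psi x < c1.
    move: xK => /andP[k2 k1]; rewrite !lt_neqAle k2 k1 !andbT; apply/andP; split.
      by apply: contraNneq pF => <-; exact: postcritical_c2.
    by apply: contraNneq pF => ->; exact: postcritical_c1.
  have /andP[lx xr] := psir x xc xK'.
  have [gfE [U [oU AU CU]]] := Cgf.
  have xI : `[l, r]%classic (psi x) by rewrite /= in_itv/= !ltW.
  have [_ /(_ isT) dgf] := CU 0%N isT (psi x) (AU _ xI).
  have gx : gf (psi x) = x by rewrite gfE// fx.
  have [dpsi _ _ _] := psiE x xc.
  (* [psi \o gf] is the identity near [psi x], so the two derivatives are inverse to each other, and
     an upper bound on that of [gf] bounds that of [psi] from below. *)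
  have d1 : is_derive (psi x) (1 : R) (psi \o gf) (derive1 psi x * derive1 gf (psi x)).
    apply: is_derive1_comp; last exact: derive1_is_derive dgf erefl.
    by rewrite gx; exact: derive1_is_derive dpsi erefl.
  have d2 : is_derive (psi x) (1 : R) (psi \o gf) 1.
    apply: is_derive_near_eq (@is_derive_id R R (psi x) 1).
    near=> y.
    have yI : l <= y <= r.
      by apply/andP; split; apply: ltW; near: y; [exact: lt_nbhsr|exact: lt_nbhsl].
    by rewrite /= gfE ?inv//= in_itv.
  have E : derive1 psi x * derive1 gf (psi x) = 1.
    by rewrite -(is_derive_derive1 d1) (is_derive_derive1 d2).
  rewrite -norm_w// -[X in X <= _]normr1 -E normrM mulrC; apply: ler_wpM2r => //.
  have H := HLa 1%N (psi x) isT ltac:(by rewrite !ltW).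
  by apply: le_trans H _; rewrite /La lerDl.
have c2x x : c2 <= psi x <= c1 -> c2 <= x.
  by move=> xK; rewrite leNgt; apply/negP => /out; rewrite xK.
have bd (y w : R) : `|y| <= M -> 1 <= La * w -> `|y| <= (M + 1) * La * w.
  move=> yM w1; apply: le_trans yM _; rewrite -mulrA.
  by apply: (@le_trans _ _ (M + 1)); [rewrite lerDl|rewrite ler_peMr// addr_ge0].
exists th, La, ((M + 1) * La); split => //.
  by rewrite mulr_gt0// ?ltr_wpDl// (lt_le_trans ltr01).
split => //.
- by move=> x /psiE[].
- by move=> x /psiE[].
- by move=> x /psiE[].
- move=> x xc; rewrite sgn//= -norm_w//.
  by have [_ _ _ [-> _ _]] := psiE x xc; apply: gth; exact: ltW.
- move=> x xc xF xK; apply: bd; last exact: low.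
  have [_ _ _ [_ -> _]] := psiE x xc.
  exact: HM 2%N x isT ltac:(by rewrite c2x// ltW).
- move=> x xc xF xK; apply: bd; last exact: low.
  have [_ _ _ [_ _ ->]] := psiE x xc.
  exact: HM 3%N x isT ltac:(by rewrite c2x// ltW).
Unshelve. all: by end_near. Qed.

End InducedMarkovMap.

(** * Verification of the Markov data *)

Section MarkovInstance.
Variable R : realType.
Implicit Types (x y z p q : R).
Variables (a c b a0 : R) (f psip psim : R -> R) (n0 n1 : nat).
Hypothesis hf : expanding_unimodal a c b f.
Hypothesis hpsi : inverse_branches a c b f psip psim.
Hypothesis ha0 : a0 <= a.
Hypothesis ha0fix : psip a0 = a0.
Hypothesis hn0 : (2 <= n0)%N.
Hypothesis hn1 : minimal_period f (iter n0 f c) n1.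

Let c1 := f c.
Let c2 := f (f c).
Local Notation F := (postcritical c f n0 n1).

Let ac : a < c. Proof. by have /andP[] := eu_order hf. Qed.
Let cb : c < b. Proof. by have /andP[] := eu_order hf. Qed.
Let cc1 : c < c1 := c_lt_c1 hf.
Let c1b : c1 <= b := c1_le_b hf.
Let ac2 : a <= c2 := a_le_c2 hf.
Let c2c : c2 < c := c2_lt_c hf.
Let c21 : c2 < c1 := lt_trans c2c cc1.

Lemma contracting_lipschitz psi : contracting_on psi `]-oo, c1] ->
  forall x y, x <= c1 -> y <= c1 -> `|psi x - psi y| <= `|x - y|.
Proof.
move=> /contracting_bound[g [th [[gE [U [oU AU CU]]] /andP[th0 th1] gth]]] x y xc yc.
have gEx z : z <= c1 -> g z = psi z by move=> zc; apply: gE; rewrite /= in_itv.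
rewrite -!gEx//; apply: (@le_trans _ _ (th * `|x - y|)); last by rewrite ler_piMl// ltW.
have zc z : Num.min x y <= z <= Num.max x y -> z <= c1.
  by move=> /andP[_ /le_trans]; apply; rewrite ge_max xc yc.
apply: (@MVT_lipschitz _ g (derive1 g)) => z /zc zc1; last exact: gth.
have [_ /(_ isT) dg] := CU 0%N isT z ltac:(by apply: AU; rewrite /= in_itv).
exact: derive1_is_derive dg erefl.
Qed.

Lemma contracting_continuous psi : contracting_on psi `]-oo, c1] ->
  {within `]-oo, c1], continuous psi}.
Proof.
move=> [g [Cg _]]; have [gE _] := Cg.
apply: (@subspace_eq_continuous _ _ _ (g : R -> R)).
  by move=> x /set_mem xc; rewrite /from_subspace gE.
by apply: continuous_in_subspaceT => x /set_mem xc; exact: (Ck_continuous Cg).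
Qed.

Lemma contracting_derivable psi x : contracting_on psi `]-oo, c1] -> x < c1 ->
  derivable psi x 1.
Proof.
move=> [g [Cg _]] xc; have oV : open `]-oo, c1[%classic by exact: interval_open.
have VJ : `]-oo, c1[ `<=` `]-oo, c1] by move=> y /=; rewrite !in_itv/=; exact: ltW.
by have [d _ _ _] := C3_extension Cg oV VJ (x := x) ltac:(by rewrite /= in_itv).
Qed.

Lemma psip_lt x y : x < y -> y <= c1 -> psip x < psip y.
Proof. by move=> xy yc; apply: (ib_increasing hpsi); rewrite ?in_itv//= (le_trans (ltW xy)). Qed.

Lemma psim_lt x y : x < y -> y <= c1 -> psim y < psim x.
Proof. by move=> xy yc; apply: (ib_decreasing hpsi); rewrite ?in_itv//= (le_trans (ltW xy)). Qed.

Lemma psipK y : a <= y <= c -> psip (f y) = y.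
Proof. by move=> yI; apply: (ib_inverse_l hpsi); rewrite in_itv. Qed.

Lemma psimK y : c <= y <= b -> psim (f y) = y.
Proof. by move=> yI; apply: (ib_inverse_r hpsi); rewrite in_itv. Qed.

Lemma psip_c1 : psip c1 = c. Proof. by rewrite psipK// lexx ltW. Qed.

Lemma psim_c1 : psim c1 = c. Proof. by rewrite psimK// lexx ltW. Qed.

Lemma psim_c2 : psim c2 = c1. Proof. by rewrite psimK// ltW. Qed.

(** [psip] is nonexpansive and fixes [a0], so [psip x <= x] for [x >= a0]; points to the left of
    [a0] stay there by monotonicity. *)
Lemma psip_le x : x <= c2 -> psip x <= c2.
Proof.
move=> x2; have xc1 : x <= c1 := le_trans x2 (ltW c21).
have a02 : a0 <= c2 := le_trans ha0 ac2.
have [xa|ax] := ltP x a0.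
  by rewrite (le_trans (ltW (psip_lt xa (le_trans a02 (ltW c21)))))// ha0fix.
have := contracting_lipschitz (ib_contracting_l hpsi) xc1 (le_trans a02 (ltW c21)).
rewrite ha0fix (@ger0_norm _ (x - a0)) ?subr_ge0// => /(le_trans (ler_norm _)) H.
by apply: le_trans x2; rewrite -(lerD2r (- a0)).
Qed.

Lemma psip_out x : x < c2 -> ~~ (c2 <= psip x <= c1).
Proof.
move=> x2; rewrite negb_and -ltNge (lt_le_trans (psip_lt x2 (ltW c21)))//.
exact: psip_le.
Qed.

Lemma psim_out x : x < c2 -> ~~ (c2 <= psim x <= c1).
Proof. by move=> x2; rewrite negb_and -!ltNge -psim_c2 psim_lt ?orbT// ltW. Qed.

(** [psip] takes the same value at [x] and at [f (psip x)], and it is injective up to [c1]. *)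
Lemma f_psip x : x < c1 -> c2 <= psip x <= c1 -> f (psip x) = x.
Proof.
move=> xc xK; have yK := psipK (y := psip x) _.
have E : psip (f (psip x)) = psip x.
  apply: yK; have /andP[x2 _] := xK.
  by rewrite (le_trans ac2 x2)/= -psip_c1 ltW// psip_lt.
have /andP[_ fc1] := f_core hf xK.
have [h|h|//] := ltgtP (f (psip x)) x.
  by have := psip_lt h (ltW xc); rewrite E ltxx.
by have := psip_lt h fc1; rewrite E ltxx.
Qed.

Lemma f_psim x : x < c1 -> c2 <= psim x <= c1 -> f (psim x) = x.
Proof.
move=> xc xK; have yK := psimK (y := psim x) _.
have E : psim (f (psim x)) = psim x.
  apply: yK; have /andP[_ x1] := xK.
  by rewrite (le_trans x1 c1b) andbT -psim_c1 ltW// psim_lt.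
have /andP[_ fc1] := f_core hf xK.
have [h|h|//] := ltgtP (f (psim x)) x.
  by have := psim_lt h (ltW xc); rewrite E ltxx.
by have := psim_lt h fc1; rewrite E ltxx.
Qed.

Lemma induced_markov_map : exists th La D, markov_map c2 c c1 F f psip psim th La D.
Proof.
have [thp [Lap [Dp [/andP[tp0 tp1] Lp1 Dp0 bp]]]] : exists th La D,
    [/\ 0 <= th < 1, 1 <= La, 0 < D & branch c2 c1 F th La D 1 psip].
  apply: (@branch_intro R a c b f n0 n1 hf hn0 hn1 psip 1 a c); rewrite ?normr1//.
  - exact: ltW.
  - exact: (ib_contracting_l hpsi).
  - exact: (eu_expanding_l hf).
  - exact: psipK.
  - move=> x xc; rewrite mul1r; apply: (@incr_derive1_ge0_itvNy _ psip true c1).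
    + move=> y; rewrite inE/= in_itv/= => yc.
      exact: (contracting_derivable (ib_contracting_l hpsi)).
    + by move=> y z _; rewrite in_itv/= => zc yz; exact: (psip_lt yz (ltW zc)).
    + by rewrite in_itv.
  - exact: f_psip.
  - move=> x xc /andP[x2 _]; rewrite (le_lt_trans ac2 x2)/= -psip_c1.
    exact: psip_lt.
  - exact: psip_out.
have [thm [Lam [Dm [/andP[tm0 tm1] Lm1 Dm0 bm]]]] : exists th La D,
    [/\ 0 <= th < 1, 1 <= La, 0 < D & branch c2 c1 F th La D (-1) psim].
  apply: (@branch_intro R a c b f n0 n1 hf hn0 hn1 psim (-1) c b); rewrite ?normrN1//.
  - exact: ltW.
  - exact: (ib_contracting_r hpsi).
  - exact: (eu_expanding_r hf).
  - exact: psimK.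
  - move=> x xc; rewrite mulN1r oppr_ge0; apply: (@decr_derive1_le0_itvNy _ psim true c1).
    + move=> y; rewrite inE/= in_itv/= => yc.
      exact: (contracting_derivable (ib_contracting_r hpsi)).
    + by move=> y z; rewrite !in_itv/= => yc zc yz; exact: (psim_lt yz (ltW yc)).
    + by rewrite in_itv.
  - exact: f_psim.
  - move=> x xc /andP[_ x1]; rewrite (lt_le_trans x1 c1b) andbT -psim_c1.
    exact: psim_lt.
  - exact: psim_out.
exists (Num.max thp thm), (Num.max Lap Lam), (Num.max Dp Dm); split => //.
- by rewrite le_max tp0/= gt_max tp1 tm1.
- by rewrite le_max Lp1.
- by rewrite lt_max Dp0.
- exact: postcritical_c2.
- exact: postcritical_c1.
- exact: (postcritical_core hf hn0 hn1).
- exact: (postcritical_f hn0 hn1).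
- exact: (f_core hf).
- by apply: (branch_weaken _ _ _ _ _ bp); rewrite ?le_max ?lexx ?(le_trans ler01 Lp1) ?(ltW Dp0).
- by apply: (branch_weaken _ _ _ _ _ bm); rewrite ?le_max ?lexx ?orbT ?(le_trans ler01 Lm1) ?(ltW Dm0).
- exact: psip_c1.
- exact: psim_c1.
- exact: psip_le.
- exact: psim_c2.
- exact: contracting_continuous (ib_contracting_l hpsi).
- exact: contracting_continuous (ib_contracting_r hpsi).
- by move=> y /andP[y2 yc]; apply: psipK; rewrite (le_trans ac2).
- by move=> y /andP[yc y1]; apply: psimK; rewrite yc (le_trans y1).
- exact: psip_lt.
- exact: psim_lt.
- exact: (covering hf).
Qed.

End MarkovInstance.

(** * Invariant densities are fixed by the transfer operator *)

Section OneSidedSlopes.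
Variable R : realType.
Implicit Types (x y l d c : R) (g k : R -> R).

Definition slope g x : R -> R := fun y => (g y - g x) / (y - x).

(** Chain rule for one-sided difference quotients. Two filters are kept apart because a decreasing
    inner map exchanges left and right neighbourhoods. *)
Lemma slope_comp (H H' : set_system R) (FH : Filter H) (FH' : Filter H') g k x l d :
  k @ H --> H' -> (\forall y \near H, k y != k x) ->
  slope g (k x) @ H' --> l -> slope k x @ H --> d ->
  slope (g \o k) x @ H --> l * d.
Proof.
move=> kH ne gl kd.
have gkl : (slope g (k x) \o k) @ H --> l by exact: cvg_comp kH gl.
apply: cvg_trans (cvgM gkl kd); apply: near_eq_cvg; near=> y.
have ne' : k y - k x != 0 by rewrite subr_eq0; near: y.
by rewrite /slope /= mulrA mulfVK.
Unshelve. all: by end_near. Qed.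

Lemma slope_derivable k x : derivable k x 1 ->
  slope k x @ x^' --> derive1 k x.
Proof.
move=> dk; have H : (fun h => h^-1 *: (k (h + x) - k x)) @ 0^' --> derive1 k x.
  rewrite derive1E; have := dk; rewrite /derivable /derive => /cvg_ex[l hl].
  have E : (fun h : R => h^-1 *: ((k \o shift x) (h *: (1 : R)) - k x)) =
      (fun h => h^-1 *: (k (h + x) - k x)).
    by apply/funext => h; rewrite /= /GRing.scale/= mulr1.
  by rewrite -E; exact: dk.
apply/cvgrPdist_le => e e0; move/cvgrPdist_le: H => /(_ e e0)[d d0 Hd].
exists d => // y /= yd yx; have := Hd (y - x).
rewrite /ball/= sub0r opprB => /(_ yd); rewrite subrK /slope mulrC; apply.
by rewrite subr_eq0.
Qed.

Lemma slope_right k x : derivable k x 1 -> slope k x @ x^'+ --> derive1 k x.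
Proof.
move=> /slope_derivable H; apply: cvg_trans H; apply: cvg_app => A [e e0 HA].
by exists e => // y ye xy; apply: HA => //; rewrite gt_eqF.
Qed.

Lemma slope_left k x : derivable k x 1 -> slope k x @ x^'- --> derive1 k x.
Proof.
move=> /slope_derivable H; apply: cvg_trans H; apply: cvg_app => A [e e0 HA].
by exists e => // y ye xy; apply: HA => //; rewrite lt_eqF.
Qed.

Section Monotone.
Variables (k : R -> R) (x c : R).
Hypothesis xc : x < c.
Hypothesis ck : {for x, continuous k}.

Let close (A : set R) (e : R) : 0 < e -> exists2 d, 0 < d &
  forall y, `|x - y| < d -> y < c /\ `|k x - k y| < e.
Proof.
move=> e0; have [d d0 Hd] : \forall y \near x, y < c /\ `|k x - k y| < e.
  by near=> y; split; near: y; [exact: lt_nbhsl|move/cvgrPdist_lt: ck => /(_ e e0)].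
by exists d => // y xy; exact: Hd.
Unshelve. all: by end_near. Qed.

Lemma increasing_at_right : (forall y z, y < z -> z < c -> k y < k z) ->
  k @ x^'+ --> (k x)^'+.
Proof.
move=> km A [e e0 HA]; have [d d0 Hd] := close A e0.
exists d => // y /Hd[yc ky] xy; apply: HA => //; exact: km.
Qed.

Lemma increasing_at_left : (forall y z, y < z -> z < c -> k y < k z) ->
  k @ x^'- --> (k x)^'-.
Proof.
move=> km A [e e0 HA]; have [d d0 Hd] := close A e0.
exists d => // y /Hd[yc ky] xy; apply: HA => //; exact: km.
Qed.

Lemma decreasing_at_right : (forall y z, y < z -> z < c -> k z < k y) ->
  k @ x^'+ --> (k x)^'-.
Proof.
move=> km A [e e0 HA]; have [d d0 Hd] := close A e0.
exists d => // y /Hd[yc ky] xy; apply: HA => //; exact: km.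
Qed.

Lemma decreasing_at_left : (forall y z, y < z -> z < c -> k z < k y) ->
  k @ x^'- --> (k x)^'+.
Proof.
move=> km A [e e0 HA]; have [d d0 Hd] := close A e0.
exists d => // y /Hd[yc ky] xy; apply: HA => //; exact: km.
Qed.

End Monotone.

End OneSidedSlopes.

(** * Densities of bounded variation and their distribution functions *)

Section DensityTransfer.
Variable R : realType.
Implicit Types (x y z r e : R).
Local Notation leb := (@lebesgue_measure R).

(** The variation compares the value at [x] with the value zero at a point beyond the support. *)
Lemma BVR_bounded (rho : R -> R) (P Q : R) : BVR rho -> P <= Q ->
  (forall x, 0 <= rho x) -> (forall x, ~~ (P <= x <= Q) -> rho x = 0) ->
  exists M, forall x, 0 <= rho x <= M.
Proof.
move=> [M HM] PQ r0 rout; exists M => x; rewrite r0/=.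
pose y := Num.max x Q + 1.
have xy : x <= y by rewrite /y (@le_trans _ _ (Num.max x Q)) ?le_max ?lexx// lerDl.
have ry : rho y = 0.
  apply: rout; rewrite negb_and -!ltNge; apply/orP; right.
  by rewrite (@le_lt_trans _ _ (Num.max x Q)) ?le_max ?lexx ?orbT// ltrDl.
have := le_trans (total_variation_ge rho xy) (HM x y xy).
by rewrite lee_fin ry sub0r normrN ger0_norm.
Qed.

(** Jordan decomposition into monotone functions. It lives on a compact interval, so the argument is
    clamped to one that exceeds [[P, Q]] by a unit on each side, which keeps the value zero outside
    [[P, Q]]. *)
Lemma BVR_measurable (rho : R -> R) (P Q : R) : BVR rho -> P <= Q ->
  (forall x, ~~ (P <= x <= Q) -> rho x = 0) -> measurable_fun setT rho.
Proof.
move=> [M HM] PQ rout.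
have bv : bounded_variation (P - 1) (Q + 1) rho.
  apply/bounded_variationP; first lra.
  have PQ' : P - 1 <= Q + 1 by lra.
  rewrite ge0_fin_numE ?total_variation_ge0//.
  by rewrite (le_lt_trans (HM _ _ PQ'))// ltry.
pose cl x := Num.max (P - 1) (Num.min x (Q + 1)).
have clI x : P - 1 <= cl x <= Q + 1.
  by rewrite /cl le_max lexx/= ge_max ge_min lexx orbT andbT; lra.
have clm x y : x <= y -> cl x <= cl y.
  by move=> xy; rewrite /cl ge_max !le_max lexx/= le_min !ge_min xy lexx !orbT.
pose p x := (fine \o pos_tv (P - 1) rho) (cl x).
pose n x := (fine \o neg_tv (P - 1) rho) (cl x).
have mn : measurable_fun setT n.
  apply: nondecreasing_measurable => // x y xy.
  by apply: (fine_neg_tv_nondecreasing bv); rewrite ?in_itv/= ?clI// clm.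
have mp : measurable_fun setT p.
  apply: nondecreasing_measurable => // x y xy.
  by apply: (fine_neg_tv_nondecreasing (bounded_variationN bv)); rewrite ?in_itv/= ?clI// clm.
rewrite (_ : rho = p \- n); first exact: measurable_funB.
apply/funext => x.
have -> : rho x = rho (cl x).
  have [xP|Px] := ltP x P.
    rewrite !rout// negb_and -!ltNge ?xP//; apply/orP; left.
    by rewrite /cl gt_max ltrBlDr ltrDl ltr01/= gt_min xP.
  have [Qx|xQ] := ltP Q x.
    rewrite !rout// negb_and -!ltNge ?Qx ?orbT//; apply/orP; right.
    by rewrite /cl lt_max lt_min Qx ltrDl ltr01 orbT.
  congr rho; rewrite /cl (min_l (le_trans xQ _)) ?lerDl// max_r//; lra.
by rewrite (bounded_variation_pos_neg_tvE bv) ?in_itv/= ?clI.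
Qed.

Variables (P Q : R) (rho : R -> R) (mu : probability (measurableTypeR R) R).
Hypothesis PQ : P <= Q.
Hypothesis rho_ge0 : forall x, 0 <= rho x.
Hypothesis rho_out : forall x, ~~ (P <= x <= Q) -> rho x = 0.
Hypothesis rho_BV : BVR rho.
Hypothesis muE : forall A : set R, measurable A -> mu A = (\int[leb]_(x in A) (rho x)%:E)%E.

Let mrho : measurable_fun setT (EFin \o rho).
Proof. by apply/measurable_EFinP; exact: BVR_measurable rho_BV PQ rho_out. Qed.

Let mufin (A : set R) : measurable A -> mu A \is a fin_num.
Proof. by move=> mA; exact: fin_num_measure. Qed.

Definition cdf_at (x : R) : R := fine (mu `]-oo, x]%classic).

Lemma mu_point x : mu [set x] = 0%E.
Proof. by rewrite muE// integral_set1. Qed.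

Lemma cdf_sub x y : x <= y -> cdf_at y - cdf_at x = fine (mu `]x, y]%classic).
Proof.
move=> xy; rewrite /cdf_at.
have -> : `]-oo, y]%classic = `]-oo, x] `|` `]x, y].
  apply/seteqP; split => z; rewrite /= !in_itv/=.
    by move=> zy; have [zx|xz] := leP z x; [left|right; rewrite zy].
  by move=> [zx|/andP[]//]; exact: le_trans xy.
rewrite measureU//; last first.
  by apply/seteqP; split => z //=; rewrite !in_itv/= => -[zx /andP[xz _]]; lra.
by rewrite fineD ?mufin// addrAC subrr add0r.
Qed.

Lemma mu_oc_oo x y : mu `]x, y]%classic = mu `]x, y[%classic.
Proof.
have [xy|yx] := ltP x y; last first.
  by rewrite !set_itv_ge// bnd_simp -leNgt.
have -> : `]x, y]%classic = `]x, y[ `|` [set y].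
  apply/seteqP; split => z; rewrite /= !in_itv/=.
    by move=> /andP[xz]; rewrite le_eqVlt => /predU1P[->|zy]; [right|left; rewrite xz].
  by move=> [/andP[-> /ltW ->]//|->]; rewrite xy lexx.
rewrite measureU//.
  by rewrite [X in (_ + X)%E]mu_point adde0.
by apply/seteqP; split => z //= [+ zE]; rewrite in_itv/= zE ltxx andbF.
Qed.

Lemma mu_co_oc x y : mu `[x, y[%classic = mu `]x, y]%classic.
Proof.
rewrite mu_oc_oo; have [xy|yx] := ltP x y; last first.
  by rewrite !set_itv_ge// bnd_simp -leNgt.
have -> : `[x, y[%classic = `]x, y[ `|` [set x].
  apply/seteqP; split => z; rewrite /= !in_itv/=.
    by move=> /andP[+ zy]; rewrite le_eqVlt => /predU1P[->|xz]; [right|left; rewrite xz].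
  by move=> [/andP[/ltW -> ->]//|->]; rewrite xy lexx.
rewrite measureU//.
  by rewrite [X in (_ + X)%E]mu_point adde0.
by apply/seteqP; split => z //= [+ zE]; rewrite in_itv/= zE ltxx.
Qed.

Lemma mu_near x y r e : x < y -> (forall z, x < z < y -> `|r - rho z| <= e) ->
  `|r - fine (mu `]x, y[%classic) / (y - x)| <= e.
Proof.
move=> xy H; have yx0 : 0 < y - x by rewrite subr_gt0.
have mI : measurable `]x, y[%classic by exact: measurable_itv.
have leI : leb `]x, y[ = (y - x)%:E.
  by rewrite lebesgue_measure_itv/= lte_fin xy.
have irho : leb.-integrable `]x, y[ (EFin \o rho).
  apply/integrableP; split; first exact: measurable_funTS.
  have -> : (\int[leb]_(z in `]x, y[) `|(EFin \o rho) z| = mu `]x, y[%classic)%E.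
    by rewrite muE//; apply: eq_integral => z _; rewrite /= ger0_norm.
  by rewrite -ge0_fin_numE// mufin.
have icst k : leb.-integrable `]x, y[ (EFin \o cst k).
  apply/integrableP; split; first exact/measurable_EFinP/measurable_cst.
  rewrite (_ : (\int[leb]_(z in _) _ = \int[leb]_(z in `]x, y[) cst `|k|%:E z)%E)//.
  by rewrite integral_cst// [X in (_ * X)%E]leI -EFinM ltry.
have cstE k : (\int[leb]_(z in `]x, y[) (EFin \o cst k) z)%E = (k * (y - x))%:E.
  by have := integral_cst leb mI k%:E; rewrite [X in (_ * X)%E]leI.
have lo : (((r - e) * (y - x))%:E <= mu `]x, y[%classic)%E.
  rewrite muE// -cstE; apply: le_integral => // z; rewrite inE/= in_itv/= => /H.
  by rewrite lee_fin ler_norml; lra.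
have hi : (mu `]x, y[%classic <= ((r + e) * (y - x))%:E)%E.
  rewrite muE// -cstE; apply: le_integral => // z; rewrite inE/= in_itv/= => /H.
  by rewrite lee_fin ler_norml; lra.
rewrite -(@fineK _ (mu `]x, y[%classic)) ?mufin// lee_fin -ler_pdivlMr// in lo.
rewrite -(@fineK _ (mu `]x, y[%classic)) ?mufin// lee_fin -ler_pdivrMr// in hi.
by rewrite ler_norml; lra.
Qed.

(** On a short interval to the right of [x] the density is close to [r], and so is its mean, which
    is the difference quotient. *)
Lemma cdf_slope_right x r : rho y @[y --> x^'+] --> r -> slope cdf_at x @ x^'+ --> r.
Proof.
move=> /cvgrPdist_le H; apply/cvgrPdist_lt => e e0.
have [d d0 Hd] := near_at_rightP (H (e / 2) (divr_gt0 e0 (ltr0Sn R 1))).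
near=> y; have xy : x < y by near: y; exact: nbhs_right_gt.
rewrite /slope cdf_sub ?ltW// mu_oc_oo.
apply: (@le_lt_trans _ _ (e / 2)); last by rewrite ltr_pdivrMr// ltr_pMr// ltr1n.
apply: mu_near => // z /andP[xz zy].
apply: Hd; rewrite xz (lt_trans zy)//; near: y; apply: nbhs_right_lt.
by rewrite ltrDl.
Unshelve. all: by end_near. Qed.

Lemma cdf_slope_left x r : rho y @[y --> x^'-] --> r -> slope cdf_at x @ x^'- --> r.
Proof.
move=> /cvgrPdist_le H; apply/cvgrPdist_lt => e e0.
have [d d0 Hd] := near_at_leftP (H (e / 2) (divr_gt0 e0 (ltr0Sn R 1))).
near=> y; have yx : y < x by near: y; exact: nbhs_left_lt.
rewrite /slope -(opprB (cdf_at x)) -(opprB x) invrN mulrNN cdf_sub ?ltW// mu_oc_oo.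
apply: (@le_lt_trans _ _ (e / 2)); last by rewrite ltr_pdivrMr// ltr_pMr// ltr1n.
apply: mu_near => // z /andP[yz zx].
apply: Hd; rewrite zx andbT (lt_trans _ yz)//; near: y; apply: nbhs_left_gt.
by rewrite ltrBlDr ltrDl.
Unshelve. all: by end_near. Qed.

Lemma density_mass : \int[leb]_(x in `[P, Q]) rho x = 1.
Proof.
have mI : measurable `[P, Q]%classic by exact: measurable_itv.
have C0 : mu (~` `[P, Q]%classic) = 0%E.
  rewrite muE; last exact: measurableC.
  by apply: integral0_eq => x /= xPQ; rewrite rho_out//; apply/negP; rewrite in_itv/= in xPQ.
have := probability_setC mu mI; rewrite [LHS]C0 /Rintegral -muE// => H.
by have := mufin mI; move: H; case: (mu `[P, Q]%classic) => //= s [s1] _; lra.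
Qed.

End DensityTransfer.

(** * From an invariant measure to a fixed point of the transfer operator *)

Section DensityInvariance.
Variable R : realType.
Implicit Types (x y z p q : R).
Variables (a c b a0 : R) (f psip psim rho : R -> R) (n0 n1 : nat).
Hypothesis hf : expanding_unimodal a c b f.
Hypothesis hpsi : inverse_branches a c b f psip psim.
Hypothesis ha0 : a0 <= a.
Hypothesis ha0fix : psip a0 = a0.
Hypothesis hrho : invariant_density a c b f rho.

Let c1 := f c.
Let c2 := f (f c).
Local Notation leb := (@lebesgue_measure R).

Let c21 : c2 < c1 := lt_trans (c2_lt_c hf) (c_lt_c1 hf).

Lemma density_out x : ~~ (c2 <= x <= c1) -> rho x = 0.
Proof. by move=> xK; apply: (id_support hrho); rewrite in_itv. Qed.

Section WithMeasure.
Variable mu : probability (measurableTypeR R) R.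
Hypothesis muinv : ac_invariant_probability a b f mu.
Hypothesis muE : forall A : set R, measurable A -> mu A = (\int[leb]_(x in A) (rho x)%:E)%E.

Let mu_ab (A : set R) : measurable A -> mu (`[a, b]%classic `&` A) = mu A.
Proof.
move=> mA; have [_ ab1 _] := muinv.
have mI : measurable `[a, b]%classic by exact: measurable_itv.
have C0 : mu (~` `[a, b]%classic) = 0%E.
  by rewrite [LHS](probability_setC mu mI) ab1 subee.
rewrite -[in RHS](setIT A) -(setUv `[a, b]%classic) setIUr measureU.
- rewrite [X in (_ + X)%E](_ : _ = 0%E) ?adde0 1?setIC//.
  apply: (@subset_measure0 _ _ _ mu _ (~` `[a, b]%classic)) => //.
  - by apply: measurableI => //; exact: measurableC.
  - exact: measurableC.
- exact: measurableI.
- exact: (measurableI _ _ mA (measurableC mI)).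
- by rewrite setIACA setICr setI0.
Qed.

(** Within [[a, b]] the preimage of []x, y]] is the disjoint union of []psip x, psip y]] and [[psim
    y, psim x[]. The decreasing branch exchanges the open and the closed end, which is harmless
    since points have measure zero. *)
Lemma cdf_invariance x y : x < y -> y < c1 ->
  cdf_at mu y - cdf_at mu x =
  (cdf_at mu (psip y) - cdf_at mu (psip x)) + (cdf_at mu (psim x) - cdf_at mu (psim y)).
Proof.
move=> xy yc; have xc : x < c1 := lt_trans xy yc.
have pxy := psip_lt hpsi xy (ltW yc); have mxy := psim_lt hpsi xy (ltW yc).
have pyc : psip y < c by rewrite -(psip_c1 hf hpsi); exact: (psip_lt hpsi).
have cmy : c < psim y by rewrite -(psim_c1 hf hpsi); exact: (psim_lt hpsi).
rewrite !cdf_sub ?ltW//.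
have <- : mu (`[a, b]%classic `&` f @^-1` `]x, y]%classic) = mu `]x, y]%classic.
  by have [_ _] := muinv; apply; exact: measurable_itv.
have -> : `[a, b]%classic `&` f @^-1` `]x, y]%classic =
    `[a, b]%classic `&` (`]psip x, psip y]%classic `|` `[psim y, psim x[%classic).
  apply/seteqP; split => u [uab H]; split=> //; move: (uab); rewrite /= in_itv/= => /andP[au ub].
    move: H; rewrite /= !in_itv/= => /andP[xf fy].
    have [uc|/ltW cu] := leP u c.
      left; rewrite -(psipK hpsi (y := u)) ?au// (psip_lt hpsi xf (le_trans fy (ltW yc)))/=.
      move: fy; rewrite le_eqVlt => /predU1P[->//|fy].
      by rewrite ltW// (psip_lt hpsi fy (ltW yc)).
    right; rewrite -(psimK hpsi (y := u)) ?cu// (psim_lt hpsi xf (le_trans fy (ltW yc))) andbT.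
    move: fy; rewrite le_eqVlt => /predU1P[->//|fy].
    by rewrite ltW// (psim_lt hpsi fy (ltW yc)).
  have fu1 : f u <= c1.
    have [uc|cu|->//] := ltgtP u c.
      by rewrite ltW//; apply: (f_increasing hf).
    by rewrite ltW//; apply: (f_decreasing hf).
  move: H; rewrite /= !in_itv/= => -[/andP[pu up]|/andP[pu up]].
    have uE : psip (f u) = u by rewrite (psipK hpsi)// au (le_trans up (ltW pyc)).
    rewrite -uE in pu up; apply/andP; split.
      rewrite ltNge; apply/negP; rewrite le_eqVlt => /predU1P[E|h].
        by rewrite E ltxx in pu.
      by have := lt_trans pu (psip_lt hpsi h (ltW xc)); rewrite ltxx.
    rewrite leNgt; apply/negP => h.
    by have := le_lt_trans up (psip_lt hpsi h fu1); rewrite ltxx.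
  have uE : psim (f u) = u by rewrite (psimK hpsi)// ub (le_trans (ltW cmy) pu).
  rewrite -uE in pu up; apply/andP; split.
    rewrite ltNge; apply/negP; rewrite le_eqVlt => /predU1P[E|h].
      by rewrite E ltxx in up.
    by have := lt_trans up (psim_lt hpsi h (ltW xc)); rewrite ltxx.
  rewrite leNgt; apply/negP => h.
  by have := le_lt_trans pu (psim_lt hpsi h fu1); rewrite ltxx.
have mU : measurable `]psip x, psip y]%classic by exact: measurable_itv.
have mV : measurable `[psim y, psim x[%classic by exact: measurable_itv.
rewrite mu_ab; last exact: measurableU.
rewrite measureU//; last first.
  apply/seteqP; split => u //=; rewrite !in_itv/= => -[/andP[_ up] /andP[mu' _]].
  by have := lt_trans (le_lt_trans up pyc) (lt_le_trans cmy mu'); rewrite ltxx.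
rewrite fineD ?fin_num_measure//; congr (_ + fine _); exact: (mu_co_oc muE).
Qed.

Lemma cvg_slope_eq (H : set_system R) (g k m : R -> R) x (lg lk lm : R) : ProperFilter H ->
  (\forall y \near H, slope g x y = slope k x y - slope m x y) ->
  slope g x @ H --> lg -> slope k x @ H --> lk -> slope m x @ H --> lm -> lg = lk - lm.
Proof.
move=> PH E cg ck cm.
have ckm : slope g x @ H --> lk - lm.
  by apply: cvg_trans (cvgB ck cm); apply: near_eq_cvg; apply: filterS E => y ->.
exact: (cvg_unique _ cg ckm).
Qed.

(* Both one-sided derivatives of the distribution function are transferred; [psim]
   exchanges left and right limits, so only their half sum is fixed pointwise. *)
Lemma transfer_density x : x < c1 -> transfer c1 psip psim rho x = rho x.
Proof.
move=> xc; rewrite /transfer /half_transfer xc mul1r mulN1r mulNr.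
have rBV := id_BV hrho; have r0 := id_ge0 hrho.
have sr := cdf_slope_right (ltW c21) r0 density_out rBV muE.
have sl := cdf_slope_left (ltW c21) r0 density_out rBV muE.
have [l [r [hl hr E]]] := id_regular hrho x.
have [lp [rp [hlp hrp Ep]]] := id_regular hrho (psip x).
have [lm [rm [hlm hrm Em]]] := id_regular hrho (psim x).
have dp := contracting_derivable (ib_contracting_l hpsi) xc.
have dm := contracting_derivable (ib_contracting_r hpsi) xc.
have pm y z : y < z -> z < c1 -> psip y < psip z.
  by move=> yz zc; exact: psip_lt hpsi _ _ yz (ltW zc).
have mm y z : y < z -> z < c1 -> psim z < psim y.
  by move=> yz zc; exact: psim_lt hpsi _ _ yz (ltW zc).
have cp : {for x, continuous psip} by move: dp => /derivable1_diffP/differentiable_continuous.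
have cm : {for x, continuous psim} by move: dm => /derivable1_diffP/differentiable_continuous.
have Er : r = rp * derive1 psip x - lm * derive1 psim x.
  apply: (@cvg_slope_eq x^'+ (cdf_at mu) (cdf_at mu \o psip) (cdf_at mu \o psim) x _ _ _ _).
  - near=> y; have xy : x < y by near: y; exact: nbhs_right_gt.
    have yc : y < c1 by near: y; exact: nbhs_right_lt.
    by rewrite /slope /= cdf_invariance// -mulrBl opprB addrA.
  - exact: sr.
  - apply: slope_comp (increasing_at_right xc cp pm) _ (sr _ _ hrp) (slope_right dp).
    near=> y; have xy : x < y by near: y; exact: nbhs_right_gt.
    have yc : y < c1 by near: y; exact: nbhs_right_lt.
    by rewrite gt_eqF// pm.
  - apply: slope_comp (decreasing_at_right xc cm mm) _ (sl _ _ hlm) (slope_right dm).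
    near=> y; have xy : x < y by near: y; exact: nbhs_right_gt.
    have yc : y < c1 by near: y; exact: nbhs_right_lt.
    by rewrite lt_eqF// mm.
have El : l = lp * derive1 psip x - rm * derive1 psim x.
  apply: (@cvg_slope_eq x^'- (cdf_at mu) (cdf_at mu \o psip) (cdf_at mu \o psim) x _ _ _ _).
  - near=> y; have yx : y < x by near: y; exact: nbhs_left_lt.
    have := cdf_invariance yx xc; rewrite /slope /= -mulrBl => H; congr (_ * _).
    by lra.
  - exact: sl.
  - apply: slope_comp (increasing_at_left xc cp pm) _ (sl _ _ hlp) (slope_left dp).
    near=> y; have yx : y < x by near: y; exact: nbhs_left_lt.
    by rewrite lt_eqF// pm.
  - apply: slope_comp (decreasing_at_left xc cm mm) _ (sr _ _ hrm) (slope_left dm).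
    near=> y; have yx : y < x by near: y; exact: nbhs_left_lt.
    by rewrite gt_eqF// mm.
move: E Ep Em Er El; set u := derive1 psip x; set v := derive1 psim x.
clearbody u v => E Ep Em Er El.
apply: (@mulfI _ 2); first by rewrite pnatr_eq0.
have -> : 2 * (u * rho (psip x) - v * rho (psim x)) =
    u * (2 * rho (psip x)) - v * (2 * rho (psim x)) by ring.
by rewrite Ep Em E El Er; ring.
Unshelve. all: by end_near. Qed.

End WithMeasure.
End DensityInvariance.

(** * Reduction of the theorem to the Markov setting *)

Theorem theorem5p1 (R : realType) (a c b a0 : R)
    (f psip psim rho0 X phi : R -> R) (n0 n1 : nat)
    (hf : expanding_unimodal a c b f)
    (hrho : invariant_density a c b f rho0)
    (hpsi : inverse_branches a c b f psip psim)
    (ha0 : a0 <= a) (ha0fix : psip a0 = a0)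
    (hX : perturbation_field a b f X)
    (hn0 : (2 <= n0)%N)
    (hn1 : minimal_period f (iter n0 f c) n1)
    (hn0min : forall k : nat, (k < n0)%N -> ~ periodic_point f (iter k f c))
    (hphi : extends_Ck 1 `[a0, b] phi) :
  exists (r : R) (Psi : Cplx R -> Cplx R),
    [/\ 1 < r,
        meromorphic_on (Cdisc r) Psi,
        forall z : Cplx R, `|z| < 1 ->
          susceptibility_partial a0 b c f psip psim rho0 X phi z @ \oo --> Psi z,
        forall (z : Cplx R) (m : nat), `|z| <= 1 -> is_pole Psi z m ->
          m = 1%N /\ z ^+ n1 = 1
      & ((forall k : nat, (n0 <= k)%N -> phi (iter k f c) = 0) /\
          (\int[@lebesgue_measure R]_(x in `[a0, b]) (phi x * rho0 x))%R = 0)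
        \/ (forall k : nat, (1 <= k)%N -> X (iter k f c) = 0) ->
        (forall z : Cplx R, `|z| = 1 -> is_residue Psi z 0) /\
        (fun k : nat => \sum_(0 <= n < k.+1)
           toC (susceptibility_term a0 b c f psip psim rho0 X phi n))
          @ \oo --> Psi 1].
Proof.
have [per0 per1 _] := hn1.
have c21 : f (f c) < f c := lt_trans (c2_lt_c hf) (c_lt_c1 hf).
have ac2 := a_le_c2 hf; have c1b := c1_le_b hf; have a0c2 := le_trans ha0 ac2.
have /andP[ac cb] := eu_order hf.
have [th [La [D mk]]] := induced_markov_map hf hpsi ha0 ha0fix hn0 hn1.
have [A [Cs [ki [C [tau [N db]]]]]] := doeblin_exists mk.
have rout := density_out hrho.
have [mu [muinv muE]] := id_density hrho.
have [M0 HM0] := BVR_bounded (id_BV hrho) (ltW c21) (id_ge0 hrho) rout.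
have Lrho x : x \notin postcritical c f n0 n1 -> transfer (f c) psip psim rho0 x = rho0 x.
  move=> xF; have [xc|cx] := ltP x (f c); first exact: (transfer_density hf hpsi hrho muinv muE xc).
  rewrite rout; first by rewrite /transfer /half_transfer ltNge cx/= addr0.
  rewrite negb_and -!ltNge; apply/orP; right; rewrite lt_neqAle cx andbT.
  by apply: contraNneq xF => <-; exact: (mk_c1F mk).
have rho1 := density_mass rout muE.
have [rhoCl prho rho_lim] := invariant_density_unique mk db HM0 rout (id_regular hrho) Lrho rho1.
have [G CG] := hphi; have [GE [UG [oUG AUG HG]]] := CG.
have a0b : a0 <= b by rewrite (le_trans ha0)// ltW// (lt_trans ac).
have [BG BG0 HBG] := Ck_bounded a0b CG (fun x => id).
have phiG x : a0 <= x <= b -> phi x = G x by move=> xI; rewrite GE//= in_itv.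
have inUG x : a0 <= x <= b -> UG x by move=> xI; apply: AUG; rewrite /= in_itv.
have dGx x : a0 <= x <= b -> is_derive x (1 : R) G (derive1 G x).
  move=> /inUG xU; have [_ /(_ isT) dG] := HG 0%N isT x xU.
  exact: derive1_is_derive dG erefl.
have cdG x : a0 <= x <= b -> {for x, continuous (derive1 G)}.
  by move=> /inUG xU; have [] := HG 1%N isT x xU.
have [GX CX] := pf_C2 hX; have [XE [UX [oUX AUX HX]]] := CX.
(* The field is smooth near the image of [[a, b]]; the decreasing branch alone shows that this image
   contains the core interval. *)
have Kf : `[f (f c), f c]%classic `<=` f @` `[a, b]%classic.
  move=> x; rewrite /= in_itv/= => /andP[x2]; rewrite le_eqVlt => /predU1P[->|x1].
    by exists c => //; rewrite /= in_itv/= !ltW.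
  have [mE|mx] := eqVneq x (f (f c)); first by exists (f c); rewrite ?mE//= in_itv/= c1b (le_trans ac2 (ltW c21)).
  have xK : f (f c) <= psim x <= f c.
    have cx : c < psim x.
      by have := psim_lt hpsi x1 (lexx _); rewrite (psim_c1 hf hpsi).
    have x2' : f (f c) < x by rewrite lt_neqAle eq_sym mx.
    have := psim_lt hpsi x2' (ltW x1); rewrite (psim_c2 hf hpsi) => /ltW ->.
    by rewrite andbT ltW// (lt_trans (c2_lt_c hf)).
  exists (psim x); last exact: (f_psim hf hpsi).
  by move: xK => /andP[h1 h2]; rewrite /= in_itv/= (le_trans ac2 h1) (le_trans h2 c1b).
have [BX BX0 HBX] := Ck_bounded (ltW c21) CX Kf.
have inUX x : f (f c) <= x <= f c -> UX x by move=> xK; apply/AUX/Kf; rewrite /= in_itv.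
have XGX x : f (f c) <= x <= f c -> GX x = X x by move=> xK; apply/XE/Kf; rewrite /= in_itv.
have XB x : f (f c) < x < f c ->
    [/\ `|X x| <= BX, `|derive1 GX x| <= BX & `|derive1 (derive1 GX) x| <= BX].
  move=> /andP[/ltW x2 /ltW x1]; have xK : f (f c) <= x <= f c by rewrite x2.
  split; [|exact: HBX 1%N x isT xK|exact: HBX 2%N x isT xK].
  by rewrite -XGX//; exact: HBX 0%N x isT xK.
have X1 x : f (f c) < x < f c -> is_derive x (1 : R) X (derive1 GX x).
  move=> xK; have /andP[x2 x1] := xK.
  have xU : UX x by apply: inUX; rewrite !ltW.
  have [_ /(_ isT) dG] := HX 0%N isT x xU.
  apply: is_derive_near_eq (derive1_is_derive dG erefl).
  near=> y; apply: esym; apply: XGX.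
  by apply/andP; split; apply: ltW; near: y; [exact: lt_nbhsr|exact: lt_nbhsl].
have X2 x : f (f c) < x < f c -> is_derive x (1 : R) (derive1 GX) (derive1 (derive1 GX) x).
  move=> xK; have /andP[x2 x1] := xK.
  have xU : UX x by apply: inUX; rewrite !ltW.
  have [_ /(_ isT) dG] := HX 1%N isT x xU.
  exact: derive1_is_derive dG erefl.
have Xcont : {within `[f (f c), f c], continuous X}.
  apply: (@subspace_eq_continuous _ _ _ (GX : R -> R)).
    by move=> x /set_mem; rewrite /= in_itv/= /from_subspace => /XGX.
  by apply: continuous_in_subspaceT => x /set_mem/Kf/(Ck_continuous CX).
have [K K0 [HK1 HK2]] := susc_asymptotics mk a0c2 c1b phiG dGx cdG
  (fun x => HBG 0%N x isT) (fun x => HBG 1%N x isT) db rhoCl prho rho1 Lrho rho_lim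
  (pf_bound hX) XB X1 X2 Xcont (postcritical_periodic hn0 hn1).
have [r [Psi [r1 mero cvgP poles res]]] := meromorphic_series per0 K0 (do_tau db) HK1.
exists r, Psi; split => // H; apply: res; apply: HK2.
case: H => [[phi0 int0]|X0]; [left; split|right].
(* The n-th image of a postcritical point, with [n >= n0], is some [c_j] with [j >= n0], where [phi]
   vanishes by assumption. *)
- move=> p n /(postcriticalP hn0 hn1)[k k0 ->] nn; rewrite -iterD.
  have kn : (n0 <= n + k)%N by rewrite (leq_trans nn) ?leq_addr.
  rewrite -phiG ?phi0//; have := iter_core hf (k := (n + k)%N) ltac:(by rewrite addn_gt0 k0 orbT).
  by move=> /andP[h1 h2]; rewrite (le_trans a0c2 h1) (le_trans h2 c1b).
- rewrite /mean -[RHS]int0; apply: eq_Rintegral => x /set_mem; rewrite /= in_itv/= => xI.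
  by rewrite /Gcut xI phiG.
- by move=> p /(postcriticalP hn0 hn1)[k k0 ->]; exact: X0.
Unshelve. all: by end_near. Qed.
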